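(* Let $F=F(X)$ be in $L^2(P)$ with mean zero and variance $\sigma^2>0$. Then $$d_K(\sigma^{-1}F,N)\le \frac{\sqrt{\mathrm{Var}(Z)}}{\sigma^2}+\frac{\sqrt{\mathrm{Var}(\bar Z)}}{\sigma^2}+\frac{7\Big(\sum_{i=1}^\infty\sqrt{E|\mathfrak{D}_iF|^4}\Big)^{1/2}\sum_{i=1}^\infty(E|\mathfrak{D}_iF|^4)^{3/4}}{2\sigma^4}+\frac{\sqrt{2\pi}}{4\sigma^3}\mathcal{L}_3(F)$$ and the right-hand side is in turn bounded by $$\frac{\sqrt{\mathcal{L}_2(Z)}}{\sigma^2}+\frac{\sqrt{\mathcal{L}_2(\bar Z)}}{\sigma^2}+\frac{7\Big(\sum_{i=1}^\infty\sqrt{E|\mathfrak{D}_iF|^4}\Big)^{1/2}\sum_{i=1}^\infty(E|\mathfrak{D}_iF|^4)^{3/4}}{2\sigma^4}+\frac{\sqrt{2\pi}}{4\sigma^3}\mathcal{L}_3(F),$$ where $$Z:=\sum_{i=1}^{\infty}\mathfrak{D}_iF\,E[\mathfrak{D}_iF|\mathcal{F}_i],\qquad \bar Z:=\sum_{i=1}^{\infty}\mathfrak{D}_i\Big(\mathfrak{D}_iF\big(|E[\mathfrak{D}_iF|\mathcal{F}_i]|+E_i|E[\mathfrak{D}_iF|\mathcal{F}_i]|\big)\Big).$$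
   Context: $X=(X_1,X_2,\dots)$ is a sequence of independent random variables (not necessarily identically distributed) on a probability space $(\Omega,\mathfrak{F},P)$ with values in a measurable space $\mathcal{X}$. $F=F(X)$ means that $F$ is a real-valued measurable function of the sequence $X$. $E_i$ denotes the expectation with respect to $X_i$; in particular $E_i[F]=E[F|\sigma(X_k,k\neq i)]$. The difference operators are $\mathfrak{D}_iF=F-E_i[F]$, $i\ge1$, for $F\in L^1(P)$. $\mathcal{F}_i=\sigma(X_k,k\le i)$. Generalized Lyapunov ratio of a random variable $G=G(X)$: $\mathcal{L}_r(G):=\sum_{i=1}^\infty E|\mathfrak{D}_iG|^r$, $r>0$. $N$ is a standard normal random variable and, for a random variable $G$, $d_K(G,N)=\sup_{x\in\mathbb{R}}|P(G\le x)-P(N\le x)|$. *)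

(* Defs.v *)
From HB Require Import structures.
From mathcomp Require Import all_boot all_order all_algebra finmap.
From mathcomp Require Import all_classical all_reals all_analysis.

Set Implicit Arguments.
Unset Strict Implicit.
Unset Printing Implicit Defensive.

Import Order.TTheory GRing.Theory Num.Theory.
Import numFieldNormedType.Exports.

Local Open Scope classical_set_scope.
Local Open Scope ring_scope.

(* sigma(Y_k, k \in K), for an infinite family of maps (the library's
   g_sigma_preimage only covers families indexed by 'I_n). *)
Definition sigma_family d (S : measurableType d) (T : Type)
    (Y : nat -> T -> S) (K : set nat) : set (set T) :=
  <<s \bigcup_(k in K) preimage_set_system setT (Y k) measurable >>.

Definition measurable_wrt (T : Type) d (S : measurableType d)
    (G : set (set T)) (f : T -> S) : Prop :=
  forall B, measurable B -> G (f @^-1` B).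

(* F = f(X_0, X_1, ...) with f measurable for the product sigma-algebra on
   S^nat, i.e. the one generated by the coordinate maps. *)
Definition function_of (T : Type) d (S : measurableType d) (R : realType)
    (X : nat -> T -> S) (F : T -> R) : Prop :=
  exists2 f : (nat -> S) -> R,
    measurable_wrt (sigma_family (fun k (x : nat -> S) => x k) setT) f &
    forall w, F w = f (fun k => X k w).

Section probability_space.
Context d (T : measurableType d) (R : realType) (P : probability T R).

Definition independent_seq d' (S : measurableType d') (X : nat -> T -> S) :
    Prop :=
  forall (J : {fset nat}) (B : nat -> set S), (forall j, measurable (B j)) ->
    P (\bigcap_(j in [set` J]) (X j @^-1` B j)) =
    (\prod_(j <- J) P (X j @^-1` B j))%E.

Definition is_condexp (G : set (set T)) (Y V : T -> R) : Prop :=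
  [/\ measurable_wrt G V,
      P.-integrable setT (EFin \o V) &
      forall A, G A ->
        (\int[P]_(w in A) (V w)%:E = \int[P]_(w in A) (Y w)%:E)%E].

(* A version of E[Y | G]. For integrable Y and a sub-sigma-algebra G a version
   exists and is a.s. unique; 0 is a junk value for the other cases. *)
Definition condexp (G : set (set T)) (Y : T -> R) : T -> R :=
  xget (fun=> 0) [set V | is_condexp G Y V].

(* Kolmogorov distance; the two variables may live on different spaces. *)
Definition kolmogorov_dist d' (T' : measurableType d')
    (Q : probability T' R) (G : {RV P >-> R}) (N : {RV Q >-> R}) : \bar R :=
  ereal_sup (range (fun x : R => `|cdf G x - cdf N x|%E)).

Section difference_operators.
Context d' (S : measurableType d') (X : nat -> T -> S).

(* Indices start at 0: the variable X k is the mathematical X_{k+1}. *)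

Definition Ei (i : nat) (Y : T -> R) : T -> R :=
  condexp (sigma_family X [set k | k != i]) Y.

Definition Di (i : nat) (Y : T -> R) : T -> R := fun w => Y w - Ei i Y w.

(* E[Y | F_i] with F_i = sigma(X_k, k <= i). *)
Definition Efilt (i : nat) (Y : T -> R) : T -> R :=
  condexp (sigma_family X [set k | (k <= i)%N]) Y.

Definition lyapunov (r : R) (G : T -> R) : \bar R :=
  (\sum_(0 <= i <oo) 'E_P[fun w => (`|Di i G w| `^ r)%R])%E.

Definition moment4 (i : nat) (F : T -> R) : \bar R :=
  ('E_P[fun w => (`|Di i F w| ^+ 4)%R])%E.

(* The two series below are pointwise limits of partial sums. When the sum of
   the square roots of the fourth moments of the D_i F is finite they converge
   absolutely, a.s. and in L^1. For non-constant F in L^2 and an infinite such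
   sum, the bounds in which they occur are +oo whatever the (junk) value of
   limn at points of divergence. *)

Definition Zseries (F : T -> R) : T -> R := fun w =>
  limn (fun n => \sum_(0 <= i < n) Di i F w * Efilt i (Di i F) w).

Definition Zbar_term (F : T -> R) (i : nat) : T -> R :=
  let V := fun w => `|Efilt i (Di i F) w| in
  Di i (fun w => Di i F w * (V w + Ei i V w)).

Definition Zbar_series (F : T -> R) : T -> R := fun w =>
  limn (fun n => \sum_(0 <= i < n) Zbar_term F i w).

End difference_operators.
End probability_space.

(* Main.v *)
Require Import Defs.
From HB Require Import structures.
From mathcomp Require Import all_boot all_order all_algebra finmap.
From mathcomp Require Import all_classical all_reals all_analysis.
From mathcomp Require Import measurable_realfun ring lra.

(* Let G = F / sigma and let f solve Stein's equation
   f'(w) - w f(w) = 1{w <= z} - Phi(z). Then P(G <= z) - Phi(z) =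
   E[f'(G)] - E[G f(G)], and F is the L1-sum of the martingale increments
   M_i = E[D_i F | F_i]. As E_i M_i = 0, E[M_i f(G)] = E[M_i (f(G) - f(G_i'))]
   where G_i' is G with X_i replaced by an independent copy. Expanding f to first
   order at G, the linear parts sum to E[Z f'(G)]; the jump of f' at z contributes,
   by exchangeability of X_i and its copy, at most E[1{G > z} Zbar]; the rest is at
   most E|M_i| (|G| + 3/2) (G - G_i')^2 / 2, bounded by Hoelder with
   ||F||_4^2 <= 4 sum_i ||D_i F||_4^2. The crude bound 0 <= f <= 3/2 in place of
   the optimal sqrt(2 pi) / 4 suffices: because sigma^2 <= sum_i ||D_i F||_4^2, the
   terms of third order fit under the constant 7/2, and the term with L_3(F) is only
   used through its nonnegativity.

   Conditional expectations are taken on the space of sequences with the law of X,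
   where E[h | X_k, k in K] integrates h over independent copies of the
   coordinates outside K. *)

Import Order.TTheory GRing.Theory Num.Theory.
Import numFieldNormedType.Exports.

Local Open Scope classical_set_scope.
Local Open Scope ring_scope.
Set Implicit Arguments.
Unset Strict Implicit.
Unset Printing Implicit Defensive.

(** * Stein's equation for the Kolmogorov distance *)

Section gaussian.
Context {R : realType}.
Local Notation leb := (@lebesgue_measure R).
Local Notation pdf := (@normal_pdf R 0 1).

(** Independence enters through one invariance: exchanging the coordinates outside K between two
    independent sequences x and y preserves their joint law. Its first component says that
    [sp K x y] again has the law of X, which gives the calculus of conditional expectations; the
    pair, with K all indices but i, is the exchangeability behind the jump term. The conditional
    expectations so obtained ignore the coordinates outside K everywhere, but are additive only
    where the slices are integrable, hence the many a.e. statements.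

    The obstacle is the infinite sequence: Z and Zbar are known only to be integrable, and the
    fourth moment of F has to be derived from those of the D_i F. One device serves both: functions
    of finitely many coordinates are dense in L1, projections contract L1, and even moments are
    lower semicontinuous under L1 convergence. So a moment bound uniform over the projections passes
    to the limit and yields membership in L2 or L4 at the same time. An infinite remainder makes the
    bounds trivial; a finite one supplies all the summability that is used. *)

Definition Phi (x : R) : R := fine (normal_prob 0 1 `]-oo, x]).

Lemma pdfE (x : R) : pdf x = (Num.sqrt (2 * pi))^-1 * expR (- (x ^+ 2 / 2)).
Proof.
rewrite normal_pdfE ?oner_eq0// /normal_peak /normal_fun; congr (_^-1 * expR _).
  by congr Num.sqrt; rewrite expr1n mul1r mulr_natl.
by rewrite subr0 expr1n; rewrite mulNr.
Qed.

Lemma sqrt2pi_gt0 : 0 < Num.sqrt (2 * pi) :> R.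
Proof. by rewrite sqrtr_gt0 mulr_gt0// pi_gt0. Qed.

Lemma pdf_gt0 (x : R) : 0 < pdf x.
Proof. by rewrite pdfE mulr_gt0 ?expR_gt0// invr_gt0 sqrt2pi_gt0. Qed.

Lemma pdfN (x : R) : pdf (- x) = pdf x.
Proof. by rewrite !pdfE sqrrN. Qed.

Lemma is_derive_pdf (x : R) : is_derive x 1 pdf (- x * pdf x).
Proof.
rewrite (_ : pdf = fun y => (Num.sqrt (2 * pi))^-1 * expR (- (y ^+ 2 / 2))); last first.
  by apply/funext => y; rewrite pdfE.
apply: is_derive_eq.
rewrite /GRing.scale/=.
set e := expR _. set s := (Num.sqrt _)^-1.
by field.
Qed.

Lemma is_derive_Phi (x : R) : is_derive x 1 Phi (pdf x).
Proof.
have [] := @continuous_FTC1 R pdf -oo%O x (x + 1).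
- by rewrite ltrDl.
- by apply: (integrableS _ _ (subsetT _)) => //; exact: integrable_normal_pdf.
- by rewrite ltNyr.
- exact: continuous_normal_pdf.
move=> dP eP; apply: DeriveDef; first exact: dP.
by rewrite -derive1E; exact: eP.
Qed.

Lemma integral_pdfy (x : R) :
  (\int[leb]_(t in `[x, +oo[) (pdf t)%:E)%E = (1 - Phi x)%:E.
Proof.
rewrite EFinB /Phi fineK ?fin_num_measure// -probability_setC// setCitvl.
rewrite -integral_itv_obnd_cbnd//; apply/measurable_EFinP.
by apply: measurable_funTS; exact: measurable_normal_pdf.
Qed.

Lemma PhiN (x : R) : Phi (- x) = 1 - Phi x.
Proof.
apply: EFin_inj; rewrite -integral_pdfy /Phi fineK ?fin_num_measure//.
rewrite /normal_prob ge0_integration_by_substitutionNy.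
- by apply: eq_integral => t _ /=; rewrite pdfN.
- by apply: continuous_subspaceT; exact: continuous_normal_pdf.
- by move=> t _; exact: normal_pdf_ge0.
Qed.

Lemma Phi_ge0 (x : R) : 0 <= Phi x.
Proof. exact: fine_ge0. Qed.

Lemma Phi_le1 (x : R) : Phi x <= 1.
Proof. by rewrite -subr_ge0 -PhiN Phi_ge0. Qed.

Lemma cvg_pdfy : pdf x @[x --> +oo] --> (0 : R).
Proof.
apply: (@squeeze_cvgr _ _ _ _ (fun=> 0) (fun x => gauss_fun (x / 2))).
(* [gauss_fun (x / 2)] is exp(- x^2 / 4), above exp(- x^2 / 2), and the normalising factor is at
   most 1. *)
- near=> x; rewrite ltW ?pdf_gt0//= pdfE /gauss_fun -[leRHS]mul1r.
  apply: ler_pM; rewrite ?invr_ge0 ?sqrtr_ge0 ?expR_ge0//.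
    rewrite invf_le1 ?sqrt2pi_gt0// -[leLHS]sqrtr1 ler_sqrt.
    - by have := @pi_ge2 R; lra.
    - by have := @pi_ge2 R; lra.
  by rewrite ler_expR; nra.
- exact: cvg_cst.
- have h : (fun x : R => x / 2) @ +oo --> +oo by apply: gt0_cvgMly => //; rewrite ?invr_gt0.
  by apply: (cvg_comp _ _ h); exact: cvg_gauss_fun.
Unshelve. all: by end_near. Qed.

(** For x > 0, x pdf(t) <= t pdf(t) on t >= x, and the right-hand side is the derivative of - pdf,
    whose integral over [x, +oo[ is pdf(x). *)
Lemma mills (x : R) : x * (1 - Phi x) <= pdf x.
Proof.
have [x0|x0] := leP x 0.
  apply: (@le_trans _ _ 0); last exact/ltW/pdf_gt0.
  by rewrite mulr_le0_ge0// subr_ge0 Phi_le1.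
rewrite -lee_fin EFinM -integral_pdfy.
have mpdf D : measurable_fun D (EFin \o pdf).
  by apply/measurable_EFinP; apply: measurable_funTS; exact: measurable_normal_pdf.
rewrite -ge0_integralZl//=; last by rewrite lee_fin ltW.
  suff -> : (pdf x)%:E = (\int[leb]_(t in `[x, +oo[) (t * pdf t)%:E)%E.
    apply: ge0_le_integral => //=.
    - by move=> t _; rewrite mule_ge0// lee_fin ?normal_pdf_ge0// ltW.
    - by apply: measurable_funeM; exact: mpdf.
    - apply/measurable_EFinP/measurable_funM => //.
      by apply: measurable_funTS; exact: measurable_normal_pdf.
    move=> t /=; rewrite in_itv/= andbT => xt.
    by rewrite -EFinM lee_fin ler_wpM2r// normal_pdf_ge0.
  rewrite (@ge0_continuous_FTC2y _ _ (fun t => - pdf t) _ 0)//.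
  - by rewrite sub0e -EFinN opprK.
  - move=> t xt; rewrite mulr_ge0 ?normal_pdf_ge0//; exact/ltW/(lt_le_trans x0).
  - apply: continuous_subspaceT => t; apply: cvgM; first exact: cvg_id.
    exact: continuous_normal_pdf.
  - by rewrite -[X in _ --> X]oppr0; apply: cvgN; exact: cvg_pdfy.
  - by move=> t _; apply: derivableN; case: (is_derive_pdf t).
  - have cp := @continuous_normal_pdf R 0 1 (oner_neq0 _) x.
    by apply: cvgN; exact: (cvg_at_right_filter cp).
  - move=> t _; rewrite derive1E deriveN; last by case: (is_derive_pdf t).
    by have [_ ->] := is_derive_pdf t; rewrite mulNr opprK.
- exact: mpdf.
- by move=> t _; rewrite lee_fin normal_pdf_ge0.
Qed.


(** By symmetry, the usual Mills ratio at - w. It solves m' = 1 + w m, so constant multiples of m(w)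
    and m(- w) solve Stein's equation to the left and to the right of z. *)
Definition mills_ratio (w : R) : R := Phi w / pdf w.

Lemma mills_ratio_ge0 (w : R) : 0 <= mills_ratio w.
Proof. by rewrite divr_ge0 ?Phi_ge0// ltW ?pdf_gt0. Qed.

Lemma mills_ratio_deriv_ge0 (w : R) : 0 <= 1 + w * mills_ratio w.
Proof.
rewrite -(pmulr_lge0 _ (pdf_gt0 w)) mulrDl mul1r /mills_ratio mulrA divfK ?gt_eqF ?pdf_gt0//.
have := mills (- w); rewrite PhiN pdfN; lra.
Qed.

Lemma is_derive_mills_ratio (w : R) :
  is_derive w 1 mills_ratio (1 + w * mills_ratio w).
Proof.
have p0 : pdf w != 0 by rewrite gt_eqF ?pdf_gt0.
have dP := is_derive_Phi w; have dp := is_derive_pdf w.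
have dV := @is_deriveV _ pdf w _ 1 p0 dp.
have := is_deriveM dP dV.
rewrite /mills_ratio /GRing.scale/= => h; apply: is_derive_eq h _.
by field.
Qed.

Lemma is_derive_ndecr (f df : R -> R) (a b : R) : a <= b ->
  (forall x, x \in `[a, b] -> is_derive x 1 f (df x)) ->
  (forall x, x \in `[a, b] -> 0 <= df x) -> f a <= f b.
Proof.
move=> ab fdf df0.
have fdfo x : x \in `]a, b[ -> is_derive x 1 f (df x).
  by move=> xab; apply: fdf; exact: subset_itv_oo_cc.
have cf : {within `[a, b], continuous f}.
  by apply: derivable_within_continuous => x xab; have [] := fdf x xab.
have [c cab] := MVT_segment ab fdfo cf.
by move=> e; rewrite -subr_ge0 e mulr_ge0 ?df0// subr_ge0.
Qed.

Lemma mills_ratio_ndecr (v w : R) : v <= w -> mills_ratio v <= mills_ratio w.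
Proof.
move=> vw; apply: (is_derive_ndecr vw) => x _.
  exact: is_derive_mills_ratio.
exact: mills_ratio_deriv_ge0.
Qed.

Lemma mills_ratio0 : mills_ratio 0 = Num.sqrt (2 * pi) / 2.
Proof.
have := PhiN 0; rewrite oppr0 => P0; have {}P0 : Phi 0 = 1 / 2 by lra.
rewrite /mills_ratio P0 pdfE expr0n/= mul0r oppr0 expR0 mulr1 invrK; ring.
Qed.

Section stein_solution.
Variable z : R.

Definition stein_sol (w : R) : R :=
  if w <= z then mills_ratio w * (1 - Phi z) else mills_ratio (- w) * Phi z.

(** Read off from Stein's equation, which therefore holds at every w; at the kink z this selects the
    left derivative. *)
Definition stein_deriv (w : R) : R :=
  w * stein_sol w + (w <= z)%R%:R - Phi z.

Lemma stein_sol_z : mills_ratio z * (1 - Phi z) = mills_ratio (- z) * Phi z.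
Proof. by rewrite /mills_ratio PhiN pdfN; ring. Qed.

Lemma stein_sol_ge (w : R) : z <= w -> stein_sol w = mills_ratio (- w) * Phi z.
Proof.
rewrite /stein_sol le_eqVlt => /predU1P[<-|zw]; first by rewrite lexx stein_sol_z.
by rewrite leNgt zw.
Qed.

Lemma stein_sol_le (w : R) : w <= z -> stein_sol w = mills_ratio w * (1 - Phi z).
Proof. by rewrite /stein_sol => ->. Qed.

Lemma stein_sol_ge0 (w : R) : 0 <= stein_sol w.
Proof.
by rewrite /stein_sol; case: ifP => _; rewrite mulr_ge0 ?mills_ratio_ge0 ?subr_ge0 ?Phi_le1 ?Phi_ge0.
Qed.

Lemma stein_sol_le_z (w : R) : stein_sol w <= mills_ratio z * (1 - Phi z).
Proof.
have [wz|zw] := leP w z.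
  by rewrite stein_sol_le// ler_wpM2r ?subr_ge0 ?Phi_le1// mills_ratio_ndecr.
rewrite (stein_sol_ge (ltW zw)) stein_sol_z ler_wpM2r ?Phi_ge0// mills_ratio_ndecr//.
by rewrite lerN2 ltW.
Qed.

(** The maximum is attained at z, where one of the two expressions involves the Mills ratio at a
    nonpositive argument, so it is at most its value sqrt(2 pi) / 2 at 0. The round constant 3/2
    needs no more than pi < 4. *)
Lemma stein_sol_ub (w : R) : stein_sol w <= 3 / 2.
Proof.
apply: le_trans (stein_sol_le_z w) _; apply: (@le_trans _ _ (mills_ratio 0)).
  have [z0|z0] := leP z 0.
    rewrite -[leRHS]mulr1 ler_pM ?mills_ratio_ge0 ?subr_ge0 ?Phi_le1//.
      exact: mills_ratio_ndecr.
    by have := Phi_ge0 z; lra.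
  rewrite stein_sol_z -[leRHS]mulr1 ler_pM ?mills_ratio_ge0 ?Phi_ge0 ?Phi_le1//.
  by apply: mills_ratio_ndecr; rewrite oppr_le0 ltW.
rewrite mills_ratio0 ler_pM2r ?invr_gt0// -[leRHS]ger0_norm// -sqrtr_sqr.
rewrite ler_sqrt ?exprn_ge0//.
have := @pihalf_lt2 R; rewrite expr2; lra.
Qed.

(** To the right of z this is 1 - w m(- w) >= 0, with m the Mills ratio; for 0 < w <= z both factors
    are at most their values at z. *)
Lemma stein_sol_wub (w : R) : w * stein_sol w <= Phi z.
Proof.
have [w0|w0] := leP w 0.
  by apply: (@le_trans _ _ 0); rewrite ?Phi_ge0// mulr_le0_ge0 ?stein_sol_ge0.
have [wz|zw] := leP w z.
  apply: (@le_trans _ _ (z * (mills_ratio z * (1 - Phi z)))).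
    by rewrite ler_pM ?stein_sol_ge0 ?stein_sol_le_z// ltW.
  rewrite stein_sol_z mulrA -[leRHS]mul1r ler_wpM2r ?Phi_ge0//.
  by have := mills_ratio_deriv_ge0 (- z); lra.
rewrite (stein_sol_ge (ltW zw)) mulrA -[leRHS]mul1r ler_wpM2r ?Phi_ge0//.
by have := mills_ratio_deriv_ge0 (- w); lra.
Qed.

Lemma stein_sol_wlb (w : R) : Phi z - 1 <= w * stein_sol w.
Proof.
have [w0|w0] := leP 0 w.
  apply: (@le_trans _ _ 0); last by rewrite mulr_ge0 ?stein_sol_ge0.
  by have := Phi_le1 z; lra.
rewrite -(opprB 1) lerNl -mulNr.
have [wz|zw] := leP w z.
  rewrite stein_sol_le// mulrA -[leRHS]mul1r ler_wpM2r ?subr_ge0 ?Phi_le1//.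
  by have := mills_ratio_deriv_ge0 w; lra.
apply: (@le_trans _ _ (- z * (mills_ratio z * (1 - Phi z)))).
  by rewrite ler_pM ?stein_sol_ge0 ?stein_sol_le_z// ?oppr_ge0 ?lerN2 ltW.
rewrite mulrA -[leRHS]mul1r ler_wpM2r ?subr_ge0 ?Phi_le1//.
by have := mills_ratio_deriv_ge0 z; lra.
Qed.

Lemma stein_deriv_le1 (w : R) : `|stein_deriv w| <= 1.
Proof.
rewrite ler_norml /stein_deriv.
have := stein_sol_wub w; have := stein_sol_wlb w.
have := Phi_ge0 z; have := Phi_le1 z.
have [wz|zw] := leP w z; last by rewrite mulr0n; lra.
have : 0 <= (1 - Phi z) * (1 + w * mills_ratio w).
  by rewrite mulr_ge0 ?mills_ratio_deriv_ge0// subr_ge0 Phi_le1.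
have -> : (1 - Phi z) * (1 + w * mills_ratio w) = 1 - Phi z + w * stein_sol w.
  by rewrite stein_sol_le//; ring.
by rewrite mulr1n; lra.
Qed.

Lemma stein_eq (w : R) : stein_deriv w - w * stein_sol w = (w <= z)%R%:R - Phi z.
Proof. by rewrite /stein_deriv; ring. Qed.


(** The derivative of [stein_sol] minus min(w, z): subtracting the minimum cancels the jump at z and
    leaves a function with a Lipschitz bound. *)
Let drift (w : R) : R := w * stein_sol w - Phi z.

(** With s = 1 or -1 and p a polynomial, monotonicity of s f + p is a one-sided bound on the
    increments of f. Such bounds can be proved on each side of z and glued there, where f is not
    differentiable. *)
Lemma stein_sol_ndecr_left (s : R) (p dp : R -> R) (a b : R) :
  a <= b -> b <= z -> (forall v : R, is_derive v 1 p (dp v)) ->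
  (forall v, a <= v <= b -> 0 <= s * (drift v + 1) + dp v) ->
  s * stein_sol a + p a <= s * stein_sol b + p b.
Proof.
move=> ab bz dpE h.
rewrite !stein_sol_le//; last exact: le_trans bz.
pose g v := s * (mills_ratio v * (1 - Phi z)) + p v.
apply: (@is_derive_ndecr g (fun v => s * (drift v + 1) + dp v) a b ab); last first.
  by move=> v; rewrite in_itv/= => /h.
move=> v; rewrite in_itv/= => /andP[av vb].
have dm := is_derive_mills_ratio v; have dpv := dpE v.
rewrite /g; apply: is_derive_eq.
rewrite /drift stein_sol_le ?(le_trans vb)// /GRing.scale/=; ring.
Qed.

Lemma stein_sol_ndecr_right (s : R) (p dp : R -> R) (a b : R) :
  a <= b -> z <= a -> (forall v : R, is_derive v 1 p (dp v)) ->
  (forall v, a <= v <= b -> 0 <= s * drift v + dp v) ->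
  s * stein_sol a + p a <= s * stein_sol b + p b.
Proof.
move=> ab za dpE h.
rewrite !stein_sol_ge//; last exact: le_trans ab.
pose g v := s * (mills_ratio (- v) * Phi z) + p v.
apply: (@is_derive_ndecr g (fun v => s * drift v + dp v) a b ab); last first.
  by move=> v; rewrite in_itv/= => /h.
move=> v; rewrite in_itv/= => /andP[av vb].
have dm := is_derive_mills_ratio (- v); have dpv := dpE v.
have dN : is_derive v 1 (fun v : R => - v) (- 1) by apply: is_derive_eq.
have dmN := @is_derive1_comp _ mills_ratio (fun v : R => - v) v _ _ dm dN.
rewrite /g; apply: is_derive_eq.
rewrite /drift stein_sol_ge ?(le_trans za)// /GRing.scale/=; ring.
Qed.

Lemma stein_sol_min_ndecr (s : R) (p dp : R -> R) (a b : R) :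
  a <= b -> (forall v : R, is_derive v 1 p (dp v)) ->
  (forall v, a <= v <= b -> 0 <= s * drift v + dp v) ->
  s * (stein_sol a - Num.min a z) + p a <= s * (stein_sol b - Num.min b z) + p b.
Proof.
move=> ab dpE h.
have L u v : a <= u -> u <= v -> v <= b -> v <= z ->
    s * (stein_sol u - Num.min u z) + p u <= s * (stein_sol v - Num.min v z) + p v.
  move=> au uv vb vz; rewrite !min_l//; last exact: le_trans vz.
  suff : s * stein_sol u + (p u - s * u) <= s * stein_sol v + (p v - s * v) by lra.
  apply: (@stein_sol_ndecr_left s (fun t => p t - s * t) (fun t => dp t - s)) => //.
    move=> t; have dpt := dpE t; apply: is_derive_eq.
    by rewrite /GRing.scale/= mulr1.
  move=> t /andP[ut tv]; have := h t.
  by rewrite (le_trans au ut) (le_trans tv vb) => /(_ isT); lra.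
have G u v : a <= u -> u <= v -> v <= b -> z <= u ->
    s * (stein_sol u - Num.min u z) + p u <= s * (stein_sol v - Num.min v z) + p v.
  move=> au uv vb zu; rewrite !min_r//; last exact: le_trans uv.
  suff : s * stein_sol u + p u <= s * stein_sol v + p v by lra.
  apply: (@stein_sol_ndecr_right s p dp) => //.
  by move=> t /andP[ut tv]; apply: h; rewrite (le_trans au ut) (le_trans tv vb).
have /orP[bz|zb] := le_total b z; first by apply: (L a b).
have /orP[za|az] := le_total z a; first by apply: (G a b).
by apply: (le_trans (L a z _ _ _ _)) => //; apply: (G z b).
Qed.

Lemma stein_sol_shift (s a b : R) : `|s| = 1 -> a <= b ->
  s * stein_sol a + a <= s * stein_sol b + b.
Proof.
move=> s1 ab.
have hs (v : R) (c : R) : 0 <= c -> c <= 1 -> 0 <= s * c + 1.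
  move=> c0 c1; have : - (s * c) <= `|s * c| by rewrite -normrN ler_norm.
  by rewrite normrM s1 mul1r (ger0_norm c0); lra.
have hsN (v : R) (c : R) : - 1 <= c -> c <= 0 -> 0 <= s * c + 1.
  move=> c0 c1; have : - (s * c) <= `|s * c| by rewrite -normrN ler_norm.
  by rewrite normrM s1 mul1r (ler0_norm c1); lra.
have L u v : u <= v -> v <= z -> s * stein_sol u + u <= s * stein_sol v + v.
  move=> uv vz; apply: (@stein_sol_ndecr_left s id (fun=> 1)) => // t _.
  by apply: hs => //; have := stein_sol_wlb t; have := stein_sol_wub t; rewrite /drift; lra.
have G u v : u <= v -> z <= u -> s * stein_sol u + u <= s * stein_sol v + v.
  move=> uv vz; apply: (@stein_sol_ndecr_right s id (fun=> 1)) => // t _.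
  by apply: hsN => //; have := stein_sol_wlb t; have := stein_sol_wub t; rewrite /drift; lra.
have /orP[bz|zb] := le_total b z; first exact: L.
have /orP[za|az] := le_total z a; first exact: G.
by apply: (le_trans (L a z _ _)) => //; exact: G.
Qed.

Lemma stein_sol_lip (a b : R) : `|stein_sol a - stein_sol b| <= `|a - b|.
Proof.
wlog ab : a b / a <= b.
  by move=> H; have [/H//|/ltW/H] := leP a b; rewrite distrC (distrC b).
have := @stein_sol_shift 1 a b (normr1 _) ab.
have := @stein_sol_shift (-1) a b; rewrite normrN1 => /(_ erefl ab).
rewrite (ler0_norm (_ : a - b <= 0)) ?subr_le0// ler_norml; lra.
Qed.

(** The splitting puts the weight on w alone, so that after integration it involves G and never its
    resampled copy. *)
Lemma drift_lip (w v : R) : `|drift v - drift w| <= (`|w| + 3 / 2) * `|v - w|.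
Proof.
have -> : drift v - drift w = (v - w) * stein_sol v + w * (stein_sol v - stein_sol w).
  by rewrite /drift; ring.
apply: le_trans (ler_normD _ _) _; rewrite !normrM mulrDl addrC lerD//.
  by rewrite ler_wpM2l// stein_sol_lip.
by rewrite mulrC ler_wpM2r// ger0_norm ?stein_sol_ge0// stein_sol_ub.
Qed.

(** By [drift_lip], adding to s (f - min) the linear function - s drift(w) x and a parabola of
    curvature K or - K centred at w gives a nondecreasing function between w and v. The sign k of
    the parabola depends on the order of w and v; comparing end points for s = 1 and s = -1 gives
    both halves. *)
Lemma stein_taylor_min (w v : R) :
  `|stein_sol w - Num.min w z - (stein_sol v - Num.min v z) - (w - v) * drift w|
  <= (`|w| + 3 / 2) * (w - v) ^+ 2 / 2.
Proof.
set K := `|w| + 3 / 2.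
have dq (s k : R) (t : R) : is_derive t 1
    (fun x => - (s * drift w * x) + k * K * (x - w) ^+ 2 / 2)
    (- (s * drift w) + k * K * (t - w)).
  apply: is_derive_eq; rewrite /GRing.scale/=; by field.
have dl t := drift_lip w t.
have key (s : R) : `|s| = 1 ->
    s * (stein_sol w - Num.min w z - (stein_sol v - Num.min v z) - (w - v) * drift w)
    <= K * (w - v) ^+ 2 / 2.
  move=> s1.
  have dl' t : s * (drift w - drift t) <= K * `|t - w|.
    apply: le_trans (dl t); rewrite distrC.
    by apply: (le_trans (ler_norm _)); rewrite normrM s1 mul1r.
  have /orP[wv|vw] := le_total w v.
    have := @stein_sol_min_ndecr s _ _ w v wv (dq s 1).
    have h t : w <= t <= v -> 0 <= s * drift t + (- (s * drift w) + 1 * K * (t - w)).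
      move=> /andP[wt _]; have := dl' t.
      by rewrite ger0_norm ?subr_ge0//; lra.
    by move=> /(_ h); rewrite subrr expr0n/= mulr0 mul0r addr0; lra.
  have dl'' t : - s * (drift w - drift t) <= K * `|t - w|.
    apply: le_trans (dl t); rewrite distrC.
    by apply: (le_trans (ler_norm _)); rewrite normrM normrN s1 mul1r.
  have := @stein_sol_min_ndecr (- s) _ _ v w vw (dq (- s) (- 1)).
  have h t : v <= t <= w -> 0 <= - s * drift t + (- (- s * drift w) + - 1 * K * (t - w)).
    move=> /andP[_ tw]; have := dl'' t.
    by rewrite ler0_norm ?subr_le0//; lra.
  by move=> /(_ h); rewrite subrr expr0n/= mulr0 mul0r addr0; lra.
have := key 1 (normr1 _); have := key (- 1); rewrite normrN1 => /(_ erefl).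
by rewrite ler_norml; lra.
Qed.

(** The expansion of min(., z) that is added back is exact unless z separates w and v, where its
    error is at most |w - v|. This is the product with the difference of indicators, which is
    nonnegative and antisymmetric in each factor, the form that resampling can exploit. *)
Lemma stein_taylor (w v : R) :
  `|stein_sol w - stein_sol v - (w - v) * stein_deriv w|
  <= (`|w| + 3 / 2) * (w - v) ^+ 2 / 2 +
     (w - v) * ((z < w)%R%:R - (z < v)%R%:R).
Proof.
have := stein_taylor_min w v.
set K := (_ + _) * _ / 2.
set A := (X in `|X| <= K -> _) => AK.
pose B := Num.min w z - Num.min v z - (w - v) * (w <= z)%R%:R.
have -> : stein_sol w - stein_sol v - (w - v) * stein_deriv w = A + B.
  by rewrite /A /B /drift /stein_deriv; ring.
apply: le_trans (ler_normD _ _) _; rewrite lerD// /B.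
have [wz|zw] := leP w z; have [vz|zv] := leP v z; rewrite ?mulr0n ?mulr1n ler_norml; lra.
Qed.

Lemma measurable_stein_sol : measurable_fun setT stein_sol.
Proof.
apply: continuous_measurable_fun => x.
apply/cvgrPdist_le => e e0; near=> y.
apply: le_trans (stein_sol_lip x y) _; near: y.
by apply: (@cvgr_dist_le _ _ _ (nbhs x) _ id x) => //; exact: cvg_id.
Unshelve. all: by end_near. Qed.

Lemma measurable_stein_deriv : measurable_fun setT stein_deriv.
Proof.
apply: measurable_funB => //; apply: measurable_funD.
  by apply: measurable_funM => //; exact: measurable_stein_sol.
rewrite (_ : (fun w => _) = \1_(`]-oo, z])); first exact: measurable_indic.
by apply/funext => w; rewrite indicE mem_setE in_itv.
Qed.

End stein_solution.
End gaussian.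

(** * Moments on a probability space *)

Section moments.
Context d (T : measurableType d) (R : realType) (P : probability T R).
Implicit Types f g h k b u v : T -> R.

Definition Lpow (n : nat) f :=
  measurable_fun setT f /\ P.-integrable setT (EFin \o (fun x => f x ^+ n)).

Definition Ex f : R := Rintegral P setT f.

Lemma integrable_le f g : measurable_fun setT f ->
  P.-integrable setT (EFin \o g) -> (forall x, `|f x| <= g x) ->
  P.-integrable setT (EFin \o f).
Proof.
move=> mf ig fg; apply: (le_integrable measurableT _ _ ig) => //.
  exact/measurable_EFinP.
by move=> x _ /=; rewrite lee_fin (le_trans (fg x))// ler_norm.
Qed.

Lemma Lpow1P f : Lpow 1 f <-> P.-integrable setT (EFin \o f).
Proof.
split=> [[_]|fi]; first by under eq_fun do rewrite expr1.
split; first by apply/measurable_EFinP; exact: measurable_int fi.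
by under eq_fun do rewrite expr1.
Qed.

Lemma integrable_measurable f : P.-integrable setT (EFin \o f) -> measurable_fun setT f.
Proof. by move=> fi; apply/measurable_EFinP; exact: measurable_int fi. Qed.

Lemma integrable_cst (r : R) : P.-integrable setT (EFin \o (fun=> r)).
Proof. exact: finite_measure_integrable_cst. Qed.

Lemma L1D f g : P.-integrable setT (EFin \o f) -> P.-integrable setT (EFin \o g) ->
  P.-integrable setT (EFin \o (fun x => f x + g x)).
Proof. by move=> fi gi; exact: (integrableD measurableT fi gi). Qed.

Lemma L1N f : P.-integrable setT (EFin \o f) ->
  P.-integrable setT (EFin \o (fun x => - f x)).
Proof. by move=> fi; exact: (integrableN fi). Qed.

Lemma L1B f g : P.-integrable setT (EFin \o f) -> P.-integrable setT (EFin \o g) ->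
  P.-integrable setT (EFin \o (fun x => f x - g x)).
Proof. by move=> fi gi; apply: L1D => //; exact: L1N. Qed.

Lemma L1Zl r f : P.-integrable setT (EFin \o f) ->
  P.-integrable setT (EFin \o (fun x => r * f x)).
Proof. by move=> fi; exact: (integrableZl measurableT r fi). Qed.

Lemma L1_norm f : P.-integrable setT (EFin \o f) ->
  P.-integrable setT (EFin \o (fun x => `|f x|)).
Proof. exact: integrable_norm. Qed.

Lemma L1_bounded_mul b f (B : R) : measurable_fun setT b -> (forall x, `|b x| <= B) ->
  P.-integrable setT (EFin \o f) -> P.-integrable setT (EFin \o (fun x => b x * f x)).
Proof.
move=> mb bB fi; apply: (@integrable_le _ (fun x => B * `|f x|)).
- by apply: measurable_funM => //; exact: integrable_measurable.
- exact/L1Zl/L1_norm.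
- by move=> x; rewrite normrM ler_wpM2r.
Qed.

Lemma L1_sum (I : Type) (s : seq I) (F : I -> T -> R) :
  (forall i, P.-integrable setT (EFin \o F i)) ->
  P.-integrable setT (EFin \o (fun x => \sum_(i <- s) F i x)).
Proof.
move=> Fi; elim: s => [|i s IH].
  by under eq_fun do rewrite big_nil; exact: integrable_cst.
by under eq_fun do rewrite big_cons; exact: L1D.
Qed.

Lemma ExE f : P.-integrable setT (EFin \o f) -> ((Ex f)%:E = \int[P]_x (f x)%:E)%E.
Proof. by move=> fi; rewrite /Ex /Rintegral fineK//; exact: integrable_fin_num. Qed.

Lemma ExD f g : P.-integrable setT (EFin \o f) -> P.-integrable setT (EFin \o g) ->
  Ex (fun x => f x + g x) = Ex f + Ex g.
Proof. by move=> fi gi; rewrite /Ex RintegralD. Qed.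

Lemma ExB f g : P.-integrable setT (EFin \o f) -> P.-integrable setT (EFin \o g) ->
  Ex (fun x => f x - g x) = Ex f - Ex g.
Proof. by move=> fi gi; rewrite /Ex RintegralB. Qed.

Lemma ExZl r f : P.-integrable setT (EFin \o f) -> Ex (fun x => r * f x) = r * Ex f.
Proof. by move=> fi; rewrite /Ex RintegralZl. Qed.

Lemma Ex_cst r : Ex (fun=> r) = r.
Proof. by rewrite /Ex Rintegral_cst//= probability_setT mulr1. Qed.

Lemma Ex_sum (I : Type) (s : seq I) (F : I -> T -> R) :
  (forall i, P.-integrable setT (EFin \o F i)) ->
  Ex (fun x => \sum_(i <- s) F i x) = \sum_(i <- s) Ex (F i).
Proof.
move=> Fi; elim: s => [|i s IH].
  by under [X in Ex X]eq_fun do rewrite big_nil; rewrite Ex_cst big_nil.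
under [X in Ex X]eq_fun do rewrite big_cons.
by rewrite ExD ?IH ?big_cons//; exact: L1_sum.
Qed.

Lemma Ex_ge0 f : (forall x, 0 <= f x) -> 0 <= Ex f.
Proof. by move=> f0; apply: Rintegral_ge0. Qed.

Lemma Ex_le f g : P.-integrable setT (EFin \o f) -> P.-integrable setT (EFin \o g) ->
  (forall x, f x <= g x) -> Ex f <= Ex g.
Proof. by move=> fi gi fg; apply: le_Rintegral. Qed.

Lemma ler_norm_Ex f : P.-integrable setT (EFin \o f) -> `|Ex f| <= Ex (fun x => `|f x|).
Proof. by move=> fi; apply: le_normr_Rintegral. Qed.

Lemma Ex_ae_eq f g : measurable_fun setT f -> measurable_fun setT g ->
  {ae P, forall x, f x = g x} -> Ex f = Ex g.
Proof.
move=> mf mg fg; rewrite /Ex /Rintegral; congr fine.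
apply: ae_eq_integral => //; [exact/measurable_EFinP|exact/measurable_EFinP|].
by apply: filterS fg => x -> _.
Qed.

Lemma ae_integrable f g : measurable_fun setT f -> measurable_fun setT g ->
  {ae P, forall x, f x = g x} -> P.-integrable setT (EFin \o f) ->
  P.-integrable setT (EFin \o g).
Proof.
move=> mf mg fg fi; apply/integrableP; split; first exact/measurable_EFinP.
move/integrableP: fi => [_]; congr (_ < _)%E; apply: ae_eq_integral => //.
- by apply: measurableT_comp => //; exact/measurable_EFinP.
- by apply: measurableT_comp => //; exact/measurable_EFinP.
- by apply: filterS fg => x /= -> _.
Qed.

Lemma Ex_ae_le f g : P.-integrable setT (EFin \o f) -> P.-integrable setT (EFin \o g) ->
  {ae P, forall x, f x <= g x} -> Ex f <= Ex g.
Proof.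
move=> fi gi fg.
have mf := integrable_measurable fi; have mg := integrable_measurable gi.
(* [Ex_le] compares pointwise, so g is replaced by max(f, g), which equals it a.e. *)
have mm : measurable_fun setT (fun x => Num.max (f x) (g x)) by exact: measurable_maxr.
have fgm : {ae P, forall x, g x = Num.max (f x) (g x)}.
  by apply: filterS fg => x fgx; rewrite max_r.
have im := ae_integrable mg mm fgm gi.
rewrite (Ex_ae_eq mg mm fgm); apply: Ex_le => // x.
by rewrite le_max lexx.
Qed.

Lemma L2M f g : Lpow 2 f -> Lpow 2 g -> P.-integrable setT (EFin \o (fun x => f x * g x)).
Proof.
move=> [mf fi] [mg gi]; apply: (integrable_le _ (L1D fi gi)).
  exact: measurable_funM.
move=> x; rewrite normrM -(real_normK (num_real (f x))) -(real_normK (num_real (g x))).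
set a := `|f x|; set b := `|g x|.
have := sqr_ge0 (a - b); have : 0 <= a * b by rewrite mulr_ge0 ?normr_ge0.
by rewrite !expr2; lra.
Qed.

Lemma L4M f g : Lpow 4 f -> Lpow 4 g -> Lpow 2 (fun x => f x * g x).
Proof.
move=> [mf fi] [mg gi]; split; first exact: measurable_funM.
apply: (integrable_le _ (L1D fi gi)).
  exact/measurable_funX/measurable_funM.
move=> x; rewrite ger0_norm ?sqr_ge0//.
have := sqr_ge0 (f x ^+ 2 - g x ^+ 2); have : 0 <= (f x * g x) ^+ 2 by rewrite sqr_ge0.
nra.
Qed.

Lemma L2_L1 f : Lpow 2 f -> P.-integrable setT (EFin \o f).
Proof.
move=> [mf fi]; apply: (integrable_le mf (L1D (integrable_cst 1) fi)) => x.
rewrite -(real_normK (num_real (f x))); have := sqr_ge0 (`|f x| - 1).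
have := normr_ge0 (f x); nra.
Qed.

Lemma L4_L2 f : Lpow 4 f -> Lpow 2 f.
Proof.
move=> [mf fi]; split=> //.
apply: (integrable_le _ (L1D (integrable_cst 1) fi)); first exact: measurable_funX.
move=> x; rewrite ger0_norm ?sqr_ge0//.
have := sqr_ge0 (f x ^+ 2 - 1); have := sqr_ge0 (f x); nra.
Qed.

Lemma L4_sqr f : Lpow 4 f -> Lpow 2 (fun x => f x ^+ 2).
Proof. by move=> f4; under eq_fun do rewrite expr2; exact: L4M. Qed.

Lemma Lpow_cst n (r : R) : Lpow n (fun=> r).
Proof. by split=> //; exact: integrable_cst. Qed.

Lemma L2D f g : Lpow 2 f -> Lpow 2 g -> Lpow 2 (fun x => f x + g x).
Proof.
move=> [mf fi] [mg gi]; split; first exact: measurable_funD.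
apply: (integrable_le _ (L1Zl 2 (L1D fi gi))); first exact/measurable_funX/measurable_funD.
move=> x; rewrite ger0_norm ?sqr_ge0//.
have := sqr_ge0 (f x - g x); nra.
Qed.

Lemma L4D f g : Lpow 4 f -> Lpow 4 g -> Lpow 4 (fun x => f x + g x).
Proof.
move=> [mf fi] [mg gi]; split; first exact: measurable_funD.
apply: (integrable_le _ (L1Zl 8 (L1D fi gi))); first exact/measurable_funX/measurable_funD.
move=> x; rewrite ger0_norm ?exprn_even_ge0//.
have h (a b : R) : (a + b) ^+ 2 <= 2 * (a ^+ 2 + b ^+ 2).
  have := sqr_ge0 (a - b); nra.
have := h (f x) (g x); have := h (f x ^+ 2) (g x ^+ 2).
have := sqr_ge0 (f x + g x).
rewrite -!exprM !(exprM _ 2 2); nra.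
Qed.

Lemma LpowZl n r f : Lpow n f -> Lpow n (fun x => r * f x).
Proof.
move=> [mf fi]; split; first exact: measurable_funM.
by under eq_fun do rewrite exprMn; exact: L1Zl.
Qed.

Lemma LpowN n f : Lpow n f -> Lpow n (fun x => - f x).
Proof. by move=> /(LpowZl (-1)); under eq_fun do rewrite mulN1r. Qed.

Lemma L2B f g : Lpow 2 f -> Lpow 2 g -> Lpow 2 (fun x => f x - g x).
Proof. by move=> f2 g2; apply: L2D => //; exact: LpowN. Qed.

Lemma L4B f g : Lpow 4 f -> Lpow 4 g -> Lpow 4 (fun x => f x - g x).
Proof. by move=> f2 g2; apply: L4D => //; exact: LpowN. Qed.

Lemma Lpow_norm n f : Lpow n f -> Lpow n (fun x => `|f x|).
Proof.
move=> [mf fi]; split; first exact: measurableT_comp.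
by under eq_fun do rewrite -normrX; exact: L1_norm.
Qed.

Lemma Lpow_bounded n b (B : R) : measurable_fun setT b -> (forall x, `|b x| <= B) -> Lpow n b.
Proof.
move=> mb bB; split=> //; apply: (integrable_le _ (integrable_cst (B ^+ n))).
  exact: measurable_funX.
by move=> x; rewrite normrX lerXn2r// ?nnegrE// (le_trans _ (bB x)).
Qed.

Lemma Lpow_bounded_mul n b f (B : R) : measurable_fun setT b -> (forall x, `|b x| <= B) ->
  Lpow n f -> Lpow n (fun x => b x * f x).
Proof.
move=> mb bB [mf fi]; split; first exact: measurable_funM.
apply: (integrable_le _ (L1Zl (B ^+ n) (L1_norm fi))).
  exact/measurable_funX/measurable_funM.
move=> x; rewrite normrX normrM exprMn normrX ler_wpM2r ?exprn_ge0//.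
by rewrite lerXn2r// nnegrE// (le_trans _ (bB x)).
Qed.

Lemma ae_Lpow n f g : measurable_fun setT g -> {ae P, forall x, f x = g x} ->
  Lpow n f -> Lpow n g.
Proof.
move=> mg fg [mf fi]; split=> //; apply: ae_integrable fi.
- exact: measurable_funX.
- exact: measurable_funX.
- by apply: filterS fg => x ->.
Qed.

(** The best t is sqrt b / sqrt a. When a or b vanishes it degenerates, and another t contradicts c
    > 0. *)
Lemma le_sqrtM (a b c : R) : 0 <= a -> 0 <= b ->
  (forall t, 0 < t -> 2 * c <= t * a + b / t) -> c <= Num.sqrt a * Num.sqrt b.
Proof.
move=> a0 b0 h.
have [c0|c0] := leP c 0; first by rewrite (le_trans c0)// mulr_ge0 ?sqrtr_ge0.
have [a00|a00] := eqVneq a 0.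
  have t0 : 0 < (b + 1) / c by rewrite divr_gt0// ltr_pwDr.
  have := h _ t0; rewrite a00 mulr0 add0r invf_div mulrA ler_pdivlMr ?ltr_pwDr//.
  nra.
have [b00|b00] := eqVneq b 0.
  have a1 : 0 < a by rewrite lt0r a00.
  have t0 : 0 < c / a by rewrite divr_gt0.
  by have := h _ t0; rewrite b00 mul0r addr0 divfK//; nra.
have sa : 0 < Num.sqrt a by rewrite sqrtr_gt0 lt0r a00.
have sb : 0 < Num.sqrt b by rewrite sqrtr_gt0 lt0r b00.
have := h (Num.sqrt b / Num.sqrt a); rewrite divr_gt0// => /(_ isT).
rewrite -{2}(sqr_sqrtr a0) -{2}(sqr_sqrtr b0).
set x := Num.sqrt a in sa *; set y := Num.sqrt b in sb *.
have -> : y / x * x ^+ 2 + y ^+ 2 / (y / x) = 2 * (x * y).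
  by field; rewrite !gt_eqF.
by rewrite ler_pM2l.
Qed.

Lemma cauchy_schwarz f g : Lpow 2 f -> Lpow 2 g ->
  Ex (fun x => `|f x * g x|) <=
  Num.sqrt (Ex (fun x => f x ^+ 2)) * Num.sqrt (Ex (fun x => g x ^+ 2)).
Proof.
move=> f2 g2; apply: le_sqrtM; [by apply: Ex_ge0 => x; exact: sqr_ge0..|].
move=> t t0; have [_ fi] := f2; have [_ gi] := g2.
rewrite -(ExZl _ (L1_norm (L2M f2 g2))) -(ExZl _ fi) [X in _ <= _ + X]mulrC -(ExZl _ gi).
rewrite -ExD; [|exact: L1Zl..].
apply: Ex_le; [exact/L1Zl/L1_norm/L2M|by apply: L1D; exact: L1Zl|].
move=> x; rewrite normrM -(real_normK (num_real (f x))) -(real_normK (num_real (g x))).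
set a := `|f x|; set b := `|g x|.
have := sqr_ge0 (t * a - b) => h.
have ti : 0 < t^-1 by rewrite invr_gt0.
have := mulr_ge0 (ltW ti) h.
have -> : t^-1 * (t * a - b) ^+ 2 = t * a ^+ 2 - 2 * (a * b) + t^-1 * b ^+ 2.
  by field; rewrite gt_eqF.
lra.
Qed.

Definition norm4 f : R := Num.sqrt (Num.sqrt (Ex (fun x => f x ^+ 4))).

Lemma norm4_ge0 f : 0 <= norm4 f. Proof. exact: sqrtr_ge0. Qed.

Lemma norm4_sqr f : norm4 f ^+ 2 = Num.sqrt (Ex (fun x => f x ^+ 4)).
Proof. by rewrite sqr_sqrtr ?sqrtr_ge0. Qed.

Lemma norm4_pow4 f : norm4 f ^+ 4 = Ex (fun x => f x ^+ 4).
Proof.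
rewrite (exprM _ 2 2) norm4_sqr sqr_sqrtr//; apply: Ex_ge0 => x.
exact: exprn_even_ge0.
Qed.

Lemma hoelder4 f g h k : Lpow 4 f -> Lpow 4 g -> Lpow 4 h -> Lpow 4 k ->
  Ex (fun x => `|(f x * g x) * (h x * k x)|) <=
  norm4 f * norm4 g * (norm4 h * norm4 k).
Proof.
move=> f4 g4 h4 k4; apply: le_trans (cauchy_schwarz (L4M f4 g4) (L4M h4 k4)) _.
have aux (u v : T -> R) : Lpow 4 u -> Lpow 4 v ->
    Num.sqrt (Ex (fun x => (u x * v x) ^+ 2)) <= norm4 u * norm4 v.
  move=> u4 v4; rewrite /norm4 -sqrtrM ?sqrtr_ge0// ler_sqrt ?mulr_ge0 ?sqrtr_ge0//.
  have := cauchy_schwarz (L4_sqr u4) (L4_sqr v4).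
  congr (_ <= _ * _); [|by congr (Num.sqrt (Ex _)); apply/funext => x; rewrite -exprM..].
  by congr Ex; apply/funext => x; rewrite -exprMn ger0_norm// sqr_ge0.
by rewrite ler_pM ?sqrtr_ge0// aux.
Qed.

End moments.

Notation L1 P f := (integrable P setT (EFin \o f)).

(** * Resampling of coordinates *)

Section preserving.
Context d d' (T : measurableType d) (T' : measurableType d') (R : realType).
Variables (P : probability T R) (P' : probability T' R) (phi : T -> T').

Definition preserves :=
  measurable_fun setT phi /\ forall A, measurable A -> P (phi @^-1` A) = P' A.

Hypothesis pphi : preserves.

Lemma preserves_ge0_integral (f : T' -> \bar R) : measurable_fun setT f ->
  (forall x, (0 <= f x)%E) -> (\int[P]_x f (phi x) = \int[P']_x f x)%E.
Proof.
move=> mf f0; have [mphi ephi] := pphi.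
rewrite -(ge0_integral_pushforward mphi P measurableT)//.
by apply: eq_measure_integral => A mA _; exact: ephi.
Qed.

Lemma preserves_L1 (f : T' -> R) : L1 P' f -> L1 P (fun x => f (phi x)).
Proof.
move=> /integrableP[mf fi]; have [mphi _] := pphi.
apply/integrableP; split; first exact: (measurableT_comp mf).
rewrite (preserves_ge0_integral (f := fun x => `|(f x)%:E|%E))//.
exact: measurableT_comp.
Qed.

Lemma preserves_Ex (f : T' -> R) : L1 P' f -> Ex P (fun x => f (phi x)) = Ex P' f.
Proof.
move=> fi; have [mphi ephi] := pphi.
have fi' := preserves_L1 fi.
have mf := measurable_int _ fi.
rewrite /Ex /Rintegral; congr fine.
rewrite -(integral_pushforward mphi mf fi' measurableT).
by apply: eq_measure_integral => A mA _; exact: ephi.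
Qed.

Lemma preserves_Lpow n (f : T' -> R) : Lpow P' n f -> Lpow P n (fun x => f (phi x)).
Proof.
move=> [mf fi]; have [mphi _] := pphi; split; first exact: measurableT_comp.
exact: preserves_L1 fi.
Qed.

End preserving.

Section resampling.
Context d (Om : measurableType d) (R : realType) (mu : probability Om R).

Let mu2 : probability (Om * Om)%type R := (mu \x mu)%E.

(* [sp K x y] takes its coordinates in [K] from [x] and the others from [y] *)
Record resampling (sp : set nat -> Om -> Om -> Om) : Prop := Resampling {
  sp_preserves : forall K,
    preserves mu2 mu2 (fun z => (sp K z.1 z.2, sp K z.2 z.1)) ;
  sp_tower : forall K L x y z, sp L (sp K x y) z = sp (K `&` L) x (sp L y z) ;
  sp_sub : forall K L x y z, L `<=` K -> sp L (sp K x y) z = sp L x z ;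
  sp_id : forall K x y z, sp K (sp K x y) (sp K z x) = x ;
  sp0 : forall x y, sp set0 x y = y ;
}.

Variables (sp : set nat -> Om -> Om -> Om) (spP : resampling sp).

Definition dep (K : set nat) (a : Om -> R) := forall x y, a (sp K x y) = a x.

Definition cexp (K : set nat) (h : Om -> R) (x : Om) : R := Ex mu (fun y => h (sp K x y)).

Lemma fst_preserves : preserves mu2 mu fst.
Proof.
split=> // A mA.
have -> : fst @^-1` A = A `*` setT :> set (Om * Om) by apply/seteqP; split=> -[x y]//= [].
rewrite /mu2/= product_measure1E//; transitivity (mu A * 1)%E; last exact: mule1.
by congr (_ * _)%E; exact: probability_setT.
Qed.

Lemma preserves_comp d1 d2 d3 (T1 : measurableType d1) (T2 : measurableType d2)
  (T3 : measurableType d3) (P1 : probability T1 R) (P2 : probability T2 R)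
  (P3 : probability T3 R) (f : T1 -> T2) (g : T2 -> T3) :
  preserves P1 P2 f -> preserves P2 P3 g -> preserves P1 P3 (g \o f).
Proof.
move=> [mf ef] [mg eg]; split; first exact: measurableT_comp.
move=> A mA; rewrite comp_preimage ef ?eg//.
by rewrite -[X in measurable X]setTI; exact: mg.
Qed.

Lemma sp12_preserves K : preserves mu2 mu (fun z => sp K z.1 z.2).
Proof. exact: (preserves_comp (sp_preserves spP K) fst_preserves). Qed.

Lemma measurable_sp K : measurable_fun setT (fun z : Om * Om => sp K z.1 z.2).
Proof. by have [] := sp12_preserves K. Qed.

Lemma measurable_spr K x : measurable_fun setT (sp K x).
Proof. exact: (measurableT_comp (measurable_sp K) (pair1_measurable x)). Qed.

Lemma Ex_Fubini (f : Om * Om -> R) : L1 mu2 f ->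
  [/\ {ae mu, forall x, L1 mu (fun y => f (x, y))},
      L1 mu (fun x => Ex mu (fun y => f (x, y))) &
      Ex mu (fun x => Ex mu (fun y => f (x, y))) = Ex mu2 f].
Proof.
move=> fi; have aei := ae_integrable1 fi.
have mE : measurable_fun setT (fun x => Ex mu (fun y => f (x, y))).
  apply: (measurableT_comp (@fine_measurable R setT measurableT)).
  exact: (measurable_fubini_F fi).
have iF := integrable_fubini_F fi.
have FE : {ae mu, forall x, setT x ->
    fubini_F mu (EFin \o f) x = (Ex mu (fun y => f (x, y)))%:E}.
  by apply: filterS aei => x xi _; rewrite ExE.
have mF := measurable_int _ iF.
have iE : L1 mu (fun x => Ex mu (fun y => f (x, y))).
  apply/integrableP; split; first exact/measurable_EFinP.
  move/integrableP : iF => [_]; congr (_ < _)%E; apply: ae_eq_integral => //.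
  - exact: measurableT_comp.
  - by apply: measurableT_comp => //; exact/measurable_EFinP.
  - by apply: filterS FE => x /(_ I) -> _.
split=> //.
rewrite /Ex/= [LHS]/Rintegral [RHS]/Rintegral; congr fine.
rewrite -(integral12_prod_meas1 fi); apply: ae_eq_integral => //.
  exact/measurable_EFinP.
by apply: filterS FE => x /(_ I) -> _.
Qed.

Lemma sp_L1 K h : L1 mu h -> L1 mu2 (fun z => h (sp K z.1 z.2)).
Proof. exact: (preserves_L1 (sp12_preserves K)). Qed.

Lemma sp_Ex K h : L1 mu h -> Ex mu2 (fun z => h (sp K z.1 z.2)) = Ex mu h.
Proof. exact: (preserves_Ex (sp12_preserves K)). Qed.

Lemma ae_L1_slice K h : L1 mu h -> {ae mu, forall x, L1 mu (fun y => h (sp K x y))}.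
Proof. by move=> /(sp_L1 K)/Ex_Fubini[]. Qed.

Lemma cexp_L1 K h : L1 mu h -> L1 mu (cexp K h).
Proof. by move=> /(sp_L1 K)/Ex_Fubini[]. Qed.

Lemma cexp_meas K h : L1 mu h -> measurable_fun setT (cexp K h).
Proof. by move=> /(cexp_L1 K)/integrable_measurable. Qed.

Lemma cexp_Ex K h : L1 mu h -> Ex mu (cexp K h) = Ex mu h.
Proof. by move=> hi; rewrite -(sp_Ex K hi); have [_ _] := Ex_Fubini (sp_L1 K hi). Qed.

(** Turns a conditional expectation into a plain integral over two copies, where the exchange of
    coordinates can act. *)
Lemma cexp_pair K (a h : Om -> R) : measurable_fun setT a -> L1 mu h ->
  L1 mu2 (fun z => a z.1 * h (sp K z.1 z.2)) ->
  L1 mu (fun x => a x * cexp K h x) /\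
  Ex mu (fun x => a x * cexp K h x) = Ex mu2 (fun z => a z.1 * h (sp K z.1 z.2)).
Proof.
move=> ma hi ahi; have [_ i1 <-] := Ex_Fubini ahi.
have m1 := integrable_measurable i1.
have m2 : measurable_fun setT (fun x => a x * cexp K h x).
  by apply: measurable_funM => //; exact: cexp_meas.
have e : {ae mu, forall x, Ex mu (fun y => a x * h (sp K x y)) = a x * cexp K h x}.
  by apply: filterS (ae_L1_slice K hi) => x xi; rewrite ExZl.
split; first exact: ae_integrable i1.
by apply/esym; exact: Ex_ae_eq.
Qed.

Lemma cexp_dep K h : dep K (cexp K h).
Proof.
by move=> x y; congr Ex; apply/funext => z; rewrite (sp_sub spP)//.
Qed.

Lemma dep_sub K L a : L `<=` K -> dep L a -> dep K a.
Proof.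
move=> LK da x y.
(* Resample once more off L, with x: since L is contained in K, the point [sp L (sp K x y) x] is
   [sp L x x]. *)
by rewrite -(da (sp K x y) x) (sp_sub spP)// da.
Qed.

Lemma cexp_of_dep K a : dep K a -> cexp K a = a.
Proof.
move=> da; apply/funext => x; rewrite /cexp.
by under [X in Ex _ X]eq_fun do rewrite da; rewrite Ex_cst.
Qed.

(** As [a] ignores the coordinates outside K, a(x) f(sp K x y) is the product a f evaluated at
    [sp K x y], a point with law [mu]. *)
Lemma cexp_cond K (a f : Om -> R) : measurable_fun setT a -> dep K a -> L1 mu f ->
  L1 mu (fun x => a x * f x) ->
  L1 mu (fun x => a x * cexp K f x) /\
  Ex mu (fun x => a x * cexp K f x) = Ex mu (fun x => a x * f x).
Proof.
move=> ma da fi afi.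
have e : (fun z : Om * Om => a z.1 * f (sp K z.1 z.2)) =
         (fun z => (fun x => a x * f x) (sp K z.1 z.2)).
  by apply/funext => z /=; rewrite da.
have [|i1 e1] := @cexp_pair K a f ma fi; first by rewrite e; exact: (@sp_L1 K (fun x => a x * f x)).
by split=> //; rewrite e1 e (@sp_Ex K (fun x => a x * f x)).
Qed.

Lemma cexpD K f g : L1 mu f -> L1 mu g ->
  {ae mu, forall x, cexp K (fun y => f y + g y) x = cexp K f x + cexp K g x}.
Proof.
move=> fi gi; apply: filterS2 (ae_L1_slice K fi) (ae_L1_slice K gi) => x fx gx.
by rewrite /cexp ExD.
Qed.

Lemma cexpB K f g : L1 mu f -> L1 mu g ->
  {ae mu, forall x, cexp K (fun y => f y - g y) x = cexp K f x - cexp K g x}.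
Proof.
move=> fi gi; apply: filterS2 (ae_L1_slice K fi) (ae_L1_slice K gi) => x fx gx.
by rewrite /cexp ExB.
Qed.

Lemma cexp_pull K (a f : Om -> R) : dep K a -> L1 mu f ->
  {ae mu, forall x, cexp K (fun y => a y * f y) x = a x * cexp K f x}.
Proof.
move=> da fi; apply: filterS (ae_L1_slice K fi) => x fx.
by rewrite /cexp -ExZl//; congr Ex; apply/funext => y; rewrite da.
Qed.

(** A null set has null preimage under (x, y) -> sp K x y, so almost all sections of this preimage
    are null. This makes [cexp] insensitive to changes on null sets. *)
Lemma ae_slice K (Q : Om -> Prop) : {ae mu, forall x, Q x} ->
  {ae mu, forall x, {ae mu, forall y, Q (sp K x y)}}.
Proof.
move=> [N [mN N0 QN]].
have [msp esp] := sp12_preserves K.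
have mA : measurable ((fun z : Om * Om => sp K z.1 z.2) @^-1` N).
  by rewrite -[X in measurable X]setTI; exact: msp.
have i0 : (\int[mu]_x (mu \o xsection ((fun z : Om * Om => sp K z.1 z.2) @^-1` N)) x = 0)%E.
  by have := esp _ mN; rewrite /mu2/= N0 => <-.
have : ae_eq mu setT (mu \o xsection ((fun z : Om * Om => sp K z.1 z.2) @^-1` N)) (cst 0%E).
  apply/(ae_eq_integral_abs mu measurableT).
    by apply: measurable_fun_xsection.
  by rewrite -[RHS]i0; apply: eq_integral => x _; rewrite gee0_abs ?measure_ge0.
apply: filterS => x /(_ I) /= x0.
exists (xsection ((fun z : Om * Om => sp K z.1 z.2) @^-1` N) x); split=> //.
  exact: measurable_xsection.
by move=> y /= nQ; rewrite /xsection/= inE; exact: QN.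
Qed.

Lemma cexp_ae K f g : L1 mu f -> L1 mu g -> {ae mu, forall x, f x = g x} ->
  {ae mu, forall x, cexp K f x = cexp K g x}.
Proof.
move=> fi gi /(ae_slice K); apply: filterS3 (ae_L1_slice K fi) (ae_L1_slice K gi) => x fx gx fgx.
by apply: Ex_ae_eq => //; [exact: (integrable_measurable fx)|exact: (integrable_measurable gx)].
Qed.

(** By [sp_tower] the two resampled sequences enter only through [sp L y z], which has law [mu], so
    the double integral collapses to one. *)
Lemma cexp_tower K L h : L1 mu h ->
  {ae mu, forall x, cexp K (cexp L h) x = cexp (K `&` L) h x}.
Proof.
move=> hi.
apply: filterS (ae_L1_slice (K `&` L) hi) => x fx.
rewrite /cexp -(sp_Ex L fx).
have [_ _ <-] := Ex_Fubini (sp_L1 L fx).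
by congr Ex; apply/funext => y; congr Ex; apply/funext => z; rewrite (sp_tower spP).
Qed.

Lemma ler_norm_cexp K h : L1 mu h ->
  {ae mu, forall x, `|cexp K h x| <= cexp K (fun y => `|h y|) x}.
Proof.
by move=> hi; apply: filterS (ae_L1_slice K hi) => x xi; exact: ler_norm_Ex.
Qed.

Lemma Ex_norm_cexp K h : L1 mu h -> Ex mu (fun x => `|cexp K h x|) <= Ex mu (fun x => `|h x|).
Proof.
move=> hi; rewrite -(cexp_Ex K (L1_norm hi)).
by apply: Ex_ae_le; [exact/L1_norm/cexp_L1|exact/cexp_L1/L1_norm|exact: ler_norm_cexp].
Qed.

Lemma Ex_sqr_le d' (T' : measurableType d') (P' : probability T' R) (h : T' -> R) :
  Lpow P' 2 h -> (Ex P' h) ^+ 2 <= Ex P' (fun x => h x ^+ 2).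
Proof.
move=> h2; have hi := L2_L1 h2; have [_ hh] := h2; set c := Ex _ h.
have : 0 <= Ex P' (fun x => h x ^+ 2 - (2 * c * h x - c ^+ 2)).
  apply: Ex_ge0 => x; have := sqr_ge0 (h x - c); nra.
have i1 := L1Zl (2 * c) hi; have i2 := integrable_cst P' (c ^+ 2).
by rewrite (ExB hh (L1B i1 i2)) ExB// ExZl// Ex_cst -/c; nra.
Qed.

Lemma cexp_sqr K h : Lpow mu 2 h ->
  {ae mu, forall x, cexp K h x ^+ 2 <= cexp K (fun y => h y ^+ 2) x}.
Proof.
move=> [mh hi]; apply: filterS (ae_L1_slice K hi) => x xi.
apply: Ex_sqr_le; split=> //.
by apply: (measurableT_comp mh); exact: measurable_spr.
Qed.

Lemma cexp_L2 K h : Lpow mu 2 h -> Lpow mu 2 (cexp K h) /\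
  Ex mu (fun x => cexp K h x ^+ 2) <= Ex mu (fun x => h x ^+ 2).
Proof.
move=> h2; have [mh hi] := h2.
have mc : measurable_fun setT (cexp K h) by exact/cexp_meas/L2_L1.
have mc2 : measurable_fun setT (cexp K (fun y => h y ^+ 2)) by exact: cexp_meas.
have ci : L1 mu (fun x => cexp K h x ^+ 2).
  (* Jensen's inequality holds only a.e., while [integrable_le] asks for domination everywhere; the
     minimum is dominated everywhere and is a.e. the square. *)
  have mm : measurable_fun setT (fun x => Num.min (cexp K h x ^+ 2) (cexp K (fun y => h y ^+ 2) x)).
    by apply: measurable_minr => //; exact: measurable_funX.
  apply: (@ae_integrable _ _ _ _ _ _ mm); first exact: measurable_funX.
    by apply: filterS (cexp_sqr K h2) => x; exact: min_l.
  apply: (integrable_le mm (cexp_L1 K hi)) => x.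
  rewrite ger0_norm ?ge_min ?lexx ?orbT// le_min sqr_ge0/=.
  by apply: Ex_ge0 => y; exact: sqr_ge0.
split=> //; rewrite -(cexp_Ex K hi).
by apply: Ex_ae_le => //; [exact: cexp_L1|exact: cexp_sqr].
Qed.

Lemma cexp_L4 K h : Lpow mu 4 h -> Lpow mu 4 (cexp K h) /\
  Ex mu (fun x => cexp K h x ^+ 4) <= Ex mu (fun x => h x ^+ 4).
Proof.
move=> h4; have h2 := L4_L2 h4; have hh2 := L4_sqr h4.
have [[mc ci] _] := cexp_L2 K h2.
have [[mc2 ci2] le2] := cexp_L2 K hh2.
have le4 : {ae mu, forall x, cexp K h x ^+ 4 <= cexp K (fun y => h y ^+ 2) x ^+ 2}.
  apply: filterS (cexp_sqr K h2) => x h2x.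
  by rewrite (exprM _ 2 2) lerXn2r// nnegrE ?sqr_ge0// (le_trans _ h2x)// sqr_ge0.
have ci4 : L1 mu (fun x => cexp K h x ^+ 4).
  have mm : measurable_fun setT (fun x => Num.min (cexp K h x ^+ 4) (cexp K (fun y => h y ^+ 2) x ^+ 2)).
    by apply: measurable_minr => //; exact: measurable_funX.
  apply: (@ae_integrable _ _ _ _ _ _ mm); first exact: measurable_funX.
    by apply: filterS le4 => x; exact: min_l.
  apply: (integrable_le mm ci2) => x.
  rewrite ger0_norm ?ge_min ?lexx ?orbT// le_min sqr_ge0 andbT.
  exact: exprn_even_ge0.
split=> //; apply: (@le_trans _ _ (Ex mu (fun x => cexp K (fun y => h y ^+ 2) x ^+ 2))).
  exact: Ex_ae_le.
apply: (le_trans le2); rewrite le_eqVlt; apply/orP; left; apply/eqP.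
by congr Ex; apply/funext => x; rewrite -exprM.
Qed.

End resampling.

(** * Lower semicontinuity of even moments *)

Section truncation.
Context d (T : measurableType d) (R : realType) (P : probability T R).

Let trunc (k : R) (h : T -> R) x := if `|h x| <= k then h x else 0.

Let trunc_meas k h : measurable_fun setT h -> measurable_fun setT (trunc k h).
Proof.
move=> mh; apply: measurable_fun_ifT => //.
by apply: measurable_fun_ler => //; exact: measurableT_comp.
Qed.

Let trunc_le k h x : 0 <= k -> `|trunc k h x| <= k.
Proof. by move=> k0; rewrite /trunc; case: ifP => //; rewrite normr0. Qed.

(* Lower semicontinuity of a moment under L1 convergence: the tangent inequality
   of y^p at the truncation of h avoids extracting an a.e. convergent
   subsequence. *)
Lemma moment_lsc (p : nat) (h : T -> R) (u : nat -> T -> R) (C : R) :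
  (forall t y : R, t ^+ p.+2 + p.+2%:R * t ^+ p.+1 * (y - t) <= y ^+ p.+2) ->
  L1 P h -> (forall n, L1 P (u n)) -> (forall n, Lpow P p.+2 (u n)) ->
  (forall n, Ex P (fun x => u n x ^+ p.+2) <= C) ->
  (forall e : R, 0 < e -> exists n, Ex P (fun x => `|h x - u n x|) <= e) ->
  Lpow P p.+2 h /\ Ex P (fun x => h x ^+ p.+2) <= C.
Proof.
move=> tg hi ui up uC hu.
have mh := integrable_measurable hi.
have pge0 (y : R) : 0 <= y ^+ p.+2.
  by have := tg 0 y; rewrite !expr0n/= mulr0 mul0r addr0.
have tL n k : Lpow P n (trunc k%:R h).
  apply: (@Lpow_bounded _ _ _ _ _ _ k%:R); first exact: trunc_meas.
  by move=> x; exact: trunc_le.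
have tC (k : nat) : Ex P (fun x => trunc k%:R h x ^+ p.+2) <= C.
  apply/ler_addgt0Pl => e e0.
  (* A bound on the tangent slope at a truncated value, which is at most k in modulus. *)
  pose B : R := p.+2%:R * k%:R ^+ p.+1.
  have B1 : 0 < B + 1 by rewrite ltr_pwDr// mulr_ge0// exprn_ge0.
  have [n hun] := hu (e / (B + 1)) (divr_gt0 e0 B1).
  have [_ ti] := tL p.+2 k; have [_ upi] := up n.
  have hui := L1_norm (L1B hi (ui n)).
  apply: (@le_trans _ _ (Ex P (fun x => u n x ^+ p.+2 + B * `|h x - u n x|))).
    apply: Ex_le => //; first by apply: L1D => //; exact: L1Zl.
    move=> x; have := tg (trunc k%:R h x) (u n x).
    (* Where |h| > k the truncation is 0 and so is the slope, its exponent being positive; elsewhere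
       the truncation is h. Hence h may replace it in the difference. Truncating to 0 rather than
       clipping at k is what allows this. *)
    have -> : p.+2%:R * trunc k%:R h x ^+ p.+1 * (u n x - trunc k%:R h x) =
              - (p.+2%:R * trunc k%:R h x ^+ p.+1 * (h x - u n x)).
      by rewrite /trunc; case: ifP => _; [ring|rewrite expr0n/= mulr0 !mul0r oppr0].
    suff : p.+2%:R * trunc k%:R h x ^+ p.+1 * (h x - u n x) <= B * `|h x - u n x| by lra.
    apply: (le_trans (ler_norm _)); rewrite normrM ler_wpM2r// normrM ger0_norm//.
    by rewrite ler_wpM2l// normrX lerXn2r ?nnegrE// trunc_le.
  rewrite ExD ?ExZl//; last exact: L1Zl.
  rewrite addrC lerD//.
  apply: (@le_trans _ _ (B * (e / (B + 1)))); first by rewrite ler_wpM2l// mulr_ge0// exprn_ge0.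
  by rewrite mulrA ler_pdivrMr// mulrC ler_wpM2l ?(ltW e0)// lerDl.
have mt k : measurable_fun setT (fun x => (trunc k%:R h x ^+ p.+2)%:E).
  by apply/measurable_EFinP/measurable_funX/trunc_meas.
have cv : (\int[P]_x (trunc n%:R h x ^+ p.+2)%:E)%E @[n --> \oo] --> (\int[P]_x (h x ^+ p.+2)%:E)%E.
  have lE x : ((h x ^+ p.+2)%:E = limn (fun n => (trunc n%:R h x ^+ p.+2)%:E))%E.
    apply/esym/cvg_lim => //; apply: cvg_near_cst; near=> n.
    rewrite /trunc ifT//; near: n; exact: nbhs_infty_ger.
  under [X in _ --> X]eq_integral do rewrite lE.
  apply: cvg_monotone_convergence => //.
  - by move=> n x _; rewrite lee_fin.
  - move=> x _ m n mn; rewrite lee_fin /trunc.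
    case: ifP => [hm|_]; last by rewrite expr0n/=; case: ifP.
    by rewrite (le_trans hm) ?ler_nat.
have le : (\int[P]_x (h x ^+ p.+2)%:E <= C%:E)%E.
  apply: (cvge_to_le cv); near=> n.
  by have [_ ti] := tL p.+2 n; rewrite -ExE// lee_fin.
have hp : Lpow P p.+2 h.
  split=> //; apply/integrableP; split; first exact/measurable_EFinP/measurable_funX.
  under eq_integral do rewrite gee0_abs ?lee_fin//.
  by rewrite (le_lt_trans le)// ltry.
split=> //; rewrite -lee_fin ExE//; by have [] := hp.
Unshelve. all: by end_near. Qed.

End truncation.

(** * Fourth moment of an orthogonal sum *)

Section orthogonal_sum.
Context d (T : measurableType d) (R : realType) (P : probability T R).

(** With x and y the two norms, expanding the fourth power loses its term in t^3 m, and Hoelder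
    leaves x^4 + 6 x^2 y^2 + 4 x y^3 + y^4. As 4 x y^3 <= 2 x^2 y^2 + 2 y^4, the mixed coefficient
    becomes 8 = 2 * 4, which is the origin of the 4. *)
Lemma norm4_orth (t m : T -> R) : Lpow P 4 t -> Lpow P 4 m ->
  Ex P (fun x => t x ^+ 3 * m x) = 0 ->
  norm4 P (fun x => t x + m x) ^+ 2 <= norm4 P t ^+ 2 + 4 * norm4 P m ^+ 2.
Proof.
move=> t4 i4 o.
have [[mt' tti] [mi ii]] := (t4, i4).
have h1 := L2M (L4_sqr t4) (L4M t4 i4).
have h2 := L2M (L4M t4 t4) (L4M i4 i4).
have h3 := L2M (L4M t4 i4) (L4M i4 i4).
have g1 := L1Zl 4 h1; have g2 := L1Zl 6 h2; have g3 := L1Zl 4 h3.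
have b2 : Ex P (fun z => t z * t z * (m z * m z)) <=
    norm4 P t * norm4 P t * (norm4 P m * norm4 P m).
  apply: (le_trans _ (hoelder4 t4 t4 i4 i4)).
  by apply: (Ex_le h2 (L1_norm h2)) => z; exact: ler_norm.
have b3 : Ex P (fun z => t z * m z * (m z * m z)) <=
    norm4 P t * norm4 P m * (norm4 P m * norm4 P m).
  apply: (le_trans _ (hoelder4 t4 i4 i4 i4)).
  by apply: (Ex_le h3 (L1_norm h3)) => z; exact: ler_norm.
have o' : Ex P (fun z => t z ^+ 2 * (t z * m z)) = 0.
  by rewrite -[RHS]o; congr Ex; apply/funext => x; ring.
rewrite (norm4_sqr P (fun x => t x + m x)).
have -> : Ex P (fun z => (t z + m z) ^+ 4) =
    Ex P (fun z => t z ^+ 4 + (4 * (t z ^+ 2 * (t z * m z)) +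
      (6 * (t z * t z * (m z * m z)) + (4 * (t z * m z * (m z * m z)) + m z ^+ 4)))).
  by congr Ex; apply/funext => x; ring.
rewrite (ExD tti (L1D g1 (L1D g2 (L1D g3 ii)))) (ExD g1 (L1D g2 (L1D g3 ii))).
rewrite (ExD g2 (L1D g3 ii)) (ExD g3 ii).
rewrite (ExZl 4 h1) (ExZl 6 h2) (ExZl 4 h3) o' -(norm4_pow4 P t) -(norm4_pow4 P m).
move: (norm4 P t) (norm4 P m) (norm4_ge0 P t) (norm4_ge0 P m) b2 b3 => x y x0 y0.
move: (Ex P _) (Ex P _) => A B AB BB.
have s0 : 0 <= x ^+ 2 + 4 * y ^+ 2 by rewrite addr_ge0 ?mulr_ge0 ?sqr_ge0.
rewrite -(ger0_norm s0) -sqrtr_sqr ler_sqrt ?sqr_ge0//.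
have : 0 <= y ^+ 2 * (x - y) ^+ 2 by rewrite mulr_ge0 ?sqr_ge0.
have : 0 <= y ^+ 4 by rewrite exprn_ge0.
nra.
Qed.

End orthogonal_sum.

(** * Martingale increments *)

Section martingale.
Context d (Om : measurableType d) (R : realType) (mu : probability Om R).
Variables (sp : set nat -> Om -> Om -> Om) (spP : resampling mu sp).

Definition lts (n : nat) : set nat := [set k | (k < n)%N].
Definition les (n : nat) : set nat := [set k | (k <= n)%N].
Definition nes (n : nat) : set nat := [set k | k != n].

Definition approx (h : Om -> R) := forall e : R, 0 < e ->
  exists n k, [/\ L1 mu k, dep sp (lts n) k & Ex mu (fun x => `|h x - k x|) <= e].

Hypothesis dense : forall h, L1 mu h -> approx h.

Local Notation ce := (cexp mu sp).

Definition diff_op i (h : Om -> R) x := h x - ce (nes i) h x.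
Definition partial_proj n (h : Om -> R) := ce (lts n) h.
Definition increment i (h : Om -> R) := ce (les i) (diff_op i h).

Lemma lesE n : les n = lts n.+1.
Proof. by apply/seteqP; split. Qed.

Lemma les_nes n : les n `&` nes n = lts n.
Proof.
apply/seteqP; split=> k /=; rewrite /les /nes /lts/=.
  by move=> [kn /eqP nk]; rewrite ltn_neqAle kn andbT; apply/eqP.
by move=> kn; split; [exact: ltnW|rewrite ltn_eqF].
Qed.

Lemma nes_lts n : nes n `&` lts n = lts n.
Proof.
by apply/seteqP; split=> k /=; [case|rewrite /lts /nes/= => kn; rewrite ltn_eqF].
Qed.

Lemma lts_sub_nes n : lts n `<=` nes n.
Proof. by move=> k; rewrite /lts /nes/= => kn; rewrite ltn_eqF. Qed.

Lemma diff_op_L1 i h : L1 mu h -> L1 mu (diff_op i h).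
Proof. by move=> hi; apply: L1B => //; exact: cexp_L1. Qed.

Lemma diff_op_L2 i h : Lpow mu 2 h -> Lpow mu 2 (diff_op i h).
Proof. by move=> hi; apply: L2B => //; have [] := cexp_L2 spP (nes i) hi. Qed.

Lemma diff_op_L4 i h : Lpow mu 4 h -> Lpow mu 4 (diff_op i h).
Proof. by move=> hi; apply: L4B => //; have [] := cexp_L4 spP (nes i) hi. Qed.

Lemma increment_L1 i h : L1 mu h -> L1 mu (increment i h).
Proof. by move=> hi; apply/(cexp_L1 spP)/diff_op_L1. Qed.

Lemma partial_proj_L1 n h : L1 mu h -> L1 mu (partial_proj n h).
Proof. exact: (cexp_L1 spP). Qed.

Lemma cexp_diff_op i h : L1 mu h -> {ae mu, forall x, ce (nes i) (diff_op i h) x = 0}.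
Proof.
move=> hi; have := cexpB spP (nes i) hi (cexp_L1 spP (nes i) hi).
apply: filterS => x ->.
by rewrite (cexp_of_dep _ (cexp_dep spP _ _)) subrr.
Qed.

(** Projecting E_i h on the coordinates up to i leaves those strictly below i, as [les i] meets
    [nes i] in [lts i]: the increments are martingale differences. *)
Lemma increment_partial_proj i h : L1 mu h -> {ae mu, forall x, increment i h x = partial_proj i.+1 h x - partial_proj i h x}.
Proof.
move=> hi; have := cexp_tower spP (les i) (nes i) hi; rewrite les_nes.
apply: filterS2 (cexpB spP (les i) hi (cexp_L1 spP (nes i) hi)) => x e1 e2.
by rewrite /increment /diff_op e1 e2 /partial_proj -lesE.
Qed.

Lemma cexp_increment i h : L1 mu h -> {ae mu, forall x, ce (nes i) (increment i h) x = 0}.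
Proof.
move=> hi; have ti n := partial_proj_L1 n hi.
have e1 := cexp_ae spP (nes i) (increment_L1 i hi) (L1B (ti i.+1) (ti i)) (increment_partial_proj i hi).
have e2 := cexpB spP (nes i) (ti i.+1) (ti i).
have := cexp_tower spP (nes i) (les i) hi; rewrite lesE => e3.
have := cexp_tower spP (nes i) (lts i) hi; rewrite nes_lts => e4.
apply: filterS2 (filterI e1 e2) (filterI e3 e4) => x [-> ->] [].
rewrite /partial_proj => -> ->.
by rewrite -lesE setIC les_nes subrr.
Qed.

Lemma partial_proj0 h : partial_proj 0 h = fun=> Ex mu h.
Proof.
apply/funext => x; rewrite /partial_proj /cexp; congr Ex; apply/funext => y.
rewrite (_ : lts 0 = set0) ?(sp0 spP)//.
by apply/seteqP; split.
Qed.

(** An L1 form of the upward martingale convergence theorem. If k depends on the first N coordinates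
    and n >= N, then h minus its projection is h - k minus the projection of h - k, and the
    projection contracts L1; each part is at most e / 2. *)
Lemma partial_proj_cvg h : L1 mu h -> forall e : R, 0 < e ->
  exists N, forall n, (N <= n)%N -> Ex mu (fun x => `|h x - partial_proj n h x|) <= e.
Proof.
move=> hi e e0; have e2 : 0 < e / 2 by rewrite divr_gt0.
have [N [k [ki dk hk]]] := dense hi e2.
exists N => n Nn.
have dkn : dep sp (lts n) k.
  by apply: (dep_sub spP) dk => m; rewrite /lts/= => /leq_trans; apply.
have hki := L1B hi ki; have ti := partial_proj_L1 n hi.
have ci := cexp_L1 spP (lts n) hki.
have := Ex_norm_cexp spP (lts n) hki => le1.
apply: (@le_trans _ _ (Ex mu (fun x => `|h x - k x| + `|ce (lts n) (fun y => h y - k y) x|))).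
  apply: Ex_ae_le; [exact/L1_norm/L1B|by apply: L1D; exact: L1_norm|].
  apply: filterS (cexpB spP (lts n) hi ki) => x ->.
  rewrite (cexp_of_dep mu dkn) /partial_proj.
  have -> : h x - ce (lts n) h x = h x - k x - (ce (lts n) h x - k x) by ring.
  exact: ler_normB.
by rewrite ExD; [lra|exact: L1_norm..].
Qed.

Lemma diff_op_Ex i h : L1 mu h -> Ex mu (diff_op i h) = 0.
Proof. by move=> hi; rewrite ExB ?cexp_Ex ?subrr//; exact: cexp_L1. Qed.

(** The increment is the projection of D_i h, so one factor may be projected. Summed over i, this is
    what gives E Z = sigma^2. *)
Lemma Ex_diff_op_increment i h : Lpow mu 2 (diff_op i h) ->
  Ex mu (fun x => diff_op i h x * increment i h x) = Ex mu (fun x => increment i h x ^+ 2).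
Proof.
move=> d2; have [[mi2 i2] _] := cexp_L2 spP (les i) d2.
have [_ e] := cexp_cond spP (integrable_measurable (L2_L1 (conj mi2 i2)))
  (cexp_dep spP (les i) _) (L2_L1 d2) (L2M (conj mi2 i2) d2).
rewrite (_ : (fun x => increment i h x ^+ 2) = fun x => increment i h x * ce (les i) (diff_op i h) x).
  by rewrite e; congr Ex; apply/funext => x; rewrite mulrC.
by apply/funext => x; rewrite expr2.
Qed.

Lemma increment_L2 i h : Lpow mu 2 (diff_op i h) -> Lpow mu 2 (increment i h) /\
  Ex mu (fun x => increment i h x ^+ 2) <= Ex mu (fun x => diff_op i h x ^+ 2).
Proof. exact: cexp_L2. Qed.

Lemma increment_L4 i h : Lpow mu 4 (diff_op i h) -> Lpow mu 4 (increment i h) /\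
  Ex mu (fun x => increment i h x ^+ 4) <= Ex mu (fun x => diff_op i h x ^+ 4).
Proof. exact: cexp_L4. Qed.

Lemma Ex_dep_increment i h a : L1 mu h -> measurable_fun setT a -> dep sp (lts i) a ->
  L1 mu (fun x => a x * increment i h x) -> Ex mu (fun x => a x * increment i h x) = 0.
Proof.
move=> hi ma da ai.
have da' := dep_sub spP (@lts_sub_nes i) da.
have [i1 <-] := cexp_cond spP ma da' (increment_L1 i hi) ai.
rewrite -[RHS](@Ex_cst _ _ _ mu 0); apply: Ex_ae_eq => //.
  exact: (integrable_measurable i1).
by apply: filterS (cexp_increment i hi) => x ->; rewrite mulr0.
Qed.

Lemma partial_proj_succ i h : L1 mu h -> {ae mu, forall x, partial_proj i h x + increment i h x = partial_proj i.+1 h x}.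
Proof. by move=> hi; apply: filterS (increment_partial_proj i hi) => x ->; ring. Qed.

Lemma partial_proj_L2 h : L1 mu h -> (forall i, Lpow mu 2 (diff_op i h)) -> forall n,
  Lpow mu 2 (partial_proj n h) /\ Ex mu (fun x => partial_proj n h x ^+ 2) =
    Ex mu h ^+ 2 + \sum_(0 <= i < n) Ex mu (fun x => increment i h x ^+ 2).
Proof.
move=> hi d2; elim=> [|n [t2 te]].
  by rewrite partial_proj0 big_geq// addr0 Ex_cst; split=> //; exact: Lpow_cst.
have [i2 _] := increment_L2 (d2 n).
have mt := integrable_measurable (partial_proj_L1 n.+1 hi).
have s2 := L2D t2 i2.
split; first exact: ae_Lpow (partial_proj_succ n hi) s2.
have [_ ti] := t2; have [_ ii] := i2; have [ms si] := s2.
have cr := L2M t2 i2.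
transitivity (Ex mu (fun x => partial_proj n h x ^+ 2 + (2 * (partial_proj n h x * increment n h x) + increment n h x ^+ 2))).
  apply: Ex_ae_eq.
  - exact: measurable_funX.
  - apply: (@integrable_measurable _ _ _ mu); apply: L1D => //; apply: L1D => //; exact: L1Zl.
  - by apply: filterS (partial_proj_succ n hi) => x <-; ring.
have cr2 := L1Zl 2 cr.
rewrite (ExD ti (L1D cr2 ii)) (ExD cr2 ii) ExZl//.
rewrite (Ex_dep_increment hi (proj1 t2) (cexp_dep spP _ _) cr).
by rewrite mulr0 add0r te big_nat_recr//= addrA.
Qed.

Lemma tangent2 (t y : R) : t ^+ 2 + 2%:R * t ^+ 1 * (y - t) <= y ^+ 2.
Proof. have := sqr_ge0 (y - t); nra. Qed.

Lemma tangent4 (t y : R) : t ^+ 4 + 4%:R * t ^+ 3 * (y - t) <= y ^+ 4.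
Proof.
(* This sum of squares is exactly the gap between the two sides. *)
have h1 : 0 <= (y ^+ 2 - t ^+ 2) ^+ 2 + 2 * t ^+ 2 * (y - t) ^+ 2.
  by rewrite addr_ge0 ?sqr_ge0// mulr_ge0 ?sqr_ge0// mulr_ge0 ?sqr_ge0.
rewrite -subr_ge0; apply: le_trans h1 _; rewrite le_eqVlt; apply/orP; left; apply/eqP; ring.
Qed.

(** The Efron-Stein inequality. Square integrability is part of the conclusion, because the lemma is
    applied to Z and Zbar, which are only known to be in L1. *)
Lemma poincare h (B : R) : L1 mu h -> (forall i, Lpow mu 2 (diff_op i h)) ->
  (forall n, \sum_(0 <= i < n) Ex mu (fun x => increment i h x ^+ 2) <= B) ->
  Lpow mu 2 h /\ Ex mu (fun x => h x ^+ 2) <= Ex mu h ^+ 2 + B.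
Proof.
move=> hi d2 hB.
apply: (@moment_lsc _ _ _ mu 0 h (fun n => partial_proj n h) _ tangent2 hi) => [n|n|n|e e0].
- exact: partial_proj_L1.
- by have [] := partial_proj_L2 hi d2 n.
- by have [_ ->] := partial_proj_L2 hi d2 n; rewrite lerD2l.
- by have [N h'] := partial_proj_cvg hi e0; exists N; exact: h'.
Qed.

Lemma sum_increment_cvg h : Lpow mu 2 h -> Ex mu h = 0 ->
  (fun n => \sum_(0 <= i < n) Ex mu (fun x => increment i h x ^+ 2)) @ \oo -->
  Ex mu (fun x => h x ^+ 2).
Proof.
move=> h2 h0; have hi := L2_L1 h2.
have d2 i := diff_op_L2 i h2.
set S := fun n => _.
have Sub n : S n <= Ex mu (fun x => h x ^+ 2).
  have [_ te] := partial_proj_L2 hi d2 n; have [_] := cexp_L2 spP (lts n) h2.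
  by rewrite -/(partial_proj n h) te h0 expr0n/= add0r.
have Snd : nondecreasing_seq S.
  apply/nondecreasing_seqP => n; rewrite /S big_nat_recr//= lerDl.
  by apply: Ex_ge0 => x; exact: sqr_ge0.
apply/cvgrPdist_le => e e0.
(* Otherwise all partial sums stay below E h^2 - e, and [poincare] with this bound would give E h^2
   <= E h^2 - e. *)
have [N SN] : exists N, Ex mu (fun x => h x ^+ 2) - e < S N.
  apply: contrapT => /forallNP hN.
  have [|_] := @poincare h (Ex mu (fun x => h x ^+ 2) - e) hi d2.
    by move=> n; rewrite leNgt; exact/negP/hN.
  by rewrite h0; lra.
exists N => // n /= Nn.
have := Snd _ _ Nn; have := Sub n => *.
rewrite ger0_norm; lra.
Qed.

Lemma norm4_partial_proj h : L1 mu h -> Ex mu h = 0 -> (forall i, Lpow mu 4 (diff_op i h)) -> forall n,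
  Lpow mu 4 (partial_proj n h) /\
  norm4 mu (partial_proj n h) ^+ 2 <= 4 * \sum_(0 <= i < n) norm4 mu (diff_op i h) ^+ 2.
Proof.
move=> hi h0 d4; elim=> [|n [t4 te]].
  rewrite partial_proj0 h0 big_geq// mulr0; split; first exact: Lpow_cst.
  by rewrite norm4_sqr expr0n/= Ex_cst sqrtr0.
have [i4 i4d] := increment_L4 (d4 n).
have mt := integrable_measurable (partial_proj_L1 n.+1 hi).
have s4 := L4D t4 i4.
split; first exact: ae_Lpow (partial_proj_succ n hi) s4.
rewrite big_nat_recr//= mulrDr.
have yd : norm4 mu (increment n h) ^+ 2 <= norm4 mu (diff_op n h) ^+ 2.
  rewrite (norm4_sqr mu (increment n h)) (norm4_sqr mu (diff_op n h)) ler_sqrt//.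
  by apply: Ex_ge0 => w; exact: exprn_even_ge0.
have -> : norm4 mu (partial_proj n.+1 h) = norm4 mu (fun x => partial_proj n h x + increment n h x).
  congr (Num.sqrt (Num.sqrt _)); apply: Ex_ae_eq.
  - exact: measurable_funX.
  - by apply: measurable_funX; have [] := s4.
  - by apply: filterS (partial_proj_succ n hi) => z <-.
have o : Ex mu (fun x => partial_proj n h x ^+ 3 * increment n h x) = 0.
  apply: (Ex_dep_increment hi).
  - by apply: measurable_funX; have [] := t4.
  - by move=> u v; rewrite /partial_proj (cexp_dep spP).
  - have := L2M (L4_sqr t4) (L4M t4 i4).
    by congr (integrable _ _ (EFin \o _)); apply/funext => x; rewrite mulrA -exprSr.
apply: (le_trans (norm4_orth t4 i4 o)).
by apply: lerD => //; apply: ler_wpM2l.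
Qed.

Lemma norm4_le_sum h (B : R) : L1 mu h -> Ex mu h = 0 -> (forall i, Lpow mu 4 (diff_op i h)) ->
  (forall n, \sum_(0 <= i < n) norm4 mu (diff_op i h) ^+ 2 <= B) ->
  Lpow mu 4 h /\ norm4 mu h ^+ 2 <= 4 * B.
Proof.
move=> hi h0 d4 hB.
have B0 : 0 <= B by have := hB 0%N; rewrite big_geq.
have [||||h4 le4] := @moment_lsc _ _ _ mu 2 h (fun n => partial_proj n h) ((4 * B) ^+ 2) tangent4 hi.
- by move=> n; exact: partial_proj_L1.
- by move=> n; have [] := norm4_partial_proj hi h0 d4 n.
- move=> n; have [_ le1] := norm4_partial_proj hi h0 d4 n.
  rewrite -norm4_pow4 (exprM _ 2 2) lerXn2r// ?nnegrE ?sqr_ge0 ?mulr_ge0//.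
  by apply: (le_trans le1); rewrite ler_wpM2l.
- by move=> e e0; have [N h'] := partial_proj_cvg hi e0; exists N; exact: h'.
split=> //; rewrite norm4_sqr -[leRHS]ger0_norm ?mulr_ge0// -sqrtr_sqr.
by rewrite ler_sqrt ?sqr_ge0.
Qed.

End martingale.

(** * Almost sure limits of summable series *)

Section limn_measurable.
Context d (T : measurableType d) (R : realType).
Variable S : nat -> T -> R.
Hypothesis mS : forall n, measurable_fun setT (S n).

Let C : set T := [set x | cvgn (S ^~ x)].

(** The Cauchy criterion with countable quantifiers, which exhibits the set of convergence as
    measurable. *)
Let CE : C = \bigcap_k \bigcup_N \bigcap_(n in [set n | (N <= n)%N])
  [set x | `|S N x - S n x| <= k.+1%:R^-1].
Proof.
apply/seteqP; split=> x /=.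
  move=> /cvg_ex[l Sl] k _.
  have e0 : 0 < k.+1%:R^-1 / 2 :> R by rewrite divr_gt0// invr_gt0.
  have /cvgrPdist_le/(_ _ e0)[N _ NS] := Sl.
  exists N => // n /= Nn.
  have -> : S N x - S n x = (l - S n x) - (l - S N x) by ring.
  apply: (le_trans (ler_normB _ _)).
  by rewrite [leRHS]splitr lerD// ?NS/=.
move=> h; apply: cauchy_cvg; apply: cauchy_exP => e e0.
have [k ke] : exists k, k.+1%:R^-1 < e.
  exists (Num.truncn e^-1); rewrite -[ltRHS]invrK ltf_pV2 ?posrE ?invr_gt0//.
  exact: truncnS_gt.
have [N _ hN] := h k I.
exists (S N x); exists N => // n /= Nn.
exact: le_lt_trans (hN n Nn) ke.
Qed.

Let mC : measurable C.
Proof.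
rewrite CE; apply: bigcap_measurableType => k _; apply: bigcup_measurable => N _.
apply: bigcap_measurableType => n _.
rewrite -[X in measurable X]setTI.
have := @measurable_fun_ler _ T R setT (fun x => `|S N x - S n x|) (fun=> k.+1%:R^-1).
move=> /(_ _ (measurable_cst _)) h.
have /h : measurable_fun setT (fun x => `|S N x - S n x|).
  by apply: measurableT_comp => //; exact: measurable_funB.
move=> /(_ measurableT [set true]); apply.
by [].
Qed.

(** Off the set of convergence [limn] is the constant [point], so the function is measurable on all
    of T. *)
Lemma measurable_limn : measurable_fun setT (fun x => limn (S ^~ x)).
Proof.
rewrite -(setUv C); apply/measurable_funU => //; first exact: measurableC.
split.
  apply: (@measurable_fun_cvg _ _ _ C S) => // m.
  exact: measurable_funTS.
apply: (eq_measurable_fun (fun=> point)) => // x.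
by rewrite inE => /dvgP.
Qed.

End limn_measurable.

Section summable_series.
Context d (T : measurableType d) (R : realType) (P : probability T R).
Variables (u : nat -> T -> R) (B : R).
Hypotheses (ui : forall i, L1 P (u i))
  (uB : forall n, \sum_(0 <= i < n) Ex P (fun x => `|u i x|) <= B).

Let S n x := \sum_(0 <= i < n) u i x.
Let U x := limn (S ^~ x).
Let g x := (\sum_(0 <= i <oo) `|u i x|%:E)%E.

Let mS n : measurable_fun setT (S n).
Proof. by apply: measurable_sum => i; exact: integrable_measurable. Qed.

Let gi : P.-integrable setT g.
Proof.
have mu' n : measurable_fun setT (fun x => `|u n x|%:E).
  by apply/measurable_EFinP/measurableT_comp => //; exact: integrable_measurable.
have mg : measurable_fun setT g by apply: ge0_emeasurable_sum.
apply/integrableP; split=> //.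
under eq_integral do rewrite gee0_abs ?nneseries_ge0//.
rewrite integral_nneseries//.
apply: (@le_lt_trans _ _ B%:E); last exact: ltry.
apply: lime_le; first by apply: is_cvg_nneseries => n _ _; exact: integral_ge0.
apply: nearW => n.
under eq_bigr do rewrite -ExE ?L1_norm//.
by rewrite sumEFin lee_fin.
Qed.

Let S_le n x : (`|(S n x)%:E| <= g x)%E.
Proof.
apply: (@le_trans _ _ (\sum_(0 <= i < n) `|u i x|)%:E).
  by rewrite lee_fin ler_norm_sum.
by rewrite -sumEFin; exact: nneseries_lim_ge.
Qed.

Lemma summable_ae_cvg : {ae P, forall x, cvgn (S ^~ x)}.
Proof.
have := integrable_ae measurableT gi; apply: filterS => x /(_ I) gx.
have h : cvgn [normed series (u ^~ x)].
  apply: nondecreasing_is_cvgn.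
    by apply/nondecreasing_seqP => n; rewrite /normed_series_of /series/= big_nat_recr//= lerDl.
  exists (fine (g x)) => _ [n _ <-].
  rewrite -lee_fin fineK// /series/= -sumEFin; exact: nneseries_lim_ge.
exact: (normed_cvg h).
Qed.

Lemma measurable_series_lim : measurable_fun setT U.
Proof. exact: measurable_limn. Qed.

Let U_le : {ae P, forall x, (`|(U x)%:E| <= g x)%E}.
Proof.
apply: filterS summable_ae_cvg => x Sx.
have cU : (fun n => (`|S n x|)%:E) @ \oo --> (`|U x|)%:E.
  by apply: cvg_EFin; [exact: nearW|apply: cvg_norm; exact: Sx].
by apply: (cvge_to_le cU); apply: nearW => n; exact: S_le.
Qed.

Lemma series_lim_L1 : L1 P U.
Proof.
apply/integrableP; split; first exact/measurable_EFinP/measurable_series_lim.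
move/integrableP : gi => [mg]; apply: le_lt_trans.
apply: ae_ge0_le_integral => //.
- by apply: measurableT_comp => //; exact/measurable_EFinP/measurable_series_lim.
- exact: measurableT_comp.
- apply: filterS U_le => x Ux _; apply: (le_trans Ux).
  by rewrite gee0_abs// nneseries_ge0.
Qed.

(** Dominated convergence with majorant c times the sum of the |u i|. It is applied with [b] equal
    to 1, to Stein's derivative and to the indicator of G > z. *)
Lemma series_lim_Ex (b : T -> R) (c : R) : measurable_fun setT b ->
  (forall x, `|b x| <= c) ->
  (fun n => \sum_(0 <= i < n) Ex P (fun x => b x * u i x)) @ \oo -->
  Ex P (fun x => b x * U x).
Proof.
move=> mb bc.
have bi i := L1_bounded_mul mb bc (ui i).
have bU := L1_bounded_mul mb bc series_lim_L1.
have bS n : L1 P (fun x => b x * S n x).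
  by apply: (L1_bounded_mul mb bc); apply: L1_sum.
have c0 (x : T) : 0 <= c by exact: (le_trans (normr_ge0 _) (bc x)).
have [] := @dominated_convergence _ T R P setT measurableT
  (fun n x => (b x * S n x)%:E) (fun x => (b x * U x)%:E) (fun x => c%:E * g x)%E.
- by move=> n; exact: measurable_int (bS n).
- exact: measurable_int bU.
- apply: filterS summable_ae_cvg => x Sx _.
  apply: cvg_EFin; first exact: nearW.
  by apply: cvgM; [exact: cvg_cst|exact: Sx].
- exact: integrableZl.
- apply: aeW => x n _.
  rewrite EFinM abseM lee_pmul//.
  by rewrite lee_fin.
move=> _ _ cv.
have -> : (fun n => \sum_(0 <= i < n) Ex P (fun x => b x * u i x)) =
          fun n => fine (\int[P]_x (b x * S n x)%:E)%E.
  apply/funext => n; rewrite -Ex_sum//; congr Ex.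
  by apply/funext => x; rewrite /S mulr_sumr.
by apply: fine_cvg; rewrite ExE.
Qed.

End summable_series.

(** * First order expansion in one coordinate *)

Section stein_malliavin.
Context d (Om : measurableType d) (R : realType) (mu : probability Om R).
Variables (sp : set nat -> Om -> Om -> Om) (spP : resampling mu sp).
Let mu2 : probability (Om * Om)%type R := (mu \x mu)%E.

Local Notation ce := (cexp mu sp).
Local Notation Dif := (diff_op mu sp).
Local Notation Inc := (increment mu sp).
Local Notation Trm := (partial_proj mu sp).

Definition Zterm (i : nat) (F : Om -> R) x := Dif i F x * Inc i F x.

Definition Zbterm (i : nat) (F : Om -> R) :=
  Dif i (fun x => Dif i F x * (`|Inc i F x| + ce (nes i) (fun y => `|Inc i F y|) x)).

Variable F : Om -> R.
Hypothesis F4 : Lpow mu 4 F.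

Let F2 : Lpow mu 2 F. Proof. exact: L4_L2. Qed.
Let F1 : L1 mu F. Proof. exact: L2_L1. Qed.
Let mF : measurable_fun setT F. Proof. by have [] := F4. Qed.

Section one_coordinate.
Variable i : nat.

Let D := Dif i F.
Let M := Inc i F.
Let V x := `|M x|.
Let e := ce (nes i).
Let spi (z : Om * Om) := sp (nes i) z.1 z.2.

Let D4 : Lpow mu 4 D. Proof. exact: diff_op_L4. Qed.
Let M4 : Lpow mu 4 M. Proof. by have [] := increment_L4 spP D4. Qed.
Let V4 : Lpow mu 4 V. Proof. exact: Lpow_norm. Qed.
Let eV4 : Lpow mu 4 (e V). Proof. by have [] := cexp_L4 spP (nes i) V4. Qed.
Let eF4 : Lpow mu 4 (e F). Proof. by have [] := cexp_L4 spP (nes i) F4. Qed.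

Let L4_1 (f : Om -> R) : Lpow mu 4 f -> L1 mu f.
Proof. by move=> /L4_L2/L2_L1. Qed.

Let L4_m n (f : Om -> R) : Lpow mu n f -> measurable_fun setT f.
Proof. by case. Qed.

Let L4M_1 (f g : Om -> R) : Lpow mu 4 f -> Lpow mu 4 g -> L1 mu (fun x => f x * g x).
Proof. by move=> f4 g4; exact/L2_L1/L4M. Qed.

Let l1 n (f : Om -> R) : Lpow mu n f -> Lpow mu2 n (fun z => f z.1).
Proof. exact: (preserves_Lpow (fst_preserves mu)). Qed.

Let l2 n (f : Om -> R) : Lpow mu n f -> Lpow mu2 n (fun z => f (spi z)).
Proof. exact: (preserves_Lpow (sp12_preserves spP (nes i))). Qed.

(** The right-hand side is what integrating (V + V') (F - F') over the copy of X_i produces, primes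
    marking the resampled values. This identifies [Zbterm] as that integral. *)
Lemma Zbterm_ae : {ae mu, forall x, Zbterm i F x =
  F x * V x + F x * e V x - e F x * V x - e (fun y => F y * V y) x}.
Proof.
have FV := L4M_1 F4 V4; have FeV := L4M_1 F4 eV4.
have eFV := L4M_1 eF4 V4; have eFeV := L4M_1 eF4 eV4.
have deF : dep sp (nes i) (e F) by exact: cexp_dep.
have deV : dep sp (nes i) (e V) by exact: cexp_dep.
have s1 := L1B FV eFV; have s2 := L1B FeV eFeV.
have E1 := cexpD spP (nes i) s1 s2.
have E2 := cexpB spP (nes i) FV eFV.
have E3 := cexpB spP (nes i) FeV eFeV.
have P1 := cexp_pull spP deF (L4_1 V4).
have P2 := cexp_pull spP deV (L4_1 F4).
apply: filterS3 (filterI E1 (filterI E2 E3)) P1 P2 => x [e1 [e2 e3]] p1 p2.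
rewrite /Zbterm /diff_op -/e -/D -/M -/V.
have -> : e (fun y => (F y - e F y) * (V y + e V y)) x =
  e (fun y => F y * V y - e F y * V y + (F y * e V y - e F y * e V y)) x.
  by congr Ex; apply/funext => y /=; rewrite /e; ring.
rewrite [in X in _ - X]/e e1 e2 e3 p1.
have -> : ce (nes i) (fun y => F y * e V y) x = e F x * e V x.
  rewrite mulrC -p2; congr Ex; apply/funext => y; exact: mulrC.
have dee : dep sp (nes i) (fun y => e F y * e V y) by exact (fun a b => f_equal2 *%R (deF a b) (deV a b)).
by rewrite (cexp_of_dep mu dee) /e /V; ring.
Qed.

Lemma Zbterm_L1 : L1 mu (Zbterm i F).
Proof. by apply: (diff_op_L1 spP); apply: L4M_1 => //; exact: L4D. Qed.

Lemma Zterm_L1 : L1 mu (Zterm i F).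
Proof. exact: L4M_1. Qed.

Variables (s z : R) (s0 : 0 < s).

Let I x : R := (z < F x / s)%R%:R.

Let mI : measurable_fun setT I.
Proof.
rewrite (_ : I = \1_(`]z, +oo[) \o (fun x => F x / s)); last first.
  by apply/funext => x; rewrite /= indicE mem_setE in_itv/= andbT.
apply: measurableT_comp; first exact: measurable_indic.
exact: measurable_funM.
Qed.

Let I1 x : `|I x| <= 1. Proof. by rewrite /I; case: (_ < _); rewrite ?normr1 ?normr0. Qed.

Let I4 : Lpow mu 4 I. Proof. exact: Lpow_bounded I1. Qed.

Lemma Ex_swap (H : Om * Om -> R) : L1 mu2 H ->
  Ex mu2 (fun w => H (spi w, sp (nes i) w.2 w.1)) = Ex mu2 H.
Proof. exact: (preserves_Ex (sp_preserves spP (nes i))). Qed.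

(** Exchanging X_i with its copy turns - V (F - F') I' into V' (F - F') I, so the left-hand side is
    the integral of (V + V') (F - F') I; the copy is then integrated out. *)
Lemma Ex_indicator : Ex mu2 (fun w => V w.1 * ((F w.1 - F (spi w)) * (I w.1 - I (spi w)))) =
  Ex mu (fun x => I x * Zbterm i F x).
Proof.
pose H w := V w.1 * ((F w.1 - F (spi w)) * I w.1).
pose H' w := V (spi w) * ((F w.1 - F (spi w)) * I w.1).
have dF4 := L4B (l1 F4) (l2 F4).
have L4b (f : Om * Om -> R) : Lpow mu2 4 f -> L1 mu2 (fun w => f w * ((F w.1 - F (spi w)) * I w.1)).
  move=> f4; have := L1_bounded_mul (B := 1) (l1 I4).1 (fun w => I1 w.1) (L2_L1 (L4M f4 dF4)).
  by congr (integrable _ _ (EFin \o _)); apply/funext => w; ring.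
have Hi : L1 mu2 H by exact: L4b (l1 V4).
have Hi' : L1 mu2 H' by exact: L4b (l2 V4).
transitivity (Ex mu2 (fun w => H w + H' w)).
  rewrite (ExD Hi Hi'); have <- := Ex_swap Hi'.
  have Hsw : L1 mu2 (fun w => H' (spi w, sp (nes i) w.2 w.1)).
    exact: (preserves_L1 (sp_preserves spP (nes i))).
  rewrite -(ExD Hi Hsw); congr Ex; apply/funext => w.
  by rewrite /H /H' /spi /= (sp_id spP); ring.
pose a1 x := I x * V x; pose a2 x := I x * F x.
have a14 : Lpow mu 4 a1 by exact: Lpow_bounded_mul mI I1 V4.
have a24 : Lpow mu 4 a2 by exact: Lpow_bounded_mul mI I1 F4.
have FV := L4M_1 F4 V4.
have t1 := L2_L1 (L4M (l1 a14) (l1 F4)).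
have t2 := L2_L1 (L4M (l1 a14) (l2 F4)).
have t3 := L2_L1 (L4M (l1 a24) (l2 V4)).
have t4 : L1 mu2 (fun w => I w.1 * (F (spi w) * V (spi w))).
  apply: (L1_bounded_mul (B := 1) (l1 I4).1 (fun w => I1 w.1)).
  exact: L2_L1 (L4M (l2 F4) (l2 V4)).
transitivity (Ex mu2 (fun w => a1 w.1 * F w.1 - a1 w.1 * F (spi w) + a2 w.1 * V (spi w)
    - I w.1 * (F (spi w) * V (spi w)))).
  congr Ex; apply/funext => w; rewrite /H /H' /a1 /a2.
  by move: (V w.1) (V (spi w)) (F w.1) (F (spi w)) (I w.1) => *; ring.
rewrite (ExB (L1D (L1B t1 t2) t3) t4) (ExD (L1B t1 t2) t3) (ExB t1 t2).
have [j2 <-] := cexp_pair spP (L4_m a14) (L4_1 F4) t2.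
have [j3 <-] := cexp_pair spP (L4_m a24) (L4_1 V4) t3.
have [j4 <-] := cexp_pair spP mI FV t4.
rewrite (preserves_Ex (fst_preserves mu) (f := fun x => a1 x * F x)); last exact: L4M_1.
have j1 := L4M_1 a14 F4.
rewrite -(ExB j1 j2) -(ExD (L1B j1 j2) j3) -(ExB (L1D (L1B j1 j2) j3) j4).
apply: Ex_ae_eq.
- exact: integrable_measurable (L1B (L1D (L1B j1 j2) j3) j4).
- by apply: measurable_funM => //; exact: integrable_measurable Zbterm_L1.
- by apply: filterS Zbterm_ae => x ->; rewrite /a1 /a2 /e; ring.
Qed.

Let norm4M : norm4 mu M <= norm4 mu D.
Proof.
rewrite ler_sqrt ?sqrtr_ge0// ler_sqrt; first by have [] := increment_L4 spP D4.
by apply: Ex_ge0 => x; exact: exprn_even_ge0.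
Qed.

Let norm4V : norm4 mu V = norm4 mu M.
Proof.
congr (Num.sqrt (Num.sqrt (Ex _ _))); apply/funext => x.
by rewrite /V -normrX ger0_norm// exprn_even_ge0.
Qed.

Let norm4_l1 (f : Om -> R) : Lpow mu 4 f -> norm4 mu2 (fun z => f z.1) = norm4 mu f.
Proof.
move=> [_ fi]; congr (Num.sqrt (Num.sqrt _)).
exact: (preserves_Ex (fst_preserves mu) fi).
Qed.

Let norm4_l2 (f : Om -> R) : Lpow mu 4 f -> norm4 mu2 (fun z => f (spi z)) = norm4 mu f.
Proof.
move=> [_ fi]; congr (Num.sqrt (Num.sqrt _)).
exact: (preserves_Ex (sp12_preserves spP (nes i)) fi).
Qed.

Let Fdiff w : F w.1 - F (spi w) = D w.1 - D (spi w).
Proof. by rewrite /D /diff_op /spi (cexp_dep spP); ring. Qed.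

Lemma quadratic_L1 (b : Om -> R) : Lpow mu 4 b ->
  L1 mu2 (fun w => V w.1 * b w.1 * ((F w.1 - F (spi w)) * (F w.1 - F (spi w)))).
Proof.
move=> b4; have d4 := L4B (l1 F4) (l2 F4).
exact: (L2M (L4M (l1 V4) (l1 b4)) (L4M d4 d4)).
Qed.

(** As E_i F does not feel the resampling, F - F' = D - D'. The cross term vanishes because E_i D =
    0, and each of the two squares contributes at most once the norm of b times the cube of that of
    D. *)
Lemma Ex_quadratic (b : Om -> R) : Lpow mu 4 b ->
  Ex mu2 (fun w => V w.1 * b w.1 * ((F w.1 - F (spi w)) * (F w.1 - F (spi w)))) <=
  2 * norm4 mu b * norm4 mu D ^+ 3.
Proof.
move=> b4.
have V4' := l1 V4; have c4' := l1 b4; have D4' := l1 D4; have D4s := l2 D4.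
have q1 := L2M (L4M V4' c4') (L4M D4' D4').
have q2 := L2M (L4M V4' c4') (L4M D4' D4s).
have q3 := L2M (L4M V4' c4') (L4M D4s D4s).
have q22 := L1Zl 2 q2.
have -> : Ex mu2 (fun w => V w.1 * b w.1 * ((F w.1 - F (spi w)) * (F w.1 - F (spi w)))) =
  Ex mu2 (fun w => V w.1 * b w.1 * (D w.1 * D w.1) - 2 * (V w.1 * b w.1 * (D w.1 * D (spi w)))
    + V w.1 * b w.1 * (D (spi w) * D (spi w))).
  congr Ex; apply/funext => w; rewrite Fdiff.
  by move: (D w.1) (D (spi w)) (V w.1) (b w.1) => *; ring.
rewrite (ExD (L1B q1 q22) q3) (ExB q1 q22) (ExZl 2 q2).
have cross : Ex mu2 (fun w => V w.1 * b w.1 * (D w.1 * D (spi w))) = 0.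
  pose a x := V x * b x * D x.
  have ma : measurable_fun setT a.
    exact: (measurable_funM (measurable_funM (L4_m V4) (L4_m b4)) (L4_m D4)).
  have ai : L1 mu2 (fun w => a w.1 * D (spi w)).
    by move: q2; congr (integrable _ _ (EFin \o _)); apply/funext => w; rewrite /a !mulrA.
  have [j] := cexp_pair spP ma (L4_1 D4) ai.
  have -> : Ex mu2 (fun w => V w.1 * b w.1 * (D w.1 * D (spi w))) =
            Ex mu2 (fun w => a w.1 * D (spi w)).
    by congr Ex; apply/funext => w; rewrite /a !mulrA.
  move=> <-; rewrite -[RHS](Ex_cst mu 0); apply: Ex_ae_eq => //.
    exact: (integrable_measurable j).
  by apply: filterS (cexp_diff_op spP i F1) => x ->; rewrite mulr0.
rewrite cross mulr0 subr0.
have h1 := hoelder4 V4' c4' D4' D4'.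
have h3 := hoelder4 V4' c4' D4s D4s.
rewrite !norm4_l1// norm4V in h1.
rewrite !norm4_l1// norm4_l2// norm4V in h3.
have g1 := Ex_le q1 (L1_norm q1) (fun x => ler_norm _).
have g3 := Ex_le q3 (L1_norm q3) (fun x => ler_norm _).
have le1 : norm4 mu M * norm4 mu b * (norm4 mu D * norm4 mu D) <=
           norm4 mu b * norm4 mu D ^+ 3.
  have -> : norm4 mu b * norm4 mu D ^+ 3 = norm4 mu D * norm4 mu b * (norm4 mu D * norm4 mu D).
    by ring.
  apply: ler_wpM2r; first by rewrite mulr_ge0 ?norm4_ge0.
  by apply: ler_wpM2r norm4M; exact: norm4_ge0.
apply: (le_trans (lerD (le_trans g1 h1) (le_trans g3 h3))).
by apply: (le_trans (lerD le1 le1)); rewrite -[in leRHS]mulrA [in leRHS]mulr_natl mulr2n.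
Qed.

Let phi x := stein_sol z (F x / s).
Let dphi x := stein_deriv z (F x / s).

Let mphi : measurable_fun setT phi.
Proof. by apply: (measurableT_comp (measurable_stein_sol z)); exact: measurable_funM. Qed.

Let mdphi : measurable_fun setT dphi.
Proof. by apply: (measurableT_comp (measurable_stein_deriv z)); exact: measurable_funM. Qed.

Let phi_le x : `|phi x| <= 3 / 2.
Proof. by rewrite ger0_norm ?stein_sol_ge0// stein_sol_ub. Qed.

Let dphi_le x : `|dphi x| <= 1. Proof. exact: stein_deriv_le1. Qed.

(** [stein_taylor] multiplied by M and integrated. The indicator term is kept without absolute value
    so that summation over i assembles [Zbar] before any modulus is taken; the factor 1/2 of the
    quadratic term cancels the 2 of [Ex_quadratic]. *)
Lemma stein_remainder :
  `|Ex mu (fun x => phi x * M x) - s^-1 * Ex mu (fun x => dphi x * Zterm i F x)| <=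
  s^-1 * Ex mu (fun x => I x * Zbterm i F x) +
  s^-1 ^+ 2 * (s^-1 * norm4 mu F + 3 / 2) * norm4 mu D ^+ 3.
Proof.
have M1 := L4_1 M4.
have phi4 : Lpow mu 4 phi by exact: Lpow_bounded phi_le.
have dphi4 : Lpow mu 4 dphi by exact: Lpow_bounded dphi_le.
have dM4 : Lpow mu 4 (fun x => dphi x * M x) by exact: Lpow_bounded_mul mdphi dphi_le M4.
have p1 := L2_L1 (L4M (l1 phi4) (l1 M4)).
have p2 := L2_L1 (L4M (l2 phi4) (l1 M4)).
have p3 := L2_L1 (L4M (l1 dM4) (l1 F4)).
have p4 := L2_L1 (L4M (l1 dM4) (l2 F4)).
(* The subtracted term is 0: exchange X_i with its copy, then integrate the copy, using E_i M =
   0. *)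
have e1 : Ex mu (fun x => phi x * M x) =
    Ex mu2 (fun w => phi w.1 * M w.1) - Ex mu2 (fun w => phi (spi w) * M w.1).
  rewrite (preserves_Ex (fst_preserves mu) (f := fun x => phi x * M x)); last exact: L4M_1.
  suff -> : Ex mu2 (fun w => phi (spi w) * M w.1) = 0 by rewrite subr0.
  have <- := Ex_swap p2.
  have p5 := L2_L1 (L4M (l1 phi4) (l2 M4)).
  transitivity (Ex mu2 (fun w => phi w.1 * M (spi w))).
    by congr Ex; apply/funext => w; rewrite /spi/= (sp_id spP).
  have [j <-] := cexp_pair spP mphi M1 p5.
  rewrite -[RHS](Ex_cst mu 0); apply: Ex_ae_eq => //.
    exact: (integrable_measurable j).
  by apply: filterS (cexp_increment spP i F1) => x ->; rewrite mulr0.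
(* Integrating the copy turns F - F' into D_i F, the first factor of [Zterm]. *)
have e2 : Ex mu (fun x => dphi x * Zterm i F x) =
    Ex mu2 (fun w => dphi w.1 * M w.1 * F w.1) - Ex mu2 (fun w => dphi w.1 * M w.1 * F (spi w)).
  have [j <-] := cexp_pair spP (L4_m dM4) F1 p4.
  have j1 := L4M_1 dM4 F4.
  rewrite (preserves_Ex (fst_preserves mu) (f := fun x => dphi x * M x * F x))//.
  rewrite -(ExB j1 j); congr Ex; apply/funext => x.
  by rewrite /Zterm /diff_op -/M; ring.
rewrite e1 e2 -(ExB p1 p2) -(ExB p3 p4).
have p12 := L1B p1 p2; have p34 := L1Zl s^-1 (L1B p3 p4).
rewrite -(ExZl s^-1 (L1B p3 p4)) -(ExB p12 p34).
apply: (le_trans (ler_norm_Ex (L1B p12 p34))).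
have nF4 := Lpow_norm F4; have one4 := Lpow_cst mu 4 1.
have qF := quadratic_L1 nF4; have q1 := quadratic_L1 one4.
pose H w := V w.1 * ((F w.1 - F (spi w)) * (I w.1 - I (spi w))).
have Hi : L1 mu2 H.
  have := L2M (L4M (l1 V4) (L4B (l1 F4) (l2 F4))) (L4_L2 (L4B (l1 I4) (l2 I4))).
  by congr (integrable _ _ (EFin \o _)); apply/funext => w; rewrite /H mulrA.
have sH := L1Zl s^-1 Hi; have sqF := L1Zl (s^-1 ^+ 3 / 2) qF.
have sq1 := L1Zl (s^-1 ^+ 2 / 2 * (3 / 2)) q1.
have -> : Ex mu (fun x => I x * Zbterm i F x) = Ex mu2 H by rewrite Ex_indicator.
(* The weight |F / s| + 3/2 is split, so that [Ex_quadratic] applies with b = |F| and with b = 1. *)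
apply: (@le_trans _ _ (Ex mu2 (fun w => s^-1 * H w + (s^-1 ^+ 3 / 2 *
    (V w.1 * `|F w.1| * ((F w.1 - F (spi w)) * (F w.1 - F (spi w)))) +
    s^-1 ^+ 2 / 2 * (3 / 2) * (V w.1 * 1 * ((F w.1 - F (spi w)) * (F w.1 - F (spi w)))))))).
  apply: (Ex_le (L1_norm (L1B p12 p34)) (L1D sH (L1D sqF sq1))) => w.
  have := stein_taylor z (F w.1 / s) (F (spi w) / s).
  rewrite -/(phi _) -/(phi _) -/(dphi _) -/(I _) -/(I _) => t.
  have -> : phi w.1 * M w.1 - phi (spi w) * M w.1 - s^-1 * (dphi w.1 * M w.1 * F w.1 -
      dphi w.1 * M w.1 * F (spi w)) =
    M w.1 * (phi w.1 - phi (spi w) - (F w.1 / s - F (spi w) / s) * dphi w.1).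
    by move: (phi _) (phi _) (M _) (dphi _) (F _) (F _) => *; ring.
  rewrite normrM; apply: (le_trans (ler_wpM2l (normr_ge0 _) t)).
  rewrite -/(V _) normrM (ger0_norm (x := s^-1)) ?invr_ge0 ?(ltW s0)// /H.
  move: (V _) (I _) (I _) (F _) (F _) => v j j' f f'.
  rewrite le_eqVlt; apply/orP; left; apply/eqP; move: `|f'| => nf.
  by ring.
rewrite (ExD sH (L1D sqF sq1)) (ExD sqF sq1) (ExZl _ Hi) (ExZl _ qF) (ExZl _ q1) lerD2l.
have hF := Ex_quadratic nF4; have h1 := Ex_quadratic one4.
have nF : norm4 mu (fun x => `|F x|) = norm4 mu F.
  congr (Num.sqrt (Num.sqrt (Ex _ _))); apply/funext => x.
  by rewrite -normrX ger0_norm// exprn_even_ge0.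
have n1 : norm4 mu (fun=> 1) = 1 by rewrite /norm4 expr1n Ex_cst !sqrtr1.
rewrite nF in hF; rewrite n1 in h1.
have si : 0 <= s^-1 by rewrite invr_ge0 ltW.
have c1 : 0 <= s^-1 ^+ 3 / 2 by rewrite divr_ge0// exprn_ge0.
have c2 : 0 <= s^-1 ^+ 2 / 2 * (3 / 2) by apply: mulr_ge0; [rewrite divr_ge0// exprn_ge0|rewrite divr_ge0].
apply: (le_trans (lerD (ler_wpM2l c1 hF) (ler_wpM2l c2 h1))).
by move: (norm4 mu F) (norm4 mu D) s^-1 => *; rewrite le_eqVlt; apply/orP; left; apply/eqP; field.
Qed.

End one_coordinate.

End stein_malliavin.

(** * The bound on the sequence space *)

Section berry_esseen.
Context d (Om : measurableType d) (R : realType) (mu : probability Om R).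
Variables (sp : set nat -> Om -> Om -> Om) (spP : resampling mu sp).

Local Notation ce := (cexp mu sp).
Local Notation Dif := (diff_op mu sp).
Local Notation Inc := (increment mu sp).
Local Notation Trm := (partial_proj mu sp).
Local Notation Zterm := (Zterm mu sp).
Local Notation Zbterm := (Zbterm mu sp).

Hypothesis dense : forall h, L1 mu h -> approx mu sp h.

Lemma norm4_le (f g : Om -> R) :
  Ex mu (fun x => f x ^+ 4) <= Ex mu (fun x => g x ^+ 4) -> norm4 mu f <= norm4 mu g.
Proof.
move=> fg; rewrite ler_sqrt ?sqrtr_ge0// ler_sqrt//.
by apply: Ex_ge0 => x; exact: exprn_even_ge0.
Qed.

Lemma norm4_norm (f : Om -> R) : norm4 mu (fun x => `|f x|) = norm4 mu f.
Proof.
congr (Num.sqrt (Num.sqrt (Ex _ _))); apply/funext => x.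
by rewrite -normrX ger0_norm// exprn_even_ge0.
Qed.

Lemma Ex_normM_le (f g : Om -> R) : Lpow mu 4 f -> Lpow mu 4 g ->
  Ex mu (fun x => `|f x * g x|) <= norm4 mu f * norm4 mu g.
Proof.
move=> f4 g4; have o := Lpow_cst mu 4 1.
have n1 : norm4 mu (fun=> 1) = 1 by rewrite /norm4 expr1n Ex_cst !sqrtr1.
have := hoelder4 f4 g4 o o; rewrite n1 !mulr1.
by under [X in Ex _ X]eq_fun do rewrite mulr1.
Qed.

Variables (F : Om -> R) (s S S3 : R).
Hypotheses (F2 : Lpow mu 2 F) (F0 : Ex mu F = 0) (s0 : 0 < s)
  (Fs : Ex mu (fun x => F x ^+ 2) = s ^+ 2)
  (D4 : forall i, Lpow mu 4 (Dif i F))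
  (SP : forall n, \sum_(0 <= i < n) norm4 mu (Dif i F) ^+ 2 <= S)
  (S3P : forall n, \sum_(0 <= i < n) norm4 mu (Dif i F) ^+ 3 <= S3).

Definition Zlim x : R := limn (fun n => \sum_(0 <= i < n) Zterm i F x).
Definition Zblim x : R := limn (fun n => \sum_(0 <= i < n) Zbterm i F x).

Let F1 : L1 mu F. Proof. exact: L2_L1. Qed.

Let S_ge0 : 0 <= S. Proof. by have := SP 0; rewrite big_geq. Qed.

Lemma F_L4 : Lpow mu 4 F /\ norm4 mu F ^+ 2 <= 4 * S.
Proof. exact: (norm4_le_sum spP dense F1 F0 D4 SP). Qed.

Let F4 : Lpow mu 4 F. Proof. by have [] := F_L4. Qed.

Let mF : measurable_fun setT F. Proof. by have [] := F2. Qed.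

Let Inc4 i : Lpow mu 4 (Inc i F). Proof. by have [] := increment_L4 spP (D4 i). Qed.

Lemma norm4_increment i : norm4 mu (Inc i F) <= norm4 mu (Dif i F).
Proof. by apply: norm4_le; have [] := increment_L4 spP (D4 i). Qed.

Lemma Ex_increment_sqr i : Ex mu (fun x => Inc i F x ^+ 2) <= norm4 mu (Dif i F) ^+ 2.
Proof.
have -> : Ex mu (fun x => Inc i F x ^+ 2) = Ex mu (fun x => `|Inc i F x * Inc i F x|).
  by congr Ex; apply/funext => x; rewrite -expr2 ger0_norm ?sqr_ge0.
apply: (le_trans (Ex_normM_le (Inc4 i) (Inc4 i))); rewrite expr2.
by apply: ler_pM; rewrite ?norm4_ge0 ?norm4_increment.
Qed.

Lemma sigma_le : s ^+ 2 <= S.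
Proof.
have [i|n|_] := @poincare _ _ _ _ _ spP dense F S F1.
- exact: L4_L2.
- by apply: (le_trans _ (SP n)); apply: ler_sum => i _; exact: Ex_increment_sqr.
by rewrite Fs F0 expr0n/= add0r.
Qed.

Let ZB n : \sum_(0 <= i < n) Ex mu (fun x => `|Zterm i F x|) <= S.
Proof.
apply: (le_trans _ (SP n)); apply: ler_sum => i _.
apply: (le_trans (Ex_normM_le (D4 i) (Inc4 i))); rewrite expr2.
by rewrite ler_wpM2l ?norm4_ge0 ?norm4_increment.
Qed.

Let Zi i : L1 mu (Zterm i F). Proof. exact: (Zterm_L1 spP F4). Qed.
Let Zbi i : L1 mu (Zbterm i F). Proof. exact: (Zbterm_L1 spP F4). Qed.

Let ZbB n : \sum_(0 <= i < n) Ex mu (fun x => `|Zbterm i F x|) <= 4 * S.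
Proof.
(* A factor 2 comes from the summands |M| and E_i |M|, another from D_i, which at most doubles an L1
   norm. *)
apply: (@le_trans _ _ (\sum_(0 <= i < n) 4 * norm4 mu (Dif i F) ^+ 2)); last first.
  by rewrite -mulr_sumr ler_wpM2l.
apply: ler_sum => i _.
have V4 := Lpow_norm (Inc4 i).
have [eV4 eVle] := cexp_L4 spP (nes i) V4.
pose A x := Dif i F x * (`|Inc i F x| + ce (nes i) (fun y => `|Inc i F y|) x).
have a1 := L2_L1 (L4M (D4 i) V4); have a2 := L2_L1 (L4M (D4 i) eV4).
have Ai : L1 mu A by exact: (L2_L1 (L4M (D4 i) (L4D V4 eV4))).
have eA := cexp_L1 spP (nes i) Ai.
have AE : Ex mu (fun x => `|A x|) <= 2 * norm4 mu (Dif i F) ^+ 2.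
  apply: (@le_trans _ _ (Ex mu (fun x => `|Dif i F x * `|Inc i F x| | +
      `|Dif i F x * ce (nes i) (fun y => `|Inc i F y|) x|))).
    apply: (Ex_le (L1_norm Ai) (L1D (L1_norm a1) (L1_norm a2))) => x.
    by rewrite /A mulrDr; exact: ler_normD.
  rewrite (ExD (L1_norm a1) (L1_norm a2)).
  apply: (le_trans (lerD (Ex_normM_le (D4 i) V4) (Ex_normM_le (D4 i) eV4))).
  have n1 := norm4_le eVle; rewrite (norm4_norm (Inc i F)) in n1; rewrite (norm4_norm (Inc i F)).
  have n2 := norm4_increment i; have n0 := norm4_ge0 mu (Dif i F).
  have E2 (a : R) : 2 * a ^+ 2 = a * a + a * a by ring.
  rewrite E2; exact: (lerD (ler_wpM2l n0 n2) (ler_wpM2l n0 (le_trans n1 n2))).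
apply: (@le_trans _ _ (Ex mu (fun x => `|A x| + `|ce (nes i) A x|))).
  apply: (Ex_le (L1_norm (Zbi i)) (L1D (L1_norm Ai) (L1_norm eA))) => x.
  exact: ler_normB.
rewrite (ExD (L1_norm Ai) (L1_norm eA)).
have := Ex_norm_cexp spP (nes i) Ai; move: AE.
move: (Ex _ _) (Ex _ _) (norm4 _ _ ^+ 2) => *; lra.
Qed.

Lemma Zlim_L1 : L1 mu Zlim. Proof. exact: (series_lim_L1 Zi ZB). Qed.
Lemma Zblim_L1 : L1 mu Zblim. Proof. exact: (series_lim_L1 Zbi ZbB). Qed.

Let bound1 (x : Om) : `|1 : R| <= 1. Proof. by rewrite normr1. Qed.

Let m1 : measurable_fun setT (fun _ : Om => 1 : R). Proof. by []. Qed.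

Lemma Ex_Zlim : Ex mu Zlim = s ^+ 2.
Proof.
have := series_lim_Ex Zi ZB m1 bound1.
under eq_fun do under eq_bigr do under [X in Ex _ X]eq_fun do rewrite mul1r.
under [X in Ex _ X]eq_fun do rewrite mul1r.
have -> : (fun n => \sum_(0 <= i < n) Ex mu (Zterm i F)) =
          (fun n => \sum_(0 <= i < n) Ex mu (fun x => Inc i F x ^+ 2)).
  apply/funext => n; apply: eq_bigr => i _.
  exact: (Ex_diff_op_increment spP (L4_L2 (D4 i))).
have := sum_increment_cvg spP dense F2 F0; rewrite Fs => c1 c2.
exact: (cvg_unique _ c2 c1).
Qed.

(** Every term lies in the range of D_i and so is centred. Hence E|Zbar| is a centred moment,
    bounded by the standard deviation. *)
Lemma Ex_Zblim : Ex mu Zblim = 0.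
Proof.
have := series_lim_Ex Zbi ZbB m1 bound1.
under eq_fun do under eq_bigr do under [X in Ex _ X]eq_fun do rewrite mul1r.
under [X in Ex _ X]eq_fun do rewrite mul1r.
have -> : (fun n => \sum_(0 <= i < n) Ex mu (Zbterm i F)) = fun=> 0.
  apply/funext => n; rewrite big1// => i _; apply: (diff_op_Ex spP).
  by have V4 := Lpow_norm (Inc4 i); have [eV4 _] := cexp_L4 spP (nes i) V4;
     exact: (L2_L1 (L4M (D4 i) (L4D V4 eV4))).
by move=> c; exact: (cvg_unique _ c (cvg_cst 0)).
Qed.

Lemma sum_Ex_increment (phi : Om -> R) (c : R) : measurable_fun setT phi ->
  (forall x, `|phi x| <= c) ->
  (fun n => \sum_(0 <= i < n) Ex mu (fun x => phi x * Inc i F x)) @ \oo -->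
  Ex mu (fun x => phi x * F x).
Proof.
move=> mphi phic.
have c0 : 0 <= c by exact: (le_trans (normr_ge0 _) (phic point)).
have pI i := L1_bounded_mul mphi phic (increment_L1 spP i F1).
have pT n := L1_bounded_mul mphi phic (partial_proj_L1 spP n F1).
have pF := L1_bounded_mul mphi phic F1.
(* The increments telescope, and the projection on no coordinates is the mean of F, which is 0. *)
have E n : \sum_(0 <= i < n) Ex mu (fun x => phi x * Inc i F x) =
    Ex mu (fun x => phi x * Trm n F x).
  elim: n => [|n IH].
    rewrite big_geq// (partial_proj0 spP) F0.
    by under [X in Ex _ X]eq_fun do rewrite mulr0; rewrite Ex_cst.
  rewrite big_nat_recr//= IH; have <- := ExD (pT n) (pI n); apply: Ex_ae_eq.
  - exact: integrable_measurable (L1D (pT n) (pI n)).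
  - exact: integrable_measurable (pT n.+1).
  - by apply: filterS (partial_proj_succ spP n F1) => x <-; rewrite mulrDr.
under eq_fun do rewrite E.
apply/cvgrPdist_le => e e0.
have e1 : 0 < e / (c + 1) by rewrite divr_gt0// ltr_pwDr.
have [N hN] := partial_proj_cvg spP dense F1 e1.
exists N => // n /= Nn.
have FT := L1B F1 (partial_proj_L1 spP n F1).
rewrite -(ExB pF (pT n)).
apply: (le_trans (ler_norm_Ex (L1B pF (pT n)))).
apply: (@le_trans _ _ (Ex mu (fun x => c * `|F x - Trm n F x|))).
  apply: (Ex_le (L1_norm (L1B pF (pT n))) (L1Zl c (L1_norm FT))) => x.
  by rewrite -mulrBr normrM ler_wpM2r.
rewrite (ExZl c (L1_norm FT)); apply: (le_trans (ler_wpM2l c0 (hN n Nn))).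
by rewrite mulrA ler_pdivrMr ?ltr_pwDr// mulrC ler_wpM2l ?(ltW e0)// lerDl.
Qed.

Theorem stein_malliavin_bound (z : R) :
  `|Ex mu (fun x => (F x / s <= z)%R%:R) - Phi z| <=
  s^-1 ^+ 2 * Ex mu (fun x => `|Zlim x - s ^+ 2|) + s^-1 ^+ 2 * Ex mu (fun x => `|Zblim x|)
  + 7 / 2 * Num.sqrt S * S3 * s^-1 ^+ 4.
Proof.
pose phi x := stein_sol z (F x / s).
pose dphi x := stein_deriv z (F x / s).
pose I x : R := (z < F x / s)%R%:R.
have si : 0 < s^-1 by rewrite invr_gt0.
have mFs : measurable_fun setT (fun x => F x / s) by exact: measurable_funM.
have mphi : measurable_fun setT phi by apply: (measurableT_comp (measurable_stein_sol z)).
have mdphi : measurable_fun setT dphi by apply: (measurableT_comp (measurable_stein_deriv z)).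
have mI : measurable_fun setT I.
  rewrite (_ : I = \1_(`]z, +oo[) \o (fun x => F x / s)); last first.
    by apply/funext => x; rewrite /= indicE mem_setE in_itv/= andbT.
  by apply: measurableT_comp mFs; exact: measurable_indic.
have I1 x : `|I x| <= 1 by rewrite /I; case: (_ < _); rewrite ?normr1 ?normr0.
have phi_le x : `|phi x| <= 3 / 2 by rewrite ger0_norm ?stein_sol_ge0// stein_sol_ub.
have dphi_le x : `|dphi x| <= 1 by exact: stein_deriv_le1.
have ca := sum_Ex_increment mphi phi_le.
have cb := series_lim_Ex Zi ZB mdphi dphi_le.
have cc := series_lim_Ex Zbi ZbB mI I1.
have kap n : `|\sum_(0 <= i < n) Ex mu (fun x => phi x * Inc i F x) -
    s^-1 * \sum_(0 <= i < n) Ex mu (fun x => dphi x * Zterm i F x)| <=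
    s^-1 * \sum_(0 <= i < n) Ex mu (fun x => I x * Zbterm i F x) +
    s^-1 ^+ 2 * (s^-1 * norm4 mu F + 3 / 2) * S3.
  have k0 : 0 <= s^-1 ^+ 2 * (s^-1 * norm4 mu F + 3 / 2).
    apply: mulr_ge0; first exact: sqr_ge0.
    by apply: addr_ge0; [apply: mulr_ge0; [exact: ltW|exact: norm4_ge0]|rewrite divr_ge0].
  apply: (@le_trans _ _ (s^-1 * \sum_(0 <= i < n) Ex mu (fun x => I x * Zbterm i F x) +
    s^-1 ^+ 2 * (s^-1 * norm4 mu F + 3 / 2) * \sum_(0 <= i < n) norm4 mu (Dif i F) ^+ 3)).
    rewrite !mulr_sumr -sumrB -big_split/=.
    apply: (le_trans (ler_norm_sum _ _ _)); apply: ler_sum => i _.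
    exact: (stein_remainder spP F4 i z s0).
  by rewrite lerD2l ler_wpM2l.
(* The limit is taken while the indicator term is still signed, so that it becomes E[I Zbar] for the
   whole series. *)
have K : `|Ex mu (fun x => phi x * F x) - s^-1 * Ex mu (fun x => dphi x * Zlim x)| <=
    s^-1 * Ex mu (fun x => I x * Zblim x) + s^-1 ^+ 2 * (s^-1 * norm4 mu F + 3 / 2) * S3.
  have cL := cvg_norm (cvgB ca (cvgM (cvg_cst s^-1) cb)).
  have cR := cvgD (cvgM (cvg_cst s^-1) cc) (cvg_cst (s^-1 ^+ 2 * (s^-1 * norm4 mu F + 3 / 2) * S3)).
  by apply: (ler_cvg_to (cL _ _ _ _) (cR _ _ _ _)); exact: nearW.
have b1 : Ex mu (fun x => I x * Zblim x) <= Ex mu (fun x => `|Zblim x|).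
  apply: (Ex_le (L1_bounded_mul mI I1 Zblim_L1) (L1_norm Zblim_L1)) => x.
  apply: (le_trans (ler_norm _)); rewrite normrM -[leRHS]mul1r.
  by rewrite ler_wpM2r.
have dphiL := Lpow_bounded mu 1 mdphi dphi_le.
have id : L1 mu dphi by exact/Lpow1P.
have iZ := L1_bounded_mul mdphi dphi_le Zlim_L1.
have iF := L1_bounded_mul mphi phi_le F1.
have iZs := L1_norm (L1B Zlim_L1 (integrable_cst mu (s ^+ 2))).
have E0 : Ex mu (fun x => (F x / s <= z)%R%:R) - Phi z = Ex mu dphi - s^-1 * Ex mu (fun x => phi x * F x).
  rewrite -(ExZl s^-1 iF) -(ExB id (L1Zl s^-1 iF)).
  have iind : L1 mu (fun x => (F x / s <= z)%R%:R : R).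
    apply: (@integrable_le _ _ _ _ _ (fun=> 1)); last 2 first.
    - exact: integrable_cst.
    - by move=> x; case: (F x / s <= z); rewrite ?normr1 ?normr0.
    rewrite (_ : (fun x => _) = \1_(`]-oo, z]) \o (fun x => F x / s)); last first.
      by apply/funext => x; rewrite /= indicE mem_setE in_itv/=.
    by apply: measurableT_comp mFs; exact: measurable_indic.
  rewrite -(Ex_cst mu (Phi z)) -(ExB iind (integrable_cst mu _)); congr Ex.
  by apply/funext => x; rewrite -(stein_eq z (F x / s)) /phi /dphi; ring.
(* Split 1 as (s^2 - Z) / s^2 + Z / s^2: the first part is controlled by E|Z - s^2|, the second is
   compared with E[phi F] by [K]. *)
have E1 : Ex mu dphi = Ex mu (fun x => dphi x * (s ^+ 2 - Zlim x)) * s^-1 ^+ 2 +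
    s^-1 ^+ 2 * Ex mu (fun x => dphi x * Zlim x).
  have -> : Ex mu (fun x => dphi x * (s ^+ 2 - Zlim x)) =
      s ^+ 2 * Ex mu dphi - Ex mu (fun x => dphi x * Zlim x).
    rewrite -(ExZl _ id) -(ExB (L1Zl _ id) iZ); congr Ex; apply/funext => x; ring.
  by field; rewrite gt_eqF.
have iA : L1 mu (fun x => dphi x * (s ^+ 2 - Zlim x)).
  apply: (L1_bounded_mul mdphi dphi_le); exact: (L1B (integrable_cst mu _) Zlim_L1).
have b2 : `|Ex mu (fun x => dphi x * (s ^+ 2 - Zlim x))| <= Ex mu (fun x => `|Zlim x - s ^+ 2|).
  apply: (le_trans (ler_norm_Ex iA)); apply: (Ex_le (L1_norm iA) iZs) => x.
  by rewrite normrM (distrC (s ^+ 2)); apply: ler_piMl; [exact: normr_ge0|exact: dphi_le].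
rewrite E0 E1.
have S30 : 0 <= S3 by have := S3P 0; rewrite big_geq.
have r0 : 0 <= Num.sqrt S by exact: sqrtr_ge0.
have nF : norm4 mu F <= 2 * Num.sqrt S.
  have [_ le4] := F_L4.
  rewrite -(ler_pXn2r (n := 2))// ?nnegrE ?norm4_ge0 ?mulr_ge0//.
  by rewrite exprMn (sqr_sqrtr S_ge0); apply: (le_trans le4); rewrite expr2; lra.
have sS : s <= Num.sqrt S.
  by rewrite -(ger0_norm (ltW s0)) -sqrtr_sqr ler_sqrt// sigma_le.
(* The constant is 7/2 = 2 + 3/2: the norm of F is at most 2 sqrt S, and s is at most sqrt S. *)
have kS : s^-1 * (s^-1 ^+ 2 * (s^-1 * norm4 mu F + 3 / 2) * S3) <= 7 / 2 * Num.sqrt S * S3 * s^-1 ^+ 4.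
  have -> : s^-1 * (s^-1 ^+ 2 * (s^-1 * norm4 mu F + 3 / 2) * S3) =
     s^-1 ^+ 4 * S3 * (norm4 mu F + 3 / 2 * s) by field; rewrite gt_eqF.
  have -> : 7 / 2 * Num.sqrt S * S3 * s^-1 ^+ 4 = s^-1 ^+ 4 * S3 * (7 / 2 * Num.sqrt S) by ring.
  apply: ler_wpM2l; first by rewrite mulr_ge0// exprn_ge0// ltW.
  by move: nF sS; lra.
set A := Ex mu (fun x => dphi x * (s ^+ 2 - Zlim x)) in b2 *.
set B := Ex mu (fun x => dphi x * Zlim x) in K *.
set C := Ex mu (fun x => phi x * F x) in K *.
have -> : A * s^-1 ^+ 2 + s^-1 ^+ 2 * B - s^-1 * C = s^-1 ^+ 2 * A - s^-1 * (C - s^-1 * B).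
  by ring.
apply: (le_trans (ler_normB _ _)); rewrite -addrA; apply: lerD.
  by rewrite normrM ger0_norm ?sqr_ge0// ler_wpM2l ?sqr_ge0.
rewrite normrM ger0_norm ?(ltW si)//; apply: (le_trans (ler_wpM2l (ltW si) K)).
rewrite mulrDr; apply: lerD => //.
by rewrite mulrA -expr2 ler_wpM2l ?sqr_ge0.
Qed.

End berry_esseen.

(** * Product structure of the law of an independent sequence *)

Section sequence_space.
Context d' (S : measurableType d').

(** Generates the sigma-algebra used in [function_of], so the function representing F is measurable
    on [Om] as it stands. *)
Definition seqsys : set (set (nat -> S)) :=
  \bigcup_(k in setT) preimage_set_system setT (fun x : nat -> S => x k) measurable.

Local Notation Om := (g_sigma_algebraType seqsys).

Lemma measurable_coord k : measurable_fun setT (fun x : Om => x k).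
Proof.
move=> _ B mB; rewrite setTI; apply: sub_sigma_algebra.
by exists k => //; exists B => //; rewrite setTI.
Qed.

Lemma measurable_seq d (T : measurableType d) (f : T -> Om) :
  (forall k, measurable_fun setT (fun w => f w k)) -> measurable_fun setT f.
Proof.
move=> mf; apply: (@measurability _ _ T Om setT f seqsys erefl).
move=> _ [A [k _ [B mB <-]] <-].
have := mf k measurableT B mB; rewrite !setTI; exact.
Qed.

Definition splice (K : set nat) (x y : Om) : Om := fun k => if `[< K k >] then x k else y k.

Lemma measurable_splice K : measurable_fun setT (fun z : Om * Om => splice K z.1 z.2).
Proof.
apply: measurable_seq => k; rewrite /splice; case: asboolP => _.
  exact: (measurableT_comp (measurable_coord k) measurable_fst).
exact: (measurableT_comp (measurable_coord k) measurable_snd).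
Qed.

Definition cylinder (B : nat -> set S) : set Om := [set x | forall k, B k (x k)].

(** Coding a cylinder by a full sequence of sets that is eventually [setT] makes intersections and
    coordinate exchanges termwise. *)
Definition cylinders : set (set Om) := [set A | exists n B,
  [/\ forall k, measurable (B k), forall k, (n <= k)%N -> B k = setT & A = cylinder B]].

Lemma measurable_cylinder B : (forall k, measurable (B k)) -> measurable (cylinder B : set Om).
Proof.
move=> mB; rewrite (_ : cylinder B = \bigcap_k ((fun x : Om => x k) @^-1` B k)); last first.
  by apply/seteqP; split=> x h k; [move=> _|]; exact: h.
apply: bigcap_measurableType => k _.
by rewrite -[X in measurable X]setTI; exact: measurable_coord.
Qed.

Lemma cylinders_generate : @measurable _ Om = <<s cylinders >>.
Proof.
apply/seteqP; split.
  apply: smallest_sub; first exact: smallest_sigma_algebra.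
  move=> _ [k _ [B mB <-]]; apply: sub_sigma_algebra.
  exists k.+1, (fun j => if j == k then B else setT); split.
  - by move=> j; case: ifP.
  - by move=> j kj; rewrite gtn_eqF.
  - apply/seteqP; split=> x /=; first by move=> [_ Bx] j; case: eqP => // ->.
    by move=> /(_ k); rewrite eqxx.
apply: smallest_sub; first exact: sigma_algebra_measurable.
by move=> _ [n [B [mB _ ->]]]; exact: measurable_cylinder.
Qed.

Lemma cylinders_setI : setI_closed cylinders.
Proof.
move=> _ _ [n [B [mB nB ->]]] [m [C [mC mC' ->]]].
exists (maxn n m), (fun k => B k `&` C k); split.
- by move=> k; exact: measurableI.
- by move=> k; rewrite geq_max => /andP[nk mk]; rewrite nB// mC'// setIT.
- apply/seteqP; split=> x /=; first by move=> [h1 h2] k; split.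
  by move=> h; split=> k; have [] := h k.
Qed.

Definition cylinders2 : set (set (Om * Om)) := [set A | exists n B C,
  [/\ forall k, measurable (B k) /\ measurable (C k),
      forall k, (n <= k)%N -> B k = setT /\ C k = setT & A = cylinder B `*` cylinder C]].

Lemma cylinderT : cylinder (fun=> setT) = setT.
Proof. by apply/seteqP; split. Qed.

Lemma cylinders2_generate : @measurable _ (Om * Om)%type = <<s cylinders2 >>.
Proof.
apply/seteqP; split; last first.
  apply: smallest_sub; first exact: sigma_algebra_measurable.
  move=> _ [n [B [C [mBC _ ->]]]].
  by apply: measurableX; apply: measurable_cylinder => k; have [] := mBC k.
(* It suffices that both projections are measurable for the sigma-algebra generated by [cylinders2];
   they are, as one of the two cylinders may be [setT]. *)
pose T2 := g_sigma_algebraType cylinders2.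
apply: smallest_sub; first exact: smallest_sigma_algebra.
have m1 : measurable_fun setT (fst : T2 -> Om).
  apply: (measurability cylinders cylinders_generate).
  move=> _ [_ [n [B [mB nB ->]]] <-]; apply: sub_sigma_algebra.
  exists n, B, (fun=> setT); split=> [k|k nk|]; [by split|by rewrite nB|].
  by rewrite cylinderT; apply/seteqP; split=> -[x y]//= [].
have m2 : measurable_fun setT (snd : T2 -> Om).
  apply: (measurability cylinders cylinders_generate).
  move=> _ [_ [n [B [mB nB ->]]] <-]; apply: sub_sigma_algebra.
  exists n, (fun=> setT), B; split=> [k|k nk|]; [by split|by rewrite nB|].
  by rewrite cylinderT; apply/seteqP; split=> -[x y]//= [].
by move=> _ [|] [A mA <-]; [exact: m1|exact: m2].
Qed.

Lemma cylinders2_setI : setI_closed cylinders2.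
Proof.
move=> _ _ [n [B [C [mBC nBC ->]]]] [m [B' [C' [mBC' nBC' ->]]]].
exists (maxn n m), (fun k => B k `&` B' k), (fun k => C k `&` C' k); split.
- move=> k; have [mB mC] := mBC k; have [mB' mC'] := mBC' k.
  by split; exact: measurableI.
- move=> k; rewrite geq_max => /andP[nk mk].
  by have [-> ->] := nBC k nk; have [-> ->] := nBC' k mk; rewrite setIT.
- apply/seteqP; split=> -[x y] /=.
    by move=> [[h1 h2] [h3 h4]]; split=> k; split.
  move=> [h1 h2]; split; split=> k; by [case: (h1 k)|case: (h2 k)].
Qed.

End sequence_space.

Section pi_lambda.
Context d (T : measurableType d) (R : realType).

Lemma probability_pi_lambda d1 d2 (T1 : measurableType d1) (T2 : measurableType d2)
    (P1 : probability T1 R) (P2 : probability T2 R) (f1 : T1 -> T) (f2 : T2 -> T)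
    (G : set (set T)) : measurable_fun setT f1 -> measurable_fun setT f2 ->
  @measurable _ T = <<s G >> -> setI_closed G ->
  (forall A, G A -> P1 (f1 @^-1` A) = P2 (f2 @^-1` A)) ->
  forall A, measurable A -> P1 (f1 @^-1` A) = P2 (f2 @^-1` A).
Proof.
move=> m1 m2 GE GI h A; rewrite GE.
have pm1 B : measurable B -> measurable (f1 @^-1` B).
  by move=> mB; rewrite -[X in measurable X]setTI; exact: m1.
have pm2 B : measurable B -> measurable (f2 @^-1` B).
  by move=> mB; rewrite -[X in measurable X]setTI; exact: m2.
apply: (dynkin_induction (P := fun A => P1 (f1 @^-1` A) = P2 (f2 @^-1` A)) GE GI).
- by rewrite !preimage_setT (probability_setT P1) (probability_setT P2).
- exact: h.
- move=> B mB e; rewrite -!preimage_setC.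
  by rewrite (probability_setC P1 (pm1 _ mB)) (probability_setC P2 (pm2 _ mB)) e.
- move=> F mF tF e; rewrite !preimage_bigcup !measure_bigcup//.
  + by apply: eq_eseriesr => n _; exact: e.
  + by move=> n _; exact: pm2.
  + apply/trivIsetP => i j _ _ ij; rewrite -preimage_setI.
    by move/trivIsetP: tF => ->//; rewrite preimage_set0.
  + by move=> n _; exact: pm1.
  + apply/trivIsetP => i j _ _ ij; rewrite -preimage_setI.
    by move/trivIsetP: tF => ->//; rewrite preimage_set0.
Qed.

End pi_lambda.

Section independent_coordinates.
Context d' (S : measurableType d') (R : realType).
Local Notation Om := (g_sigma_algebraType (@seqsys d' S)).
Variable mu : probability Om R.
Hypothesis mu_cyl : exists p : nat -> set S -> \bar R,
  forall n (B : nat -> set S), (forall k, measurable (B k)) ->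
    (forall k, (n <= k)%N -> B k = setT) ->
    mu (cylinder B) = (\prod_(0 <= k < n) p k (B k))%E.

Lemma splice_preserves K : preserves (mu \x mu)%E (mu \x mu)%E
  (fun z => (@splice d' S K z.1 z.2, splice K z.2 z.1)).
Proof.
have mT : measurable_fun setT (fun z : Om * Om => (splice K z.1 z.2, splice K z.2 z.1)).
  apply: measurable_fun_pair; first exact: measurable_splice.
  exact: (measurableT_comp (@measurable_splice _ S K) (@measurable_swap _ _ Om Om)).
split=> // A mA.
have [p muE] := mu_cyl.
apply: (@probability_pi_lambda _ _ R _ _ _ _ (mu \x mu)%E (mu \x mu)%E _ id
  (@cylinders2 d' S)) => //.
- exact: cylinders2_generate.
- exact: cylinders2_setI.
move=> _ [n [B [C [mBC nBC ->]]]].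
(* The exchange maps a product of cylinders to another one, with B k and C k swapped for k outside
   K; this only permutes the factors of its measure. *)
pose B' k := if `[< K k >] then B k else C k.
pose C' k := if `[< K k >] then C k else B k.
have -> : (fun z : Om * Om => (splice K z.1 z.2, splice K z.2 z.1)) @^-1`
    (cylinder B `*` cylinder C) = cylinder B' `*` cylinder C'.
  apply/seteqP; split=> -[x y] /= [h1 h2]; split=> k; have := h1 k; have := h2 k;
    by rewrite /B' /C' /splice; case: asboolP.
have mB k : measurable (B k) by have [] := mBC k.
have mC k : measurable (C k) by have [] := mBC k.
have mB' k : measurable (B' k) by rewrite /B'; case: asboolP.
have mC' k : measurable (C' k) by rewrite /C'; case: asboolP.
have nB k : (n <= k)%N -> B k = setT by move=> /nBC[].
have nC k : (n <= k)%N -> C k = setT by move=> /nBC[].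
rewrite /= !product_measure1E; [|exact: measurable_cylinder..].
transitivity ((\prod_(0 <= k < n) p k (B' k)) * (\prod_(0 <= k < n) p k (C' k)))%E.
  by congr (_ * _)%E; apply: muE => // k nk; rewrite /B' /C'; case: asboolP => _; rewrite ?nB ?nC.
transitivity ((\prod_(0 <= k < n) p k (B k)) * (\prod_(0 <= k < n) p k (C k)))%E; last first.
  by congr (_ * _)%E; apply/esym/muE.
rewrite -!big_split/=; apply: eq_bigr => k _; rewrite /B' /C'.
by case: asboolP => // _; rewrite muleC.
Qed.

Lemma splice_resampling : resampling mu (@splice d' S).
Proof.
split.
- exact: splice_preserves.
- move=> K L x y z; apply/funext => k; rewrite /splice asbool_and.
  by case: asboolP => Kk; case: asboolP => Lk.
- move=> K L x y z LK; apply/funext => k; rewrite /splice.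
  by case: (asboolP (L k)) => // /LK Kk; rewrite asboolT.
- move=> K x y z; apply/funext => k; rewrite /splice.
  by case: asboolP.
- by move=> x y; apply/funext => k; rewrite /splice asboolF.
Qed.

Local Notation approx := (approx mu (@splice d' S)).

Lemma approx_closed h : L1 mu h ->
  (forall e : R, 0 < e -> exists g, [/\ L1 mu g, approx g & Ex mu (fun x => `|h x - g x|) <= e]) ->
  approx h.
Proof.
move=> hi hg e e0; have e2 : 0 < e / 2 by rewrite divr_gt0.
have [g [gi ga ge]] := hg _ e2; have [n [k [ki kd ke]]] := ga _ e2.
exists n, k; split=> //.
have i1 := L1_norm (L1B hi gi); have i2 := L1_norm (L1B gi ki).
apply: (@le_trans _ _ (Ex mu (fun x => `|h x - g x| + `|g x - k x|))).
  apply: (Ex_le (L1_norm (L1B hi ki)) (L1D i1 i2)) => x.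
  have -> : h x - k x = (h x - g x) + (g x - k x) by ring.
  exact: ler_normD.
by rewrite (ExD i1 i2) [leRHS]splitr lerD.
Qed.

Lemma approxD f g : L1 mu f -> L1 mu g -> approx f -> approx g -> approx (fun x => f x + g x).
Proof.
move=> fi gi fa ga e e0; have e2 : 0 < e / 2 by rewrite divr_gt0.
have [n [k [ki kd ke]]] := fa _ e2; have [m [l [li ld le]]] := ga _ e2.
have sub a b : (a <= b)%N -> lts a `<=` lts b.
  by move=> ab j; rewrite /lts/= => /leq_trans; apply.
exists (maxn n m), (fun x => k x + l x); split; first exact: L1D.
  have kd' := dep_sub splice_resampling (sub _ _ (leq_maxl n m)) kd.
  have ld' := dep_sub splice_resampling (sub _ _ (leq_maxr n m)) ld.
  exact: (fun x y => f_equal2 +%R (kd' x y) (ld' x y)).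
have i1 := L1_norm (L1B fi ki); have i2 := L1_norm (L1B gi li).
apply: (@le_trans _ _ (Ex mu (fun x => `|f x - k x| + `|g x - l x|))).
  apply: (Ex_le (L1_norm (L1B (L1D fi gi) (L1D ki li))) (L1D i1 i2)) => x.
  have -> : f x + g x - (k x + l x) = (f x - k x) + (g x - l x) by ring.
  exact: ler_normD.
by rewrite (ExD i1 i2) [leRHS]splitr lerD.
Qed.

Lemma approx_cst c : approx (fun=> c).
Proof.
move=> e e0; exists 0%N, (fun=> c); split => //; first exact: integrable_cst.
by under [X in Ex _ X]eq_fun do rewrite subrr normr0; rewrite Ex_cst ltW.
Qed.

Lemma approxZl c f : L1 mu f -> approx f -> approx (fun x => c * f x).
Proof.
move=> fi fa e e0; have c1 : 0 < `|c| + 1 by rewrite ltr_pwDr.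
have [n [k [ki kd ke]]] := fa (e / (`|c| + 1)) (divr_gt0 e0 c1).
exists n, (fun x => c * k x); split; first exact: L1Zl.
  exact: (fun x y => f_equal (fun t => c * t) (kd x y)).
under [X in Ex _ X]eq_fun do rewrite -mulrBr normrM.
rewrite (ExZl _ (L1_norm (L1B fi ki))); apply: (le_trans (ler_wpM2l (normr_ge0 c) ke)).
by rewrite mulrA ler_pdivrMr// mulrC ler_wpM2l ?(ltW e0)// lerDl.
Qed.

Lemma approx_sum (I : Type) (s : seq I) (f : I -> Om -> R) :
  (forall i, L1 mu (f i)) -> (forall i, approx (f i)) ->
  approx (fun x => \sum_(i <- s) f i x).
Proof.
move=> fi fa; elim: s => [|i s IH].
  by under [X in approx X]eq_fun do rewrite big_nil; exact: approx_cst.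
under [X in approx X]eq_fun do rewrite big_cons.
by apply: approxD => //; exact: L1_sum.
Qed.

Let indic_L1 (A : set Om) : measurable A -> L1 mu (\1_A : Om -> R).
Proof. by move=> mA; apply: integrable_indic => //; rewrite ltey_eq fin_num_measure. Qed.

Let Ex_indic (A : set Om) : measurable A -> ((Ex mu (\1_A))%:E = mu A)%E.
Proof.
move=> mA; rewrite ExE; last exact: indic_L1.
by rewrite integral_indic// setIT.
Qed.

(** Cylinders depend on finitely many coordinates, and the property passes to complements and, by
    approximating with finite subunions, to disjoint countable unions, so Dynkin's theorem
    applies. *)
Lemma approx_indic (A : set Om) : measurable A -> approx (\1_A : Om -> R).
Proof.
rewrite cylinders_generate.
apply: (dynkin_induction (P := fun A => approx (\1_A : Om -> R)) (@cylinders_generate d' S) (@cylinders_setI d' S)).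
- rewrite (_ : \1_setT = fun=> 1); first exact: approx_cst.
  by apply/funext => x; rewrite indicE in_setT.
- move=> _ [n [B [mB nB ->]]] e e0; exists n, (\1_(cylinder B)); split.
  + by apply: indic_L1; exact: measurable_cylinder.
  + move=> x y; rewrite !indicE; congr ((_ : bool)%:R).
    apply/idP/idP; rewrite !inE => h k; have := h k; rewrite /splice;
      by case: asboolP => // /negP; rewrite -leqNgt => /nB ->.
  + by under [X in Ex _ X]eq_fun do rewrite subrr normr0; rewrite Ex_cst ltW.
- move=> B mB Ba.
  have -> : (\1_(~` B) : Om -> R) = fun x => 1 + -1 * \1_B x.
    apply/funext => x; rewrite !indicE in_setC; case: (x \in B) => /=.
      by rewrite mulr1 subrr.
    by rewrite mulr0 addr0.
  apply: approxD; [exact: integrable_cst|exact/L1Zl/indic_L1|exact: approx_cst|].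
  by apply: approxZl => //; exact: indic_L1.
- move=> F mF tF Fa.
  have mU : measurable (\bigcup_k F k) by exact: bigcupT_measurable.
  apply: approx_closed; first exact: indic_L1.
  move=> e e0.
  have cv : (fun n => \sum_(0 <= i < n) mu (F i))%E @ \oo --> (fine (mu (\bigcup_k F k)))%:E.
    rewrite fineK; last exact: fin_num_measure.
    exact: (@measure_semi_sigma_additive _ _ _ mu F mF tF mU).
  have /fine_cvgP[_ /cvgrPdist_le/(_ _ e0)[N _ hN]] := cv.
  have iF i : L1 mu (\1_(F i) : Om -> R) by exact: indic_L1.
  exists (fun x => \sum_(0 <= i < N) \1_(F i) x); split.
  + exact: L1_sum.
  + exact: approx_sum.
  have sum_le x : \sum_(0 <= i < N) \1_(F i) x <= (\1_(\bigcup_k F k) x : R).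
    have [[j _ Fj]|nF] := pselect ((\bigcup_k F k) x); last first.
      rewrite [leRHS]indicE memNset// big1// => i _.
      by rewrite indicE memNset// => Fi; apply: nF; exists i.
    rewrite [leRHS]indicE mem_set; last by exists j.
    have E i : \1_(F i) x = (i == j)%:R :> R.
      rewrite indicE; congr ((_ : bool)%:R); apply/idP/eqP => [|->]; rewrite inE// => Fi.
      apply: contrapT => ij; have /trivIsetP/(_ i j I I (introN eqP ij)) := tF.
      by move=> /seteqP[h _]; exact: (h x (conj Fi Fj)).
    under eq_bigr do rewrite E.
    have -> : \sum_(0 <= i < N) (i == j)%:R = (j < N)%N%:R :> R; last by case: (_ < _)%N.
    elim: N {hN} => [|n IH]; first by rewrite big_geq.
    rewrite big_nat_recr//= IH [in RHS]ltnS.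
    by case: (ltngtP j n) => _; rewrite ?mulr0n ?add0r ?addr0.
  have sumi := @L1_sum _ _ _ mu nat (index_iota 0 N) (fun i => \1_(F i)) iF.
  have -> : Ex mu (fun x => `|\1_(\bigcup_k F k) x - \sum_(0 <= i < N) \1_(F i) x|) =
      fine (mu (\bigcup_k F k)) - fine (\sum_(0 <= i < N) mu (F i))%E.
    transitivity (Ex mu (fun x => \1_(\bigcup_k F k) x - \sum_(0 <= i < N) \1_(F i) x)).
      by congr Ex; apply/funext => x; rewrite ger0_norm// subr_ge0.
    rewrite (ExB (indic_L1 mU) sumi) -Ex_indic//; congr (_ - _).
    rewrite (Ex_sum _ iF) -[LHS]/(fine _%:E) -sumEFin; congr fine.
    by apply: eq_bigr => i _; exact: Ex_indic.
  exact: (le_trans (ler_norm _) (hN N (leqnn N))).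
Qed.

Import HBSimple.

Lemma approx_L1 h : L1 mu h -> approx h.
Proof.
move=> hi; apply: approx_closed => // e e0.
have [g [gi _ gcv]] := approximation_sfun_integrable measurableT hi.
have /fine_cvgP[_ /cvgrPdist_le/(_ _ e0)[N _ /(_ N (leqnn N)) /= hN]] := gcv.
exists (g N); split; first exact: gi.
  have -> : (g N : Om -> R) = fun x => \sum_(y <- fset_set (range (g N))) y * \1_(g N @^-1` [set y]) x.
    by apply/funext => x; rewrite {1}(fimfunE (g N) x) fsbig_finite//; exact: fimfunP.
  have mP y : measurable (g N @^-1` [set y]) by exact: measurable_sfunP.
  apply: approx_sum => y; first exact/L1Zl/indic_L1.
  by apply: approxZl; [exact: indic_L1|exact: approx_indic].
apply: le_trans hN; rewrite sub0r normrN; apply: le_trans (ler_norm _).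
by rewrite /Ex /Rintegral.
Qed.

End independent_coordinates.

(** * Transfer from the sequence space *)

Section condexp_uniqueness.
Context d (T : measurableType d) (R : realType) (P : probability T R).

Lemma Ex_eq0 (f : T -> R) : L1 P f -> (forall x, 0 <= f x) -> Ex P f = 0 ->
  {ae P, forall x, f x = 0}.
Proof.
move=> fi f0 Ef.
have : ae_eq P setT (EFin \o f) (cst 0%E).
  apply/(ae_eq_integral_abs P measurableT (measurable_int _ fi)).
  under eq_integral do rewrite gee0_abs ?lee_fin//.
  by rewrite -ExE// Ef.
by apply: filterS => x /(_ I) [].
Qed.

Lemma integral_Ex_indic (A : set T) (V : T -> R) : measurable A -> L1 P V ->
  (\int[P]_(w in A) (V w)%:E = (Ex P (fun w => \1_A w * V w))%:E)%E.
Proof.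
move=> mA Vi; rewrite ExE; last first.
  apply: (L1_bounded_mul (B := 1)) Vi; first exact: measurable_indic.
  by move=> x; rewrite indicE; case: (_ \in _); rewrite ?normr1 ?normr0.
rewrite integral_mkcond; apply: eq_integral => w _; rewrite /patch indicE.
by case: (w \in A); rewrite ?mul1r ?mul0r.
Qed.

Variable G : set (set T).
Hypothesis GT : G `<=` measurable.
Local Notation T' := (g_sigma_algebraType G).

Lemma sigma_sub : <<s G >> `<=` measurable.
Proof. by apply: smallest_sub => //; exact: sigma_algebra_measurable. Qed.

Lemma measurable_wrt_fun (V : T -> R) : measurable_wrt <<s G >> V ->
  measurable_fun setT (V : T' -> R).
Proof. by move=> mV _ B mB; rewrite setTI; exact: mV. Qed.

Lemma measurable_wrt_measurable (V : T -> R) : measurable_wrt <<s G >> V ->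
  measurable_fun setT V.
Proof. by move=> mV _ B mB; rewrite setTI; apply: sigma_sub; exact: mV. Qed.

Let le_ae (V1 V2 : T -> R) : measurable_wrt <<s G >> V1 -> measurable_wrt <<s G >> V2 ->
  L1 P V1 -> L1 P V2 ->
  (forall A, <<s G >> A -> (\int[P]_(w in A) (V1 w)%:E = \int[P]_(w in A) (V2 w)%:E)%E) ->
  {ae P, forall w, V2 w <= V1 w}.
Proof.
move=> mV1 mV2 i1 i2 e.
pose A : set T := [set w | (V1 w < V2 w)].
have GA : <<s G >> A.
  have := measurable_fun_ltr (measurable_wrt_fun mV1) (measurable_wrt_fun mV2).
  move=> /(_ measurableT [set true]); rewrite setTI.
  by apply.
have mA := sigma_sub GA.
have mI : measurable_fun setT (\1_A : T -> R) by exact: measurable_indic.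
have I1 x : `|\1_A x : R| <= 1 by rewrite indicE; case: (_ \in _); rewrite ?normr1 ?normr0.
have j1 := L1_bounded_mul mI I1 i1; have j2 := L1_bounded_mul mI I1 i2.
have : Ex P (fun w => \1_A w * V2 w - \1_A w * V1 w) = 0.
  have := e A GA; rewrite !integral_Ex_indic// => -[e1].
  by rewrite (ExB j2 j1) e1 subrr.
move/(Ex_eq0 (L1B j2 j1)); move=> /(_ _) h.
have {}/h : forall x, 0 <= \1_A x * V2 x - \1_A x * V1 x.
  move=> x; rewrite indicE; have [|] := boolP (x \in A).
    by rewrite inE /A/= => /ltW; rewrite !mul1r subr_ge0.
  by rewrite !mul0r subrr.
apply: filterS => x; rewrite indicE; have [xA|] := boolP (x \in A).
  by move: xA; rewrite inE /A/= !mul1r => /lt_eqF + /eqP; rewrite subr_eq0 eq_sym => ->.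
by rewrite notin_setE /A/= => /negP; rewrite -leNgt.
Qed.

Lemma condexp_ae_unique (Y V1 V2 : T -> R) :
  is_condexp P <<s G >> Y V1 -> is_condexp P <<s G >> Y V2 -> {ae P, forall w, V1 w = V2 w}.
Proof.
move=> [m1 i1 e1] [m2 i2 e2].
have h12 A : <<s G >> A -> (\int[P]_(w in A) (V1 w)%:E = \int[P]_(w in A) (V2 w)%:E)%E.
  by move=> GA; rewrite e1// e2.
have h21 A : <<s G >> A -> (\int[P]_(w in A) (V2 w)%:E = \int[P]_(w in A) (V1 w)%:E)%E.
  by move=> /h12.
apply: filterS2 (le_ae m1 m2 i1 i2 h12) (le_ae m2 m1 i2 i1 h21) => w a b.
by apply/eqP; rewrite eq_le b a.
Qed.

(** The choice made by [xget] is opaque: one known version guarantees that the chosen function is a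
    version too, and uniqueness ties it a.e. to the known one. *)
Lemma condexp_version (Y V : T -> R) : is_condexp P <<s G >> Y V ->
  measurable_fun setT (condexp P <<s G >> Y) /\ {ae P, forall w, condexp P <<s G >> Y w = V w}.
Proof.
move=> h; have hc : is_condexp P <<s G >> Y (condexp P <<s G >> Y).
  have := @xgetPex _ (fun=> 0) [set V | is_condexp P <<s G >> Y V]; apply.
  by exists V.
split; last exact: condexp_ae_unique hc h.
by case: hc => mc _ _; exact: measurable_wrt_measurable.
Qed.

End condexp_uniqueness.

Section joint_law.
Context d (T : measurableType d) (R : realType) (P : probability T R).
Context d' (S : measurableType d') (X : nat -> {RV P >-> S}).
Hypothesis X_indep : independent_seq P (fun k => X k : T -> S).

Let Y := fun k => X k : T -> S.
Local Notation Om := (g_sigma_algebraType (@seqsys d' S)).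

Definition joint (w : T) : Om := fun k => X k w.

Lemma measurable_joint : measurable_fun setT joint.
Proof. by apply: measurable_seq => k; exact: measurable_funP. Qed.

HB.instance Definition _ := isMeasurableFun.Build _ _ T Om joint measurable_joint.

Definition joint_law : probability Om R := distribution P joint.

Local Notation mu := joint_law.

Lemma joint_preserves : preserves P mu joint.
Proof. by split; [exact: measurable_joint|]. Qed.

Lemma joint_law_cylinder : exists p : nat -> set S -> \bar R,
  forall n (B : nat -> set S), (forall k, measurable (B k)) ->
    (forall k, (n <= k)%N -> B k = setT) ->
    mu (cylinder B) = (\prod_(0 <= k < n) p k (B k))%E.
Proof.
exists (fun k B => P (X k @^-1` B)) => n B mB nB.
pose J : {fset nat} := [fset k in iota 0 n]%fset.
transitivity (\prod_(j <- J) P (X j @^-1` B j))%E; last first.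
  apply: perm_big; apply: uniq_perm; [exact: fset_uniq|exact: iota_uniq|].
  by move=> k; rewrite /J inE /= /index_iota subn0.
rewrite -(X_indep J mB); congr (P _).
apply/seteqP; split=> w /= h; first by move=> k _; exact: h.
move=> k; have [kn|nk] := ltnP k n; last by rewrite nB.
by apply: h; rewrite /J /= inE/= mem_iota.
Qed.

Lemma joint_resampling : resampling mu (@splice d' S).
Proof. by apply: splice_resampling; exact: joint_law_cylinder. Qed.

Lemma joint_dense (h : Om -> R) : L1 mu h -> approx mu (@splice d' S) h.
Proof. by apply: approx_L1; exact: joint_law_cylinder. Qed.

Let famsys (K : set nat) := \bigcup_(k in K) preimage_set_system setT (Y k) measurable.

Let famsys_sub K : famsys K `<=` measurable.
Proof.
by move=> _ [k _ [B mB <-]]; exact: (measurable_funP (X k)).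
Qed.

(** Supplies a test factor that ignores the coordinates outside K, as [cexp_cond] demands, for every
    event of the sigma-algebra. *)
Let dependent_preimage K A : sigma_family Y K A -> exists A' : set Om,
  [/\ measurable A', forall x y, A' (splice K x y) = A' x & A = joint @^-1` A'].
Proof.
move: A; apply: smallest_sub.
  split.
  - by exists set0; split.
  - move=> A [A' [mA' dA' ->]]; exists (~` A'); split.
    + exact: measurableC.
    + by move=> x y; rewrite /setC/= dA'.
    + by rewrite setTD.
  - move=> F hF; have /choice[F' hF'] := hF.
    exists (\bigcup_k F' k); split.
    + by apply: bigcupT_measurable => k; have [] := hF' k.
    + move=> x y; apply/propext; split=> -[k _ h]; exists k => //; have [_ dk _] := hF' k.
        by rewrite -(dk x y).
      by rewrite dk.
    + by rewrite preimage_bigcup; apply: eq_bigcup => // k _; have [] := hF' k.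
move=> _ [k Kk [B mB <-]]; exists ((fun x : Om => x k) @^-1` B); split.
- by rewrite -[X in measurable X]setTI; exact: measurable_coord.
- by move=> x y; rewrite /preimage/= /splice asboolT.
- by rewrite setTI.
Qed.

(** Agreement of [Z] with h only a.e. allows iteration: conditional expectations that occur inside
    others are themselves known only a.e. *)
Lemma is_condexp_cexp K (h : Om -> R) (Z : T -> R) : L1 mu h -> measurable_fun setT Z ->
  {ae P, forall w, Z w = h (joint w)} ->
  is_condexp P (sigma_family Y K) Z (fun w => cexp mu (@splice d' S) K h (joint w)).
Proof.
move=> hi mZ Zh; have spP := joint_resampling.
have ci := cexp_L1 spP K hi.
split.
- move=> B mB.
  (* Freezing the coordinates outside K at a default point gives a map measurable for sigma(X_k, k
     in K). By [cexp_dep] composing with it does not change [cexp], which is therefore measurable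
     for that sigma-algebra. *)
  pose r (w : g_sigma_algebraType (famsys K)) : Om := splice K (joint w) point.
  have mr : measurable_fun setT r.
    apply: measurable_seq => k; rewrite /r /splice; case: asboolP => Kk //.
    move=> _ C mC; rewrite setTI; apply: sub_sigma_algebra.
    by exists k => //; exists C => //; rewrite setTI.
  have -> : (fun w => cexp mu (@splice d' S) K h (joint w)) @^-1` B =
      r @^-1` (cexp mu (@splice d' S) K h @^-1` B).
    by apply/seteqP; split=> w /=; rewrite /r (cexp_dep spP).
  have mcB : measurable (cexp mu (@splice d' S) K h @^-1` B).
    by rewrite -[X in measurable X]setTI; exact: (cexp_meas spP K hi).
  by have := mr measurableT _ mcB; rewrite setTI.
- exact: (preserves_L1 joint_preserves).
- move=> A GA; have mA : measurable A by exact: (sigma_sub (@famsys_sub K)).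
  have hji := preserves_L1 joint_preserves hi.
  have cji := preserves_L1 joint_preserves ci.
  have Zi : L1 P Z.
    apply: (ae_integrable (integrable_measurable hji) mZ _ hji).
    by apply: filterS Zh => w ->.
  have [A' [mA' dA' AE]] := dependent_preimage GA.
  have mI : measurable_fun setT (\1_A' : Om -> R) by exact: measurable_indic.
  have I1 x : `|\1_A' x : R| <= 1 by rewrite indicE; case: (_ \in _); rewrite ?normr1 ?normr0.
  have dI : dep (@splice d' S) K (\1_A' : Om -> R).
    move=> x y; rewrite !indicE; congr ((_ : bool)%:R).
    by apply/idP/idP; rewrite !inE dA'.
  have [j1 e1] := cexp_cond spP mI dI hi (L1_bounded_mul mI I1 hi).
  rewrite !integral_Ex_indic//; congr EFin.
  have IE w : \1_A w = \1_A' (joint w) :> R by rewrite AE !indicE; congr ((_ : bool)%:R); apply/idP/idP; rewrite !inE.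
  transitivity (Ex P (fun w => \1_A' (joint w) * cexp mu (@splice d' S) K h (joint w))).
    by congr Ex; apply/funext => w; rewrite IE.
  rewrite (preserves_Ex joint_preserves j1) e1.
  have j2 := L1_bounded_mul mI I1 hi.
  rewrite -(preserves_Ex joint_preserves j2); apply: Ex_ae_eq.
  + exact: integrable_measurable (preserves_L1 joint_preserves j2).
  + by apply: measurable_funM => //; exact: measurable_indic.
  + by apply: filterS Zh => w ->; rewrite IE.
Qed.

End joint_law.

Section versions.
Context d (T : measurableType d) (R : realType) (P : probability T R).
Context d' (S : measurableType d') (X : nat -> {RV P >-> S}).
Hypothesis X_indep : independent_seq P (fun k => X k : T -> S).

Let Y := fun k => X k : T -> S.
Local Notation Om := (g_sigma_algebraType (@seqsys d' S)).
Local Notation mu := (joint_law X).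
Local Notation sp := (@splice d' S).
Let spP : resampling mu sp := joint_resampling X_indep.

(** A relation stable under all the operators of the statement; with it, every moment is computed on
    the sequence space. *)
Definition version (Z : T -> R) (h : Om -> R) :=
  [/\ measurable_fun setT Z, L1 mu h & {ae P, forall w, Z w = h (joint X w)}].

Lemma version_condexp K Z h : version Z h ->
  version (condexp P (sigma_family Y K) Z) (cexp mu sp K h).
Proof.
move=> [mZ hi Zh].
have sub : \bigcup_(k in K) preimage_set_system setT (Y k) measurable `<=` measurable.
  by move=> _ [k _ [B mB <-]]; exact: (measurable_funP (X k)).
have [mc ac] := condexp_version sub (is_condexp_cexp X_indep K hi mZ Zh).
by split=> //; exact: cexp_L1.
Qed.

Lemma version_Di i Z h : version Z h -> version (Di P Y i Z) (diff_op mu sp i h).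
Proof.
move=> Zh; have [mE Ei EE] := version_condexp (nes i) Zh; have [mZ hi Zhe] := Zh.
split; [exact: measurable_funB|exact: diff_op_L1|].
by apply: filterS2 EE Zhe => w e1 e2; rewrite /Di /diff_op /Defs.Ei e2; congr (_ - _).
Qed.

Lemma version_norm Z h : version Z h -> version (fun w => `|Z w|) (fun x => `|h x|).
Proof.
move=> [mZ hi Zh]; split; [exact: measurableT_comp|exact: L1_norm|].
by apply: filterS Zh => w ->.
Qed.

Lemma version_integral (phi : R -> \bar R) Z h : version Z h -> measurable_fun setT phi ->
  (forall r, (0 <= phi r)%E) -> (\int[P]_w phi (Z w) = \int[mu]_x phi (h x))%E.
Proof.
move=> [mZ hi Zh] mphi phi0.
have mh := integrable_measurable hi.
rewrite -(preserves_ge0_integral (joint_preserves X) (f := fun x => phi (h x)))//; last first.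
  exact: (measurableT_comp mphi).
apply: ae_eq_integral => //.
- exact: (measurableT_comp mphi).
- apply: (measurableT_comp (measurableT_comp mphi mh)); exact: measurable_joint.
- by apply: filterS Zh => w -> _.
Qed.

Lemma version_Ex Z h : version Z h -> ('E_P[Z] = (Ex mu h)%:E)%E.
Proof.
move=> [mZ hi Zh]; rewrite unlock -(preserves_Ex (joint_preserves X) hi).
have ji := preserves_L1 (joint_preserves X) hi.
rewrite ExE//; apply: ae_eq_integral => //.
- exact/measurable_EFinP.
- exact: measurable_int ji.
- by apply: filterS Zh => w -> _.
Qed.

(** An identity in the extended reals: both sides integrate a nonnegative function, so it covers h
    outside L2. *)
Lemma version_variance Z h : version Z h ->
  ('V_P[Z] = \int[mu]_x ((h x - Ex mu h) ^+ 2)%:E)%E.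
Proof.
move=> Zh; rewrite /variance unlock (version_Ex Zh)/= unlock.
rewrite -(version_integral (phi := fun r => ((r - Ex mu h) ^+ 2)%:E) Zh).
- by apply: eq_integral => w _; rewrite expr2.
- apply/measurable_EFinP; apply: measurable_funX; exact: measurable_funB.
- by move=> r; rewrite lee_fin sqr_ge0.
Qed.

Lemma version_lyapunov Z h (i : nat) : version Z h ->
  ('E_P[fun w => (`|Di P Y i Z w| `^ 2)%R] = \int[mu]_x ((diff_op mu sp i h x) ^+ 2)%:E)%E.
Proof.
move=> /(version_Di i) Dh; rewrite unlock.
rewrite -(version_integral (phi := fun r => (r ^+ 2)%:E) Dh).
- apply: eq_integral => w _; rewrite powR_mulrn// real_normK//.
  exact: num_real.
- by apply/measurable_EFinP; exact: measurable_funX.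
- by move=> r; rewrite lee_fin sqr_ge0.
Qed.

Lemma version_moment4 Z h (i : nat) : version Z h ->
  (moment4 P Y i Z = \int[mu]_x ((diff_op mu sp i h x) ^+ 4)%:E)%E.
Proof.
move=> /(version_Di i) Dh; rewrite /moment4 unlock.
rewrite -(version_integral (phi := fun r => (r ^+ 4)%:E) Dh).
- apply: eq_integral => w _; rewrite -normrX ger0_norm//; exact: exprn_even_ge0.
- by apply/measurable_EFinP; exact: measurable_funX.
- by move=> r; rewrite lee_fin exprn_even_ge0.
Qed.

Lemma lyapunov_ge0 r Z : (0 <= lyapunov P Y r Z)%E.
Proof.
apply: nneseries_ge0 => i _ _; apply: expectation_ge0 => w; exact: powR_ge0.
Qed.

Lemma moment4_ge0 i Z : (0 <= moment4 P Y i Z)%E.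
Proof. by apply: expectation_ge0 => w; exact: exprn_ge0. Qed.

Lemma integrable_fin_pow n (h : Om -> R) : measurable_fun setT h -> (forall x, 0 <= h x ^+ n) ->
  (\int[mu]_x (h x ^+ n)%:E < +oo)%E -> Lpow mu n h.
Proof.
move=> mh h0 hoo; split=> //; apply/integrableP; split.
  exact/measurable_EFinP/measurable_funX.
by under eq_integral do rewrite gee0_abs ?lee_fin//.
Qed.

(** When the right-hand side is finite, all D_i h are in L2 and [poincare] applies to h minus its
    mean, which has a.e. the same differences; E M_i^2 <= E (D_i h)^2 does the rest. *)
Lemma variance_le_lyapunov Z h : version Z h -> ('V_P[Z] <= lyapunov P Y 2 Z)%E.
Proof.
move=> Zh; have [mZ hi _] := Zh.
have [->|Loo] := eqVneq (lyapunov P Y 2 Z) +oo%E; first exact: leey.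
have Lfin : lyapunov P Y 2 Z \is a fin_num by rewrite ge0_fin_numE ?lyapunov_ge0// ltey.
set L := lyapunov P Y 2 Z in Loo Lfin *.
have term i : ('E_P[fun w => (`|Di P Y i Z w| `^ 2)%R] <= L)%E.
  apply: (@le_trans _ _ (\sum_(0 <= j < i.+1) 'E_P[fun w => (`|Di P Y j Z w| `^ 2)%R])%E).
    rewrite big_nat_recr//= leeDr//; apply: sume_ge0 => j _.
    by apply: expectation_ge0 => w; exact: powR_ge0.
  apply: nneseries_lim_ge => j _ _; apply: expectation_ge0 => w; exact: powR_ge0.
pose c := Ex mu h; pose g x := h x - c.
have gi : L1 mu g by apply: L1B => //; exact: integrable_cst.
have Dg i : {ae mu, forall x, diff_op mu sp i h x = diff_op mu sp i g x}.
  have := cexpB spP (nes i) hi (integrable_cst mu c); apply: filterS => x e1.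
  by rewrite /diff_op e1 /cexp Ex_cst /g; ring.
have D2 i : Lpow mu 2 (diff_op mu sp i h).
  apply: integrable_fin_pow => [|x|]; [exact/integrable_measurable/diff_op_L1|exact: sqr_ge0|].
  by rewrite -(version_lyapunov i Zh) (le_lt_trans (term i))// ltey.
have D2g i : Lpow mu 2 (diff_op mu sp i g).
  by apply: ae_Lpow (Dg i) (D2 i); exact/integrable_measurable/diff_op_L1.
have [|g2 ge] := @poincare _ _ _ _ _ spP (joint_dense X_indep) g (fine L) gi D2g.
  move=> n; rewrite -lee_fin fineK// -sumEFin.
  apply: (@le_trans _ _ (\sum_(0 <= j < n) 'E_P[fun w => (`|Di P Y j Z w| `^ 2)%R])%E); last first.
    apply: nneseries_lim_ge => j _ _; apply: expectation_ge0 => w; exact: powR_ge0.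
  apply: lee_sum => j _; rewrite (version_lyapunov j Zh).
  have [_ Di2] := D2 j; rewrite -ExE// lee_fin.
  have [_ le2] := increment_L2 spP (D2g j); apply: (le_trans le2).
  rewrite le_eqVlt; apply/orP; left; apply/eqP; apply: Ex_ae_eq.
  - by apply: measurable_funX; have [] := D2g j.
  - by apply: measurable_funX; have [] := D2 j.
  - by apply: filterS (Dg j) => x ->.
have g0 : Ex mu g = 0 by rewrite (ExB hi (integrable_cst mu c)) Ex_cst subrr.
rewrite (version_variance Zh) -(fineK Lfin).
have [_ g2i] := g2; rewrite -(ExE g2i) lee_fin.
by move: ge; rewrite g0 expr0n/= add0r.
Qed.

Lemma Ex_centered_le Z h : version Z h ->
  ((Ex mu (fun x => `|h x - Ex mu h|))%:E <= sqrte 'V_P[Z])%E.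
Proof.
move=> Zh; have [mZ hi _] := Zh.
have gi : L1 mu (fun x => h x - Ex mu h) by apply: L1B => //; exact: integrable_cst.
rewrite (version_variance Zh).
have [->|Voo] := eqVneq (\int[mu]_x ((h x - Ex mu h) ^+ 2)%:E)%E +oo%E; first by rewrite leey.
have h2 : Lpow mu 2 (fun x => h x - Ex mu h).
  apply: integrable_fin_pow; [exact: integrable_measurable gi|by move=> x; exact: sqr_ge0|].
  by rewrite ltey.
have [_ h2i] := h2; rewrite -(ExE h2i) /= lee_fin.
have E0 : 0 <= Ex mu (fun x => `|h x - Ex mu h|) by apply: Ex_ge0.
rewrite -(ger0_norm E0) -sqrtr_sqr ler_sqrt; last by apply: Ex_ge0 => x; exact: sqr_ge0.
apply: (le_trans (Ex_sqr_le (Lpow_norm h2))).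
rewrite le_eqVlt; apply/orP; left; apply/eqP; congr Ex; apply/funext => x.
by rewrite real_normK// num_real.
Qed.

Section series.
Variables (F : T -> R) (f : Om -> R).
Hypothesis Ff : version F f.
Hypothesis f2 : Lpow mu 2 f.

Let Dv i : version (Di P Y i F) (diff_op mu sp i f). Proof. exact: version_Di. Qed.

Let Iv i : version (Efilt P Y i (Di P Y i F)) (increment mu sp i f).
Proof. exact: version_condexp (Dv i). Qed.

Lemma Zterm_version i :
  {ae P, forall w, Di P Y i F w * Efilt P Y i (Di P Y i F) w = Zterm mu sp i f (joint X w)}.
Proof. by have [_ _ e1] := Dv i; have [_ _ e2] := Iv i; apply: filterS2 e1 e2 => w -> ->. Qed.

Lemma Zbterm_version i : version (Zbar_term P Y F i) (Zbterm mu sp i f).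
Proof.
apply: version_Di.
have Vv := version_norm (Iv i).
have eVv := version_condexp (nes i) Vv.
have [mD _ e1] := Dv i; have [mV _ e2] := Vv; have [meV _ e3] := eVv.
have D2 := diff_op_L2 spP i f2; have [I2 _] := increment_L2 spP D2.
have V2 := Lpow_norm I2; have [eV2 _] := cexp_L2 spP (nes i) V2.
split.
- by apply: measurable_funM => //; exact: measurable_funD.
- exact: (L2M D2 (L2D V2 eV2)).
- by apply: filterS3 e1 e2 e3 => w -> -> e; rewrite /Defs.Ei e.
Qed.

Lemma Zseries_version : L1 mu (Zlim mu sp f) -> version (Zseries P Y F) (Zlim mu sp f).
Proof.
move=> Zi; split=> //.
- apply: measurable_limn => n; apply: measurable_sum => i.
  have [mD _ _] := Dv i; have [mI _ _] := Iv i; exact: measurable_funM.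
- have /ae_foralln := Zterm_version; apply: filterS => w e.
  rewrite /Zseries /Zlim; congr (limn _); apply/funext => n.
  by apply: eq_bigr => i _; exact: e.
Qed.

Lemma Zbar_version : L1 mu (Zblim mu sp f) -> version (Zbar_series P Y F) (Zblim mu sp f).
Proof.
move=> Zi; split=> //.
- apply: measurable_limn => n; apply: measurable_sum => i.
  by have [mD _ _] := Zbterm_version i.
- have /ae_foralln := fun i => let: And3 _ _ e := Zbterm_version i in e.
  apply: filterS => w e.
  rewrite /Zbar_series /Zblim; congr (limn _); apply/funext => n.
  by apply: eq_bigr => i _; exact: e.
Qed.

End series.
End versions.

(** * Finiteness of the two series in the remainder *)

Section extended_reals.
Local Open Scope ereal_scope.
Context (R : realType).

Lemma nneseries_ge_term (u : nat -> \bar R) (i : nat) : (forall j, 0 <= u j) ->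
  u i <= \sum_(0 <= j <oo) u j.
Proof.
move=> u0; apply: (@le_trans _ _ (\sum_(0 <= j < i.+1) u j)).
  by rewrite big_nat_recr//= leeDr//; exact: sume_ge0.
by apply: nneseries_lim_ge.
Qed.

(* Since 0 * +oo = 0 in [\bar R], this uses that A and B vanish simultaneously. *)
Lemma sqrt_sum_mul_lty (m : nat -> \bar R) (c : R) : (0 < c)%R -> (forall i, 0 <= m i) ->
  let A := \sum_(0 <= i <oo) sqrte (m i) in
  let B := \sum_(0 <= i <oo) (m i) `^ (3 / 4) in
  7%:E * sqrte A * B / c%:E != +oo -> A < +oo /\ B < +oo.
Proof.
move=> c0 m0 A B; apply: contra_neqP => /asboolPn; rewrite asbool_and negb_and.
have A0 : 0 <= A by apply: nneseries_ge0 => i _ _; exact: sqrte_ge0.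
have B0 : 0 <= B by apply: nneseries_ge0 => i _ _; exact: poweR_ge0.
have r34 : (3 / 4 : R)%R != 0%R by rewrite mulf_neq0.
have mA : (forall i, m i = 0) -> A = 0.
  by move=> h; apply: eseries0 => i _ _; rewrite h sqrte0.
have mB : (forall i, m i = 0) -> B = 0.
  by move=> h; apply: eseries0 => i _ _; rewrite h poweR0r.
have Am : A = 0 -> forall i, m i = 0.
  move=> Ae i; have : sqrte (m i) = 0.
    apply/eqP; rewrite eq_le sqrte_ge0 andbT -Ae.
    by apply: (@nneseries_ge_term (fun i => sqrte (m i))) => j; exact: sqrte_ge0.
  by move=> s0; rewrite -(sqr_sqrte (m0 i)) s0 expe2 mule0.
have Bm : B = 0 -> forall i, m i = 0.
  move=> Be i; have : (m i) `^ (3 / 4) = 0.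
    apply/eqP; rewrite eq_le poweR_ge0 andbT -Be.
    by apply: (@nneseries_ge_term (fun i => (m i) `^ (3 / 4))) => j; exact: poweR_ge0.
  exact: poweR_eq0_eq0.
have ci : c%:E^-1 = (c^-1)%:E by rewrite inver gt_eqF.
have cV : 0 < (c^-1)%:E by rewrite lte_fin invr_gt0.
have Apos : A != 0 -> 0 < sqrte A.
  move=> An; rewrite lt0e sqrte_ge0 andbT; apply: contra_neq An => s0.
  by rewrite -(sqr_sqrte A0) s0 expe2 mule0.
rewrite ci => /orP[] /asboolPn /negP; rewrite -leNgt leye_eq => /eqP e.
  have Bn : B != 0.
    by apply/eqP => /Bm/mA; rewrite e.
  rewrite e /= gt0_muley ?lte_fin// gt0_mulye; last by rewrite lt0e Bn B0.
  by rewrite gt0_mulye.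
have An : A != 0.
  by apply/eqP => /Am/mB; rewrite e.
by rewrite e gt0_muley ?gt0_mulye// mule_gt0// ?lte_fin// Apos.
Qed.

End extended_reals.

Section pushforward_moments.
Context d d' (T : measurableType d) (T' : measurableType d') (R : realType).
Variables (P : probability T R) (P' : probability T' R) (phi : T -> T').

Lemma preserves_L1_inv (f : T' -> R) : preserves P P' phi -> measurable_fun setT f ->
  L1 P (fun w => f (phi w)) -> L1 P' f.
Proof.
move=> pphi mf /integrableP[_ fi]; apply/integrableP; split; first exact/measurable_EFinP.
move: fi; rewrite (preserves_ge0_integral pphi (f := fun x => `|(f x)%:E|%E))//.
by apply: measurableT_comp => //; exact/measurable_EFinP.
Qed.

End pushforward_moments.

Theorem corollary3p1 (R : realType)
    (d : measure_display) (T : measurableType d) (P : probability T R)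
    (d' : measure_display) (S : measurableType d') (X : nat -> {RV P >-> S})
    (X_indep : independent_seq P (fun k => X k : T -> S))
    (d0 : measure_display) (T0 : measurableType d0) (Q : probability T0 R)
    (N : {RV Q >-> R})
    (N_normal : forall A : set R, measurable A ->
       distribution Q N A = normal_prob 0 1 A)
    (F : {RV P >-> R}) (F_of_X : function_of (fun k => X k : T -> S) F)
    (F_L2 : (F : T -> R) \in Lfun P 2%:E)
    (F_mean : ('E_P[F] = 0)%E)
    (sigma : R) (sigma_gt0 : 0 < sigma)
    (F_var : ('V_P[F] = (sigma ^+ 2)%:E)%E) :
  let Y := fun k => X k : T -> S in
  let Z := Zseries P Y F in
  let Zbar := Zbar_series P Y F in
  let remainder :=
    ((7%:E * sqrte (\sum_(0 <= i <oo) sqrte (moment4 P Y i F)) *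
       (\sum_(0 <= i <oo) (moment4 P Y i F) `^ (3 / 4))) /
       (2 * sigma ^+ 4)%:E +
     (Num.sqrt (2 * pi) / (4 * sigma ^+ 3))%:E * lyapunov P Y 3 F)%E in
  let bound1 :=
    (sqrte 'V_P[Z] / (sigma ^+ 2)%:E +
     sqrte 'V_P[Zbar] / (sigma ^+ 2)%:E + remainder)%E in
  let bound2 :=
    (sqrte (lyapunov P Y 2 Z) / (sigma ^+ 2)%:E +
     sqrte (lyapunov P Y 2 Zbar) / (sigma ^+ 2)%:E + remainder)%E in
  (kolmogorov_dist (sigma^-1 *: (F : {mfun T >-> R}) : {RV P >-> R}) N <= bound1)%E /\
  (bound1 <= bound2)%E.
Proof.
move=> Y Z Zbar remainder bound1 bound2.
have s2 : 0 < sigma ^+ 2 by rewrite exprn_gt0.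
have divE x : (x / (sigma ^+ 2)%:E = x * (sigma ^- 2)%:E)%E by rewrite inver gt_eqF.
have div_ge0 x : (0 <= x -> 0 <= x / (sigma ^+ 2)%:E)%E.
  by move=> x0; rewrite divE mule_ge0// lee_fin invr_ge0 ltW.
(* An infinite remainder makes both bounds +oo, the terms with square roots being nonnegative,
   whatever values the series Z and Zbar take. *)
have [roo|rfin] := eqVneq remainder +oo%E.
  have b x y : (0 <= x -> 0 <= y -> sqrte x / (sigma ^+ 2)%:E + sqrte y / (sigma ^+ 2)%:E
      + remainder = +oo)%E.
    by move=> x0 y0; rewrite roo addey// gt_eqF// (lt_le_trans ltNy0)// adde_ge0// div_ge0// sqrte_ge0.
  rewrite /bound1 /bound2 !b ?variance_ge0 ?lyapunov_ge0//.
  by split; exact: leey.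
have m0 i : (0 <= moment4 P Y i F)%E by exact: moment4_ge0.
have c0 : 0 < 2 * sigma ^+ 4 by rewrite mulr_gt0// exprn_gt0.
have L0 : (0 <= (Num.sqrt (2 * pi) / (4 * sigma ^+ 3))%:E * lyapunov P Y 3 F)%E.
  by rewrite mule_ge0 ?lyapunov_ge0// lee_fin divr_ge0 ?sqrtr_ge0// mulr_ge0// exprn_ge0// ltW.
(* The other summand of the remainder is nonnegative, so an infinite value here would make the
   remainder infinite. *)
have R1 : ((7%:E * sqrte (\sum_(0 <= i <oo) sqrte (moment4 P Y i F)) *
    (\sum_(0 <= i <oo) (moment4 P Y i F) `^ (3 / 4))) / (2 * sigma ^+ 4)%:E != +oo)%E.
  apply: contra_neq rfin => e; rewrite /remainder e addye//.
  by rewrite -ltNye (lt_le_trans ltNy0).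
have [Aoo Boo] := sqrt_sum_mul_lty c0 m0 R1.
case: F_of_X => f' mfwrt Ff'.
pose Om := g_sigma_algebraType (@seqsys d' S).
pose f : Om -> R := f'.
have Ff w : F w = f (joint X w) := Ff' w.
pose mu := joint_law X.
have mf : measurable_fun setT f.
  by move=> _ B mB; rewrite setTI; exact: mfwrt.
have FE : (F : T -> R) = fun w => f (joint X w) by apply/funext => w; exact: Ff.
have F2 : Lpow P 2 F by split; [exact: measurable_funP|exact: Lfun2_integrable_sqr].
have F1 := L2_L1 F2.
have f2 : Lpow mu 2 f.
  split=> //; apply: (@preserves_L1_inv _ _ _ _ _ P mu (joint X) (fun x => f x ^+ 2)).
  - exact: joint_preserves.
  - exact: measurable_funX.
  by have [_] := F2; rewrite FE.
have f1 := L2_L1 f2.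
have Fv : version X F f.
  by split; [exact: measurable_funP|by []|apply: aeW => w; exact: Ff].
have f0 : Ex mu f = 0 by apply: EFin_inj; rewrite -(version_Ex Fv).
have [_ f2i] := f2.
have fs : Ex mu (fun x => f x ^+ 2) = sigma ^+ 2.
  apply: EFin_inj; rewrite (ExE f2i) -F_var (version_variance Fv) f0.
  by apply: eq_integral => x _; rewrite subr0.
pose sp := @splice d' S.
have spP : resampling mu sp := joint_resampling X_indep.
(* The finite series of square roots dominates each of its terms, so each fourth moment is
   finite. *)
have D4 i : Lpow mu 4 (diff_op mu sp i f).
  apply: integrable_fin_pow.
  - exact: integrable_measurable (diff_op_L1 spP i f1).
  - by move=> x; exact: exprn_even_ge0.
  rewrite -(version_moment4 X_indep i Fv).
  rewrite -ge0_fin_numE ?moment4_ge0// -sqrte_fin_num ?moment4_ge0//.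
  rewrite ge0_fin_numE ?sqrte_ge0//; apply: le_lt_trans Aoo.
  by apply: (@nneseries_ge_term _ (fun i => sqrte (moment4 P Y i F))) => j; exact: sqrte_ge0.
have mE i : (moment4 P Y i F = (Ex mu (fun x => diff_op mu sp i f x ^+ 4))%:E)%E.
  by have [_ D4i] := D4 i; rewrite (ExE D4i) (version_moment4 X_indep i Fv).
have sE i : (sqrte (moment4 P Y i F) = (norm4 mu (diff_op mu sp i f) ^+ 2)%:E)%E.
  by rewrite mE norm4_sqr.
(* A fourth moment to the power 3/4 is the cube of the L4 norm, since 4 * (3/4) = 3. *)
have tE i : ((moment4 P Y i F) `^ (3 / 4) = (norm4 mu (diff_op mu sp i f) ^+ 3)%:E)%E.
  rewrite mE poweR_EFin -norm4_pow4 -powR_mulrn ?norm4_ge0// -powRrM.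
  have -> : 4%:R * (3 / 4) = 3%:R :> R by field.
  by rewrite powR_mulrn ?norm4_ge0.
have A0 : (0 <= \sum_(0 <= i <oo) sqrte (moment4 P Y i F))%E.
  by apply: nneseries_ge0 => i _ _; exact: sqrte_ge0.
have B0 : (0 <= \sum_(0 <= i <oo) (moment4 P Y i F) `^ (3 / 4))%E.
  by apply: nneseries_ge0 => i _ _; exact: poweR_ge0.
have Af := ge0_fin_numE A0; rewrite Aoo in Af.
have Bf := ge0_fin_numE B0; rewrite Boo in Bf.
set A := (\sum_(0 <= i <oo) sqrte (moment4 P Y i F))%E in A0 Aoo Af R1 remainder rfin bound1 bound2 *.
set B := (\sum_(0 <= i <oo) (moment4 P Y i F) `^ (3 / 4))%E in B0 Boo Bf R1 remainder rfin bound1 bound2 *.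
have SP n : \sum_(0 <= i < n) norm4 mu (diff_op mu sp i f) ^+ 2 <= fine A.
  rewrite -lee_fin fineK// -sumEFin; under eq_bigr do rewrite -sE.
  by apply: nneseries_lim_ge => i _ _; exact: sqrte_ge0.
have S3P n : \sum_(0 <= i < n) norm4 mu (diff_op mu sp i f) ^+ 3 <= fine B.
  rewrite -lee_fin fineK// -sumEFin; under eq_bigr do rewrite -tE.
  by apply: nneseries_lim_ge => i _ _; exact: poweR_ge0.
have dn := joint_dense X_indep.
have Zi := Zlim_L1 spP dn f2 f0 D4 SP.
have Zbi := Zblim_L1 spP dn f2 f0 D4 SP.
have Zv : version X Z _ := Zseries_version X_indep Fv Zi.
have Zbv : version X Zbar _ := Zbar_version X_indep Fv f2 Zbi.
have EZ := Ex_Zlim spP dn f2 f0 fs D4 SP.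
have EZb := Ex_Zblim spP dn f2 f0 D4 SP.
have remE : ((7%:E * sqrte A * B) / (2 * sigma ^+ 4)%:E =
    (7 / 2 * Num.sqrt (fine A) * fine B * sigma^-1 ^+ 4)%:E)%E.
  rewrite -{1}(fineK Af) -{1}(fineK Bf) inver gt_eqF//= -!EFinM; congr EFin.
  by field; rewrite gt_eqF.
have vle W h : version X W h -> forall r, Ex mu h = r ->
    ((sigma^-1 ^+ 2 * Ex mu (fun x => `|h x - r|))%:E <= sqrte 'V_P[W] / (sigma ^+ 2)%:E)%E.
  move=> Wv r <-; rewrite divE -exprVn muleC EFinM.
  by rewrite lee_wpmul2l ?lee_fin ?sqr_ge0// Ex_centered_le.
split; last first.
  apply: leeD => //; apply: leeD; rewrite !divE; apply: lee_wpmul2r;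
    rewrite ?lee_fin ?invr_ge0 ?(ltW s2)// lee_sqrt ?lyapunov_ge0//.
    exact: (variance_le_lyapunov X_indep Zv).
  exact: (variance_le_lyapunov X_indep Zbv).
apply: ge_ereal_sup => _ [z _ <-].
have := @stein_malliavin_bound _ _ _ _ _ spP dn f sigma (fine A) (fine B) f2 f0 sigma_gt0 fs D4 SP S3P z.
set W := Ex mu _ => Wle.
have -> : cdf N z = (Phi z)%:E.
  by rewrite /cdf N_normal// /Phi fineK// fin_num_measure.
have -> : cdf (sigma^-1 *: (F : {mfun T >-> R}) : {RV P >-> R}) z = W%:E.
  pose A' : set Om := [set x | f x / sigma <= z].
  have mA' : measurable A'.
    have := measurable_fun_ler (measurable_funM mf (measurable_cst sigma^-1)) (measurable_cst z).
    by move=> /(_ measurableT [set true]); rewrite setTI; apply.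
  transitivity (mu A').
    rewrite /cdf /mu /joint_law /distribution /pushforward; congr (P _).
    have GE w : (sigma^-1 *: (F : {mfun T >-> R}) : {mfun T >-> R}) w = f (joint X w) / sigma.
      by rewrite mulrC -Ff.
    by apply/seteqP; split=> w /=; rewrite in_itv/= /A'/= -GE; exact.
  have -> : W = Ex mu (\1_A').
    by congr Ex; apply/funext => x; rewrite indicE mem_setE.
  rewrite ExE; first by rewrite integral_indic// setIT.
  by apply: integrable_indic => //; rewrite ltey_eq fin_num_measure.
rewrite -EFinB abse_EFin; apply: (@le_trans _ _ (_)%:E).
  by rewrite lee_fin; exact: Wle.
rewrite !EFinD; apply: leeD.
  apply: leeD; first exact: vle.
  have := vle _ _ Zbv 0 EZb.
  by under [X in (_ * Ex _ X)%:E]eq_fun do rewrite subr0.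
by rewrite -remE leeDl.
Qed.
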